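(* Let $X$ be an irreducible, non-Euclidean, unbounded, locally finite, finite-dimensional CAT(0) cube complex. Then for any discrete subgroup $G\subset \mathrm{Aut}(X)$ acting properly on $X$, the action of $G$ on $\mathcal U_{NT}(X)$ is Borel amenable, and hence also universally (or measure-wise) amenable.
   Context: **Cube complexes.** A CAT(0) cube complex is a simply connected cell complex whose closed cells are Euclidean cubes $[0,1]^n$, such that any two cubes are disjoint or meet in a single face of each, and links of vertices are flag simplicial complexes. A hyperplane $\hat{\mathfrak h}$ is a (connected) subspace meeting each cube in the empty set or in a single midcube; its complement has exactly two components, the half-spaces $\mathfrak h,\mathfrak h^*$. $\mathcal H$ is the set of half-spaces. $\mathrm{Aut}(X)$ is the group of cellular automorphisms. $X$ is irreducible if it does not decompose as a nontrivial product of cube complexes. An unbounded CAT(0) cube complex with cocompact automorphism group is Euclidean if it contains an $\mathrm{Aut}(X)$-invariant flat (isometrically embedded Euclidean space), and non-Euclidean otherwise. **Ultrafilters.** An ultrafilter is a subset $\alpha\subset\mathcal H$ containing exactly one of $\mathfrak h,\mathfrak h^*$ for each hyperplane, and such that $\mathfrak h\in\alpha$, $\mathfrak h\subset\mathfrak h'$ imply $\mathfrak h'\in\alpha$. $\mathcal U(X)$ is the set of ultrafilters with the topology induced from the product topology on $\prod_{\hat{\mathfrak h}}\{\mathfrak h,\mathfrak h^*\}$; $\mathrm{Aut}(X)$ acts by $g\alpha=\{g\mathfrak h:\mathfrak h\in\alpha\}$. An ultrafilter $\alpha$ is nonterminating if for every $\mathfrak h\in\alpha$ there is $\mathfrak h'\in\alpha$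 with $\mathfrak h'\subsetneq\mathfrak h$. $\mathcal U_{NT}(X)\subset\mathcal U(X)$ is the set of nonterminating ultrafilters, with the induced Borel structure. **Amenability.** For a countable group $G$, $P_c(G)$ denotes the finitely supported probability measures on $G$, with the $\ell^1(G)$-norm and the translation action $\mu\mapsto g\mu$. A $G$-action on a standard Borel space $B$ is Borel amenable if there are Borel maps $\beta_n:B\to P_c(G)$ with $\lim_{n\to\infty}\|\beta_n(gb)-g\beta_n(b)\|=0$ for every $b\in B$ and $g\in G$. It is universally (measure-wise) amenable if for every $G$-quasi-invariant probability measure $\eta$ on $B$ there are measurable maps $\beta_n$ to $P_c(G)$, defined and satisfying $\lim_{n\to\infty}\|\beta_n(gb)-g\beta_n(b)\|=0$ (for all $g\in G$) for $\eta$-almost every $b\in B$. *)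

(* Defs.v *)
From HB Require Import structures.
From mathcomp Require Import all_boot all_order all_algebra.
From mathcomp Require Import all_classical all_reals all_analysis.
From mathcomp Require Import ring lra.

Set Implicit Arguments.
Unset Strict Implicit.
Unset Printing Implicit Defensive.

Import Order.TTheory GRing.Theory Num.Theory.
Import numFieldNormedType.Exports.

Local Open Scope classical_set_scope.
Local Open Scope ring_scope.

Section EuclideanCube.
Context {R : realType}.

Definition edist {n} (s t : 'rV[R]_n) : R :=
  Num.sqrt (\sum_i (s 0 i - t 0 i) ^+ 2).

Definition icube n : set 'rV[R]_n := [set t | forall i, 0 <= t 0 i <= 1].

(* A face fixes some of the coordinates to 0 or 1; [F i = None] leaves the
   i-th coordinate free. *)
Definition cube_face n (F : 'I_n -> option bool) : set 'rV[R]_n :=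
  [set t | icube t /\ forall i b, F i = Some b -> t 0 i = b%:R].

Definition midcube n (i : 'I_n) : set 'rV[R]_n :=
  [set t | icube t /\ t 0 i = 2^-1].

End EuclideanCube.

(* The closed cells of a complex are given by injective characteristic maps
   [chart c : [0,1]^(dim c) -> point]; the value of [chart c] outside the unit
   cube is irrelevant.  In [cell_meet], the last clause says that the two faces
   along which cells c and d meet are identified by a Euclidean isometry. *)
Record cubeComplex (R : realType) := CubeComplex {
  point :> Type;
  cell : Type;
  dim : cell -> nat;
  chart : forall c : cell, 'rV[R]_(dim c) -> point;
  chart_inj : forall c, set_inj (icube (n := dim c)) (chart (c := c));
  chart_cover : forall p : point, exists c, (chart (c := c) @` icube (n := _)) p;
  cell_inj : forall c d,
    chart (c := c) @` icube (n := _) = chart (c := d) @` icube (n := _) -> c = d;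
  cell_face : forall c (F : 'I_(dim c) -> option bool),
    exists d, chart (c := d) @` icube (n := _) = chart (c := c) @` cube_face F;
  cell_meet : forall c d,
    let I := chart (c := c) @` icube (n := _) `&`
             chart (c := d) @` icube (n := _) in
    I !=set0 ->
    exists (F : 'I_(dim c) -> option bool) (F' : 'I_(dim d) -> option bool),
      [/\ chart (c := c) @` cube_face F = I,
          chart (c := d) @` cube_face F' = I &
          forall s s' t t', cube_face F s -> cube_face F s' ->
            cube_face F' t -> cube_face F' t' ->
            chart s = chart t -> chart s' = chart t' ->
            edist s s' = edist t t']
}.

Section CellTopology.
Context {R : realType} (X : cubeComplex R).

HB.instance Definition _ := gen_eqMixin (point X).
HB.instance Definition _ := gen_choiceMixin (point X).

Definition closed_cell (c : cell X) : set X := @chart R X c @` icube (n := _).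

(* The weak topology of the cell complex: a set is open iff its trace on each
   closed cell is open. *)
Definition cell_open : set (set X) := [set U | forall c : cell X,
  open (@chart R X c @^-1` U : set (subspace (icube (n := dim c))))].

Let cell_openT : cell_open setT.
Proof. by move=> c; rewrite preimage_setT; exact: openT. Qed.

Let cell_openI : setI_closed cell_open.
Proof. by move=> A B oA oB c; rewrite preimage_setI; exact: openI. Qed.

Let cell_open_bigU (I : Type) (f : I -> set X) :
  (forall i, cell_open (f i)) -> cell_open (\bigcup_i f i).
Proof.
by move=> of_ c; rewrite preimage_bigcup; apply: bigcup_open => i _; exact: of_.
Qed.

HB.instance Definition _ :=
  isOpenTopological.Build (point X) cell_openT cell_openI cell_open_bigU.

End CellTopology.

Section SimplyConnected.
Variable (R : realType).

Definition path_connected (T : topologicalType) := forall x y : T,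
  exists2 f : R -> T, {within `[0, 1], continuous f} & f 0 = x /\ f 1 = y.

Definition null_homotopic (T : topologicalType) (f : R -> T) :=
  exists2 h : R * R -> T, {within `[0, 1] `*` `[0, 1], continuous h} &
    forall t, t \in `[0, 1] ->
      [/\ h (t, 0) = f t, h (t, 1) = f 0, h (0, t) = f 0 & h (1, t) = f 0].

Definition simply_connected (T : topologicalType) :=
  [/\ [set: T] !=set0, path_connected T &
      forall f : R -> T, {within `[0, 1], continuous f} -> f 0 = f 1 ->
        null_homotopic f].

End SimplyConnected.

Definition simplicial_complex T (K : set (set T)) :=
  (forall A, K A -> finite_set A /\ A !=set0) /\
  (forall A B, K A -> B `<=` A -> B !=set0 -> K B).

Definition flag_complex T (K : set (set T)) :=
  simplicial_complex K /\
  forall A, finite_set A -> A !=set0 ->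
    (forall x y, A x -> A y -> K [set x; y]) -> K A.

Section CubeComplexTheory.
Context {R : realType}.
Implicit Types X Y Z : cubeComplex R.

Definition vertex X (v : X) :=
  exists2 c : cell X, dim c = 0%N & closed_cell c = [set v].

Definition edges_at X (v : X) (c : cell X) : set (cell X) := [set e |
  dim e = 1%N /\ closed_cell e v /\ closed_cell e `<=` closed_cell c].

(* The vertices of the link of v are the edges at v (edges are embedded, so
   each edge has only one end at v), and each cube of positive dimension at v
   spans the simplex of the edges at v which it contains. *)
Definition link X (v : X) : set (set (cell X)) := [set A |
  exists2 c : cell X, (0 < dim c)%N /\ closed_cell c v & A = edges_at v c].

Definition CAT0_cube_complex X :=
  simply_connected R (point X) /\
  forall v : X, vertex v -> flag_complex (link v).

Definition locally_finite X :=
  forall v : X, vertex v -> finite_set [set c : cell X | closed_cell c v].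

Definition finite_dimensional X :=
  exists n : nat, forall c : cell X, (dim c <= n)%N.

Definition coord X (c : cell X) (p : X) : 'rV[R]_(dim c) :=
  xget 0 [set t | icube t /\ chart t = p].

Definition cell_dist X (c : cell X) (p q : X) : R :=
  edist (coord c p) (coord c q).

(* [string_from_to p q l]: some sequence of points from p to q, any two
   consecutive ones lying in a common closed cell, has length l. *)
Inductive string_from_to X : X -> X -> R -> Prop :=
| string_nil p : string_from_to p p 0
| string_cons c p q r l : closed_cell c p -> closed_cell c q ->
    string_from_to q r l -> string_from_to p r (cell_dist c p q + l).

Definition cc_dist X (p q : X) : R := inf [set l | string_from_to p q l].

Definition unbounded X := forall M : R, exists p q : X, M < cc_dist p q.

Definition flat X (E : set X) := exists n (f : 'rV[R]_n -> X),
  (forall s t, cc_dist (f s) (f t) = edist s t) /\ E = range f.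

Definition product_decomposition X Y Z (f : Y * Z -> X) :=
  [/\ bijective f,
      forall (a : cell Y) (b : cell Z), exists2 c : cell X,
        f @` (closed_cell a `*` closed_cell b) = closed_cell c &
        forall y y' z z', closed_cell a y -> closed_cell a y' ->
          closed_cell b z -> closed_cell b z' ->
          cell_dist c (f (y, z)) (f (y', z')) ^+ 2 =
          cell_dist a y y' ^+ 2 + cell_dist b z z' ^+ 2 &
      forall c : cell X, exists (a : cell Y) (b : cell Z),
        f @` (closed_cell a `*` closed_cell b) = closed_cell c].

Definition irreducible X := ~ exists (Y Z : cubeComplex R) (f : Y * Z -> X),
  [/\ (exists y y' : Y, y <> y'), (exists z z' : Z, z <> z') &
      product_decomposition f].

(* Adjacent cubes force H to contain, with a midcube, every midcube parallel to
   it, so that H is automatically a whole hyperplane. *)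
Definition hyperplane X (H : set X) :=
  [/\ H !=set0, connected H &
      forall c : cell X, H `&` closed_cell c = set0 \/
        exists i : 'I_(dim c), H `&` closed_cell c = @chart R X c @` midcube i].

Definition halfspace_of X (H h : set X) :=
  exists2 p, (~` H) p & h = connected_component (~` H) p.

Definition halfspace X (h : set X) :=
  exists2 H, hyperplane H & halfspace_of H h.

Definition ultrafilter X (a : set (set X)) :=
  [/\ a `<=` halfspace (X := X),
      forall H, hyperplane H -> exists! h, halfspace_of H h /\ a h &
      forall h h', a h -> halfspace h' -> h `<=` h' -> a h'].

Definition nonterminating X (a : set (set X)) :=
  forall h, a h -> exists2 h', a h' & h' `<` h.

End CubeComplexTheory.

Definition ultraNT (R : realType) (X : cubeComplex R) : Type :=
  {a : set (set X) | ultrafilter a /\ nonterminating a}.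

Section UltraTopology.
Context {R : realType} (X : cubeComplex R).

(* U(X) has the topology induced from the product of the two-point sets
   {h, h*}; coding a by its indicator on all subsets of X gives the same induced
   topology, since a subset which is not a half-space is never in a. *)
Definition ultra_indicator (a : ultraNT X) : {ptws set X -> bool} :=
  fun h => `[< sval a h >].

HB.instance Definition _ := gen_eqMixin (ultraNT X).
HB.instance Definition _ := gen_choiceMixin (ultraNT X).
HB.instance Definition _ :=
  Topological.copy (ultraNT X) (initial_topology ultra_indicator).

End UltraTopology.

(* The isometries of unit cubes preserve midcubes: vertices are the points at
   maximal distance from some other point, and a midcube consists of the points
   equidistant from two given adjacent vertices. *)
Section CubeIsometry.
Context {R : realType}.

Let sqd n (s t : 'rV[R]_n) : R := \sum_i (s 0 i - t 0 i) ^+ 2.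

Let sqd_ge0 n (s t : 'rV[R]_n) : 0 <= sqd s t.
Proof. by apply: sumr_ge0 => i _; exact: sqr_ge0. Qed.

Let term_le1 n (s t : 'rV[R]_n) i : icube s -> icube t ->
  (s 0 i - t 0 i) ^+ 2 <= 1.
Proof.
by move=> /(_ i)/andP[s0 s1] /(_ i)/andP[t0 t1]; nra.
Qed.

Let sqd_le n (s t : 'rV[R]_n) : icube s -> icube t -> sqd s t <= n%:R.
Proof.
move=> cs ct; rewrite -[leRHS](_ : \sum_(i < n) 1 = _).
  by apply: ler_sum => i _; exact: term_le1.
by rewrite sumr_const card_ord.
Qed.

Let sqd_max n (s t : 'rV[R]_n) : icube s -> icube t -> sqd s t = n%:R ->
  forall i, s 0 i = 0 \/ s 0 i = 1.
Proof.
move=> cs ct st i.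
have st1 : (s 0 i - t 0 i) ^+ 2 = 1.
  apply/eqP; rewrite eq_le term_le1//= leNgt; apply/negP => lt1.
  suff : sqd s t < n%:R by rewrite st ltxx.
  rewrite -[ltRHS](_ : \sum_(j < n) 1 = _); last by rewrite sumr_const card_ord.
  rewrite /sqd (bigD1 i)//= [ltRHS](bigD1 i)//= ltr_leD//.
  by apply: ler_sum => j _; exact: term_le1.
have /andP[s0 s1] := cs i; have /andP[t0 t1] := ct i.
have /eqP := st1; rewrite sqrf_eq1 => /orP[|] /eqP ?; [right|left]; lra.
Qed.

Let sqd_edist n m (s t : 'rV[R]_n) (s' t' : 'rV[R]_m) :
  edist s t = edist s' t' -> sqd s t = sqd s' t'.
Proof.
move=> /(congr1 (fun x => x ^+ 2)); rewrite /edist !sqr_sqrtr//;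
  exact: sqd_ge0.
Qed.

Lemma cube_isometry_midcube m n (f : 'rV[R]_m -> 'rV[R]_n) :
    (forall s, icube s -> icube (f s)) ->
    (forall t, icube t -> exists2 s, icube s & f s = t) ->
    (forall s s', icube s -> icube s' -> edist (f s) (f s') = edist s s') ->
  forall i, exists j, forall s, icube s -> midcube i s <-> midcube j (f s).
Proof.
move=> fI fsurj fd i.
have c0 k : icube (0 : 'rV[R]_k) by move=> j; rewrite mxE lexx ler01.
have c1 k : icube (const_mx 1 : 'rV[R]_k) by move=> j; rewrite mxE lexx ler01.
have d01 k : sqd (0 : 'rV[R]_k) (const_mx 1) = k%:R.
  rewrite /sqd (eq_bigr (fun=> 1)) ?sumr_const ?card_ord// => j _.
  by rewrite !mxE sub0r sqrrN expr1n.
have fsqd s s' : icube s -> icube s' -> sqd (f s) (f s') = sqd s s'.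
  by move=> cs cs'; apply: sqd_edist; exact: fd.
have mn : m = n.
  apply/eqP; rewrite eqn_leq -!(ler_nat R) -!d01; apply/andP; split.
    by rewrite -fsqd// d01 sqd_le//; exact: fI.
  have [s cs <-] := fsurj _ (c0 n); have [t ct <-] := fsurj _ (c1 n).
  by rewrite fsqd// d01 sqd_le.
have vert v : icube v -> (forall j, v 0 j = 0 \/ v 0 j = 1) ->
    forall j, f v 0 j = 0 \/ f v 0 j = 1.
  move=> cv vv; pose w := \row_j (1 - v 0 j).
  have cw : icube w by move=> j; rewrite mxE; have /andP[? ?] := cv j; lra.
  apply: (@sqd_max _ _ (f w)); [exact: fI|exact: fI|].
  rewrite fsqd// -mn /sqd (eq_bigr (fun=> 1)) ?sumr_const ?card_ord// => j _.
  by rewrite mxE; case: (vv j) => ->; ring.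
pose e : 'rV[R]_m := delta_mx 0 i.
have ev j : e 0 j = (j == i)%:R by rewrite mxE.
have ce : icube e by move=> j; rewrite ev; case: eqP; rewrite ?lexx ler01.
have v0 := vert _ (c0 m) (fun j => or_introl (mxE _ _ _ _)).
have v1 : forall j, f e 0 j = 0 \/ f e 0 j = 1.
  by apply: vert => // j; rewrite ev; case: eqP; [right|left].
have d1 : sqd (f 0) (f e) = 1.
  rewrite fsqd// /sqd (bigD1 i)//= big1 => [|j /negbTE ji]; rewrite ev mxE.
    by rewrite eqxx sub0r sqrrN expr1n addr0.
  by rewrite ji subrr expr0n.
have [j fj] : exists j, f 0 0 j <> f e 0 j.
  apply: contrapT => /forallNP H; move: d1; rewrite /sqd big1 => [/esym/eqP|j _].
    by rewrite oner_eq0.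
  by have /contrapT -> := H j; rewrite subrr expr0n.
have fj1 : (f 0 0 j - f e 0 j) ^+ 2 = 1.
  by case: (v0 j) (v1 j) fj => -> [] -> // _; ring.
have fk k : k != j -> f 0 0 k = f e 0 k.
  move=> kj; apply/eqP; rewrite -subr_eq0 -sqrf_eq0.
  move: d1; rewrite /sqd (bigD1 j)//= fj1 => /eqP.
  rewrite -subr_eq0 addrAC subrr add0r psumr_eq0 => [/allP/(_ k)|? _]; last exact: sqr_ge0.
  by rewrite mem_index_enum kj => /(_ isT).
have eqd s : icube s -> midcube i s <-> sqd s 0 = sqd s e.
  move=> cs; rewrite /sqd (bigD1 i)//= [RHS](bigD1 i)//= ev eqxx mulr1n mxE.
  rewrite [in X in _ = _ + X](eq_bigr (fun k => (s 0 k - (0 : 'rV[R]_m) 0 k) ^+ 2)); last first.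
    by move=> k /negbTE ki; rewrite ev ki mxE.
  split=> [[_ ->]|/addIr H]; first by congr (_ + _); rewrite -sqrrN; congr (_ ^+ 2); lra.
  by split => //; nra.
exists j => s cs.
rewrite eqd// -fsqd// -[sqd s e]fsqd//.
rewrite /sqd (bigD1 j)//= [X in _ = X <-> _](bigD1 j)//=.
rewrite [in X in _ = _ + X <-> _](eq_bigr (fun k => (f s 0 k - f 0 0 k) ^+ 2)); last first.
  by move=> k kj; rewrite fk.
split=> [/addIr H|[_ ->]].
  split; first exact: fI.
  by move: H fj; case: (v0 j) (v1 j) => -> [] -> // H _; nra.
by congr (_ + _); move: fj; case: (v0 j) (v1 j) => -> [] -> // _; rewrite -sqrrN; congr (_ ^+ 2); lra.
Qed.

End CubeIsometry.

Definition cellular (R : realType) (X : cubeComplex R) (f : X -> X) :=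
  forall c : cell X, exists2 d : cell X, f @` closed_cell c = closed_cell d &
    forall p q, closed_cell c p -> closed_cell c q ->
      cell_dist d (f p) (f q) = cell_dist c p q.

(* The topological fields are consequences of the cellular ones; they are kept
   so that automorphisms are visibly homeomorphisms. *)
Record aut (R : realType) (X : cubeComplex R) := Aut {
  aut_fun :> X -> X;
  aut_inv : X -> X;
  aut_funK : cancel aut_fun aut_inv;
  aut_invK : cancel aut_inv aut_fun;
  aut_continuous : continuous aut_fun;
  aut_inv_continuous : continuous aut_inv;
  aut_cellular : cellular aut_fun;
  aut_inv_cellular : cellular aut_inv
}.

Section AutGroup.
Context {R : realType} (X : cubeComplex R).
Implicit Types g h : aut X.

Lemma aut_eqP g h : aut_fun g = aut_fun h -> g = h.
Proof.
case: g h => [f f' fK f'K cf cf' lf lf'] [k k' kK k'K ck ck' lk lk'] /= fk.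
subst k; have f'k' : f' = k' by apply/funext => x; rewrite -{1}(k'K x) fK.
subst k'; congr Aut; exact: Prop_irrelevance.
Qed.


HB.instance Definition _ := gen_eqMixin (aut X).
HB.instance Definition _ := gen_choiceMixin (aut X).

Let cellular_id : cellular (@id X).
Proof. by move=> c; exists c => //; rewrite image_id. Qed.

Let cellular_comp (f f' : X -> X) :
  cellular f -> cellular f' -> cellular (f \o f').
Proof.
move=> lf lf' c; have [d cd dE] := lf' c; have [e de eE] := lf d.
exists e; first by rewrite -image_comp cd.
by move=> p q cp cq; rewrite /= eE ?dE // -cd; [exists p|exists q].
Qed.

Definition aut_one : aut X :=
  @Aut R X id id (fun=> erefl) (fun=> erefl) (fun=> cvg_id) (fun=> cvg_id)
    cellular_id cellular_id.

Definition aut_rev g : aut X :=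
  @Aut R X (aut_inv g) g (@aut_invK _ _ g) (@aut_funK _ _ g)
    (@aut_inv_continuous _ _ g) (@aut_continuous _ _ g)
    (@aut_inv_cellular _ _ g) (@aut_cellular _ _ g).

Let comp_cts (f f' : X -> X) :
  continuous f -> continuous f' -> continuous (f \o f').
Proof. by move=> cf cf' x; apply: continuous_comp; [exact: cf'|exact: cf]. Qed.

Definition aut_mul g h : aut X :=
  @Aut R X (g \o h) (aut_inv h \o aut_inv g)
    (can_comp (@aut_funK _ _ g) (@aut_funK _ _ h))
    (can_comp (@aut_invK _ _ h) (@aut_invK _ _ g))
    (comp_cts (@aut_continuous _ _ g) (@aut_continuous _ _ h))
    (comp_cts (@aut_inv_continuous _ _ h) (@aut_inv_continuous _ _ g))
    (cellular_comp (@aut_cellular _ _ g) (@aut_cellular _ _ h))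
    (cellular_comp (@aut_inv_cellular _ _ h) (@aut_inv_cellular _ _ g)).

Let aut_mulA : associative aut_mul.
Proof. by move=> g h k; exact: aut_eqP. Qed.

Let aut_mul1 : left_id aut_one aut_mul.
Proof. by move=> g; exact: aut_eqP. Qed.

Let aut_1mul : right_id aut_one aut_mul.
Proof. by move=> g; exact: aut_eqP. Qed.

Let aut_mulV : left_inverse aut_one aut_rev aut_mul.
Proof. by move=> g; apply: aut_eqP; apply/funext => x /=; rewrite aut_funK. Qed.

Let aut_Vmul : right_inverse aut_one aut_rev aut_mul.
Proof. by move=> g; apply: aut_eqP; apply/funext => x /=; rewrite aut_invK. Qed.

HB.instance Definition _ := isGroup.Build (aut X)
  aut_mulA aut_mul1 aut_1mul aut_mulV aut_Vmul.

Definition aut_compact_open (g : aut X) : {compact-open, point X -> point X} :=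
  aut_fun g.

HB.instance Definition _ :=
  Topological.copy (aut X) (initial_topology aut_compact_open).

Definition cocompact_aut := exists2 K : set X, compact K &
  \bigcup_(g in [set: aut X]) (g @` K) = [set: X].

(* X not having a cocompact automorphism group makes it non-Euclidean here. *)
Definition Euclidean :=
  [/\ unbounded X, cocompact_aut &
      exists2 E : set X, flat E & forall g, g @` E = E].

End AutGroup.

Section UltraAction.
Context {R : realType} (X : cubeComplex R).
Implicit Types (g : aut X) (H h : set X) (c d : cell X).

Let coordP c p : closed_cell c p -> icube (coord c p) /\ chart (coord c p) = p.
Proof.
move=> [t ct tp]; rewrite /coord.
by have := @xgetPex _ 0 [set t | icube t /\ chart t = p]; apply; exists t.
Qed.

Let coordK c t : icube t -> coord c (chart t) = t.
Proof.
move=> ct; have [] : icube (coord c (chart t)) /\ _ := coordP _; first by exists t.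
by move=> i E; apply: (@chart_inj _ X c); rewrite ?inE.
Qed.

Let aut_inj g : injective g. Proof. exact: can_inj (@aut_funK _ _ g). Qed.

Let imageK g A : aut_inv g @` (g @` A) = A.
Proof.
rewrite image_comp (_ : _ \o _ = id) ?image_id//.
by apply/funext => x /=; rewrite aut_funK.
Qed.

Let imageVK g A : g @` (aut_inv g @` A) = A. Proof. exact: imageK (aut_rev g) A. Qed.

Let aut_midcube g c d : g @` closed_cell d = closed_cell c ->
  forall i, exists j, g @` (@chart R X d @` midcube i) = @chart R X c @` midcube j.
Proof.
move=> gdc i; have [c' gdc' gd] := aut_cellular g d.
have E : c' = c.
  by apply: cell_inj; rewrite -/(closed_cell c') -/(closed_cell c) -gdc'.
clear gdc'; subst c'.
have gcell s : icube s -> closed_cell c (g (@chart R X d s)).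
  by move=> cs; rewrite -gdc; exists (chart s) => //; exists s.
pose f s := coord c (g (@chart R X d s)).
have [|||j fj] := @cube_isometry_midcube R _ _ f _ _ _ i.
- by move=> s /gcell /coordP[].
- move=> t ct; have : closed_cell c (@chart R X c t) by exists t.
  by rewrite -gdc => -[p [s cs <-] E]; exists s => //; rewrite /f E coordK.
- move=> s s' cs cs'; have := gd (@chart R X d s) (@chart R X d s').
  by rewrite /cell_dist !coordK// => ->//; [exists s|exists s'].
exists j; apply/seteqP; split=> [_ [_ [s ms <-] <-]|_ [t mt <-]].
  have cs := ms.1; have [_ fs] := coordP (gcell _ cs).
  by exists (f s) => //; exact/fj.
have : closed_cell c (@chart R X c t) by exists t => //; exact: mt.1.
rewrite -gdc => -[p [s cs <-] E]; exists (chart s) => //; exists s => //.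
by apply/fj => //; rewrite /f E coordK//; exact: mt.1.
Qed.

Let aut_connected g A : connected A -> connected (g @` A).
Proof.
move=> cA; apply: connected_continuous_connected => //.
by apply: continuous_subspaceT => x; exact: aut_continuous.
Qed.

Lemma aut_hyperplane g H : hyperplane H -> hyperplane (g @` H).
Proof.
move=> [[p Hp] cH mH]; split; first by exists (g p), p.
  exact: aut_connected.
move=> c; have [d cd _] := aut_inv_cellular g c.
have dc : g @` closed_cell d = closed_cell c by rewrite -cd imageVK.
have -> : g @` H `&` closed_cell c = g @` (H `&` closed_cell d).
  rewrite -dc; apply/seteqP; split=> [_ [[x Hx <-] [y dy /aut_inj yx]]|].
    by subst y; exists x.
  by move=> _ [x [Hx dx] <-]; split; exists x.
have [->|[i ->]] := mH d; [by left; rewrite image_set0|right].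
exact: aut_midcube.
Qed.

Let aut_component_sub g A x :
  g @` connected_component A x `<=` connected_component (g @` A) (g x).
Proof.
move=> _ [y [B [Bx BA cB By]] <-]; exists (g @` B); last by exists y.
by split; [exists x|exact: image_subset|exact: aut_connected].
Qed.

Let aut_component g A x :
  g @` connected_component A x = connected_component (g @` A) (g x).
Proof.
apply/seteqP; split; first exact: aut_component_sub.
rewrite -[X in X `<=` _](imageVK g); apply: image_subset.
have := @aut_component_sub (aut_rev g) (g @` A) (g x).
by rewrite /= imageK aut_funK.
Qed.

Let aut_setC g A : g @` (~` A) = ~` (g @` A).
Proof.
apply/seteqP; split=> [_ [x nAx <-] [y Ay /aut_inj yx]|x nAx].
  by apply: nAx; rewrite -yx.
exists (aut_inv g x); last exact: aut_invK.
by move=> Ax; apply: nAx; exists (aut_inv g x) => //; exact: aut_invK.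
Qed.

Lemma aut_halfspace_of g H h :
  halfspace_of H h -> halfspace_of (g @` H) (g @` h).
Proof.
move=> [p Hp ->]; exists (g p); last by rewrite aut_component aut_setC.
by rewrite -aut_setC; exists p.
Qed.

Lemma aut_halfspace g h : halfspace h -> halfspace (g @` h).
Proof.
move=> [H hH Hh]; exists (g @` H); first exact: aut_hyperplane.
exact: aut_halfspace_of.
Qed.

Definition ultra_image g (a : set (set X)) : set (set X) :=
  [set g @` h | h in a].

Lemma ultra_image_subproof g (a : ultraNT X) :
  ultrafilter (ultra_image g (sval a)) /\ nonterminating (ultra_image g (sval a)).
Proof.
case: a => a /= [[ha ua sa] na]; split; last first.
  move=> _ [h ah <-]; have [h' ah' [h'h hh']] := na _ ah.
  exists (g @` h'); first by exists h'.
  split; first exact: image_subset.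
  by move=> /(@image_subset _ _ (aut_inv g)); rewrite !imageK.
split.
- by move=> _ [h ah <-]; apply: aut_halfspace; exact: ha.
- move=> H hH; have /ua : hyperplane (aut_inv g @` H).
    exact: (@aut_hyperplane (aut_rev g)).
  move=> [h [[Hh ah] uh]]; exists (g @` h); split.
    by split; [have := aut_halfspace_of g Hh; rewrite imageVK|exists h].
  move=> k' [Hk [k ak kk']]; subst k'; congr (_ @` _); apply: uh; split => //.
  by have := aut_halfspace_of (aut_rev g) Hk; rewrite /= imageK.
- move=> _ h' [h ah <-] hh' gh; exists (aut_inv g @` h'); last exact: imageVK.
  apply: (sa _ _ ah); first exact: (@aut_halfspace (aut_rev g)).
  by rewrite -(imageK g h); exact: image_subset.
Qed.

Definition ultra_act g (a : ultraNT X) : ultraNT X :=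
  exist _ (ultra_image g (sval a)) (ultra_image_subproof g a).

Let sval_inj (a b : ultraNT X) : sval a = sval b -> a = b.
Proof.
by case: a b => [a pa] [b pb] /= ab; subst b; rewrite (Prop_irrelevance pa pb).
Qed.

Lemma ultra_act1 a : ultra_act 1%g a = a.
Proof.
apply: sval_inj => /=; apply/seteqP; split=> [_ [h ah <-]|h ah].
  by rewrite image_id.
by exists h => //; rewrite image_id.
Qed.

Lemma ultra_actM g g' a : ultra_act (g * g')%g a = ultra_act g (ultra_act g' a).
Proof.
apply: sval_inj => /=; apply/seteqP; split=> [_ [h ah <-]|_ [_ [h ah <-] <-]].
  by exists (g' @` h); [exists h|rewrite image_comp].
by exists h => //; rewrite image_comp.
Qed.

End UltraAction.

Definition subgroup (gT : groupType) (G : groupClosed gT) : Type :=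
  {g : gT | g \in G}.

Fact subgroup_closed (gT : groupType) (G : groupClosed gT) :
  group_closed (fun g : gT => g \in G).
Proof. by split; [exact: gpred1|exact: gpredF]. Qed.

HB.instance Definition _ (gT : groupType) (G : groupClosed gT) :=
  SubChoice.on (subgroup G).
HB.instance Definition _ (gT : groupType) (G : groupClosed gT) :=
  SubChoice_isSubGroup.Build gT _ (subgroup G) (subgroup_closed G).

Section Groups.
Context {R : realType} (X : cubeComplex R) (G : groupClosed (aut X)).

(* Discreteness is relative to the compact-open topology on [aut X]. *)
Definition discrete_subgroup := forall g : aut X, g \in G ->
  isolated [set h : aut X | h \in G] g.

Definition acts_properly := forall K : set X, compact K ->
  finite_set [set g : aut X | g \in G /\ (g @` K) `&` K !=set0].

Definition subgroup_ultra_act (g : subgroup G) (a : ultraNT X) : ultraNT X :=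
  ultra_act (val g) a.

End Groups.

Record finprob (R : realType) (G : choiceType) := FinProb {
  mass :> G -> R;
  mass_ge0 : forall g, 0 <= mass g;
  mass_finite : finite_set [set g | mass g != 0];
  mass_sum1 : \sum_(g \in [set: G]) mass g = 1
}.

(* The finitely supported sum is 0 by convention when f has infinite support. *)
Definition l1norm (R : realType) (G : choiceType) (f : G -> R) : R :=
  \sum_(g \in [set: G]) `|f g|.

Section FinProbTopology.
Context {R : realType} (G : choiceType).

HB.instance Definition _ := gen_eqMixin (finprob R G).
HB.instance Definition _ := gen_choiceMixin (finprob R G).

Definition l1_open : set (set (finprob R G)) := [set U |
  forall m : finprob R G, U m -> exists2 e : R, 0 < e &
    forall m' : finprob R G, l1norm (fun g => m' g - m g) < e -> U m'].

Let l1_openT : l1_open setT.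
Proof. by move=> m _; exists 1. Qed.

Let l1_openI : setI_closed l1_open.
Proof.
move=> A B oA oB m [/oA[e e0 eA] /oB[d d0 dB]]; exists (Num.min e d).
  by rewrite lt_min e0.
by move=> m'; rewrite lt_min => /andP[/eA ? /dB ?].
Qed.

Let l1_open_bigU (I : Type) (f : I -> set (finprob R G)) :
  (forall i, l1_open (f i)) -> l1_open (\bigcup_i f i).
Proof.
by move=> of_ m [i _ /of_[e e0 ef]]; exists e => // m' /ef ?; exists i.
Qed.

HB.instance Definition _ :=
  isOpenTopological.Build (finprob R G) l1_openT l1_openI l1_open_bigU.

End FinProbTopology.

Definition borel_set (T : topologicalType) : set (set T) := <<s [set U | open U] >>.

Definition borel_map (S T : topologicalType) (f : S -> T) :=
  forall A, borel_set A -> borel_set (f @^-1` A).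

(* The library's measurable types are pointed, so that a point has to be given
   in order to turn a topological space into one. *)
Definition pointed_at (T : choiceType) (t : T) : Type := T.

HB.instance Definition _ (T : choiceType) (t : T) := Choice.on (pointed_at t).
HB.instance Definition _ (T : choiceType) (t : T) :=
  isPointed.Build (pointed_at t) t.

Definition borel_type (B : topologicalType) (b : B) :=
  g_sigma_algebraType ([set U | open U] : set (set (pointed_at b))).

Section Amenability.
Variables (R : realType) (G : groupType) (B : topologicalType).
Variable act : G -> B -> B.
Implicit Types (g h : G) (b : B).

(* The translate of m by g is h |-> m (g^-1 h). *)
Definition asymptotically_equivariant_at (beta : nat -> B -> finprob R G) b :=
  forall g, (fun n => l1norm (fun h =>
    beta n (act g b) h - beta n b (g^-1 * h)%g)) @ \oo --> (0 : R).

Definition borel_amenable :=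
  exists2 beta : nat -> B -> finprob R G, (forall n, borel_map (beta n)) &
    forall b, asymptotically_equivariant_at beta b.

Definition quasi_invariant b0 (eta : probability (borel_type b0) R) :=
  forall g (A : set B), borel_set A -> eta (act g @^-1` A) = 0%E <-> eta A = 0%E.

(* The maps beta n, which matter only eta-almost everywhere, are extended to
   the whole of B. *)
Definition universally_amenable :=
  forall b0 (eta : probability (borel_type b0) R), quasi_invariant eta ->
  exists2 beta : nat -> B -> finprob R G, (forall n, borel_map (beta n)) &
    {ae eta, forall b, asymptotically_equivariant_at beta b}.

End Amenability.

(* Main.v *)
Require Import Defs.
From HB Require Import structures.
From mathcomp Require Import all_boot all_order all_algebra finmap.
From mathcomp Require Import all_classical all_reals all_analysis.
From mathcomp Require Import ring lra zify.


(** A finite-dimensional CAT(0) cube complex carries, for every ultrafilter [z]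
    and every vertex [x], weights which sit on the vertices lying between [x]
    and [z] and which hardly depend on [x] once they are spread far enough
    towards [z].  Let [N] bound the dimension, let [d] be the combinatorial
    distance, and let [k y] be the number of edges at [y] which lead towards
    [z].  The weight of level [n] at a vertex [y] between [x] and [z], at
    distance at most [n] from [x], is the binomial coefficient
    C(n - d x y + N - k y, N - k y).  Its total is C(n + N, N), whatever [x] and
    [z] are ([region_mass]).  If [x'] is the neighbour of [x] across a wall on
    the way to [z], then the weights of level [n+1] from [x] and of level [n]
    from [x'] agree beyond the wall, where all the weights from [x'] sit.
    Hence the weights of level [n+1] from [x] and from [x'] differ by
    2 (C(n+1+N, N) - C(n+N, N)) in l1-norm ([phi_diff_sum]), which is the
    fraction 2N / (n+1+N) of the total, and this tends to 0.

    The total is computed by percolation.  Pick an edge at [x] leading towards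
    [z], across a wall [A]: the weights beyond [A] are those of level [n-1]
    seen from the other end of the edge, and the remaining ones are the weights
    of the region in which [A] may not be crossed.  Both satisfy the same
    formula, with [n] or with the number of remaining walls lowered by one, and
    Pascal's rule adds them up.  What makes this work is that the edges at a
    vertex which lead towards [z] pairwise span squares
    ([ultrafilter_square]): after one of them has been crossed, the others are
    still available on the far side.

    Attaching to an ultrafilter the normalized weights seen from a fixed vertex
    gives maps into the probability measures on the vertices which are almost
    equivariant.  Since stabilizers are finite, a vertex [v] is sent
    equivariantly to the uniform measure on the group elements which carry the
    representative of its orbit to [v], so that these maps can be pushed to the
    group.  They depend only on the finitely many half-spaces bounded by walls
    near the base vertex, so they are locally constant and therefore Borel.
    The same maps witness universal amenability.

    The geometric input is that, seen from any vertex, two edges at [v] which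
    come closer to it span a square whose opposite vertex is closer still
    ([dist_square] in [cube_distance]); separation by hyperplanes follows from
    it.  It is proved on a universal cover: the words which are reduced, up to
    replacing two sides of a square by the two others, form a covering on which
    the property holds by the flag condition.  A null-homotopy of a closed
    path lifts to this covering, because a map on a square can be lifted piece
    by piece, so the covering of a simply connected complex is trivial.
    Finally, every pair of complementary combinatorial half-spaces is realized
    by a hyperplane, the set where the coordinate transverse to it is 1/2, and
    by the two components of its complement ([wall_hyperplane],
    [halfspace_of_wall]). *)

Set Implicit Arguments.
Unset Strict Implicit.
Unset Printing Implicit Defensive.

Import Order.TTheory GRing.Theory Num.Theory.
Import numFieldNormedType.Exports.

Local Open Scope classical_set_scope.

(** * Square complexes and their universal covers *)

(** [sq a b c d] means that the closed path [a], [b], [c], [d] bounds a square.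
    The last field is the flag condition for three edges at [a]; it is what
    makes the flips of [flips_last_step] confluent. *)
Record square_graph (V : Type) (adj : V -> V -> Prop)
    (sq : V -> V -> V -> V -> Prop) : Prop := SquareGraph {
  adj_sym : forall u v, adj u v -> adj v u;
  sq_rot : forall a b c d, sq a b c d -> sq b c d a;
  sq_rev : forall a b c d, sq a b c d -> sq a d c b;
  sq_adj : forall a b c d, sq a b c d -> adj a b;
  sq_neq : forall a b c d, sq a b c d -> b <> d;
  sq_uniq : forall a b c c' d, sq a b c d -> sq a b c' d -> c = c';
  sq_cube : forall a b d f c g k, sq a b c d -> sq a d g f -> sq a f k b ->
    exists t, [/\ sq b c t k, sq d c t g & sq f g t k]
}.

Section UniversalCover.
Variables (V : Type) (adj : V -> V -> Prop) (sq : V -> V -> V -> V -> Prop).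
Hypothesis sg : square_graph adj sq.
Implicit Types (u v a b c d s t : V) (x y z w p q r : seq V).

(** Paths are words read backwards, from the endpoint to the origin, so that the
    last edge of a path is at the head of the word. *)
Inductive flips : seq V -> seq V -> Prop :=
| flips_refl w : flips w w
| flips_sq a b c d r : sq a b c d -> flips [:: a, b, c & r] [:: a, d, c & r]
| flips_cons v w w' : flips w w' -> flips (v :: w) (v :: w')
| flips_trans w w' w'' : flips w w' -> flips w' w'' -> flips w w''.

Lemma flips_sym w w' : flips w w' -> flips w' w.
Proof.
elim=> {w w'} [w|a b c d r /(sq_rev sg)|v w w' _|w w' w'' _ h1 _ h2].
- exact: flips_refl.
- exact: flips_sq.
- exact: flips_cons.
- exact: flips_trans h2 h1.
Qed.

Lemma flips_size w w' : flips w w' -> size w = size w'.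
Proof. by elim=> //= [? ? ? _ ->|? ? ? _ -> _ ->]. Qed.

Lemma flips_head d w w' : flips w w' -> head d w = head d w'.
Proof. by elim=> //= ? ? ? _ -> _ ->. Qed.

Lemma flips_last d w w' : flips w w' -> last d w = last d w'.
Proof.
elim=> {w w'} // [v w w' h|w w' w'' _ -> _ -> //].
by case: w w' h => [|a w] [|b w'] h //= E; have := flips_size h.
Qed.

Lemma flips_hd a b x y : flips (a :: x) (b :: y) -> a = b.
Proof. by move=> /(flips_head a). Qed.

(** The two ways in which a path may reach [v]: along one edge in both words, or
    along two sides of a square whose other sides are a common previous step. *)
Definition last_step v x y := flips x y \/ exists u u' s q,
  [/\ sq v u s u', flips x [:: u, s & q] & flips y [:: u', s & q]].

Let sqr3 a b c d : sq a b c d -> sq d a b c.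
Proof. by do 3 move/(sq_rot sg). Qed.

(** If two successive flips produce three last edges at [v], then the previous
    steps span squares as well, by induction, and all these squares lie in a
    cube, which contains the square spanned by the outer two edges. *)
Let last_step_trans n :
  (forall v v' x y, (size x < n)%N -> flips (v :: x) (v' :: y) -> last_step v x y) ->
  forall v x y z, size x = n ->
  last_step v x y -> last_step v y z -> last_step v x z.
Proof.
move=> IH v x y z sx [xy|[u [b [s [q [S1 xu yb]]]]]].
  move=> [yz|[u' [b' [s' [q' [S yu zb]]]]]]; first by left; exact: flips_trans yz.
  by right; exists u', b', s', q'; split => //; exact: flips_trans yu.
move=> [yz|[b' [c [s' [q' [S2 yb' zc]]]]]].
  right; exists u, b, s, q; split => //.
  exact: flips_trans (flips_sym yz) yb.
have E := flips_trans (flips_sym yb) yb'.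
have eb := flips_hd E; subst b'.
have sq1 : (size (s :: q) < n)%N by rewrite -sx (flips_size xu).
case: (IH _ _ _ _ sq1 E) => [F|[e [e' [m [p [S3 se se']]]]]].
  have es := flips_hd F; subst s'.
  have ? : u = c.
    apply: (sq_uniq sg (a := b) (b := v) (d := s)); first exact: sqr3.
    by apply: (sq_rev sg); exact: (sq_rot sg).
  subst c; left; apply: flips_trans xu _; apply: flips_trans (flips_sym zc).
  exact: flips_cons.
have ? := flips_hd se; subst e; have ? := flips_hd se'; subst e'.
have T1 : sq b v u s by exact/sqr3.
have T3 : sq b s' c v by apply: (sq_rot sg).
have [t [C1 C2 C3]] := sq_cube sg T1 S3 T3.
right; exists u, c, t, (m :: p); split => //.
  apply: flips_trans xu _; apply: flips_trans (flips_cons u se) _.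
  by apply: flips_sq; apply: sqr3; exact: (sq_rev sg).
apply: flips_trans zc _; apply: flips_trans (flips_cons c se') _.
by apply: flips_sq; exact: sqr3.
Qed.

Lemma flips_last_step v v' x y : flips (v :: x) (v' :: y) -> last_step v x y.
Proof.
move: {2}(size x).+1 (ltnSn (size x)) => n.
elim: n v v' x y => // n IHn v v' x y; rewrite ltnS leq_eqVlt => /orP[/eqP sx|sx]; last first.
  exact: IHn.
move E : (v :: x) => w; move E' : (v' :: y) => w' ww'.
elim: ww' v v' x y sx E E' => {w w'}.
- by move=> w v v' x y _ <- [_ ->]; left; exact: flips_refl.
- move=> a b c d r S v v' x y _ [-> ->] [_ ->]; right; exists b, d, c, r.
  by split => //; exact: flips_refl.
- by move=> a w w' F _ v v' x y _ [_ ->] [_ ->]; left.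
- move=> w [|a x1] w'' F1 IH1 F2 IH2 v v' x y sx E E'.
    by subst w; have := flips_size F1.
  have ha : v = a by subst w; exact: flips_hd F1.
  subst a; have sx1 : size x1 = n.
    by move: (flips_size F1); rewrite -E /= => -[<-].
  apply: (@last_step_trans n _ v x x1 y sx (IH1 _ _ _ _ sx E erefl)).
    + by move=> ? ? ? ? ?; apply: IHn.
    + exact: IH2 sx1 erefl E'.
Qed.

(** A descent is an edge along which the path can be made to arrive. *)
Definition descent w u := exists v r, flips w [:: v, u & r].

Fixpoint reduced w : Prop := match w with
  | a :: (v :: _) as w' => [/\ reduced w', adj v a & ~ descent w' a]
  | _ => True
  end.

Lemma descent_flips w w' u : flips w w' -> descent w u -> descent w' u.
Proof.
move=> ww' [v [r wr]]; exists v, r; exact: flips_trans (flips_sym ww') wr.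
Qed.

(** A descent created by a flip would give, by [flips_last_step], a square with
    the same corner as the flipped one, hence a descent before the flip. *)
Lemma reduced_flips w w' : flips w w' -> reduced w -> reduced w'.
Proof.
elim=> {w w'} // [a b c d r S|v w w' F IH|w w' w'' _ h1 _ h2 /h1/h2//].
- move=> [[rc cb nb] ba na]; do ?split => //.
  + exact: (sq_adj sg (sq_rot sg (sq_rot sg S))).
  + move=> [c' [q rq]]; have ? := flips_hd rq; subst c'; apply: na; exists b, [:: d & q].
    have S' : sq b c d a by exact: (sq_rot sg S).
    apply: flips_trans (flips_cons b rq) _; exact: flips_sq.
  + exact: (adj_sym sg (sq_adj sg (sq_rev sg S))).
  + move=> [d' [q rq]]; have ? := flips_hd rq; subst d'.
    case: (flips_last_step rq) => [F|[e [e' [s [q' [S' E1 E2]]]]]].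
      by apply: (sq_neq sg (sq_rot sg S)); exact: flips_hd F.
    have ? := flips_hd E1; subst e; have ? := flips_hd E2; subst e'.
    apply: nb; exists c, q'; have ? : s = b; last by subst s.
    apply: (sq_uniq sg S'); exact: (sq_rot sg (sq_rev sg S)).
- case: w w' F IH => [|b w] [|b' w'] F IH //=; do ?by have := flips_size F.
  have ? := flips_hd F; subst b'; move=> [/IH rw bv nv]; split=> // nd.
  apply: nv; exact: descent_flips (flips_sym F) nd.
Qed.

Lemma reduced_tail v w : reduced (v :: w) -> reduced w.
Proof. by case: w => // a w []. Qed.

(** Reduced words up to flips are the vertices of the universal cover; crossing
    an edge lengthens such a word, or shortens it when the edge is a descent. *)
Definition extends w w' := exists2 v, reduced (v :: w) & flips w' (v :: w).
Definition neighbours w w' := extends w w' \/ extends w' w.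

Lemma neighbours_sym w w' : neighbours w w' -> neighbours w' w.
Proof. by case; [right|left]. Qed.

Lemma extends_flipsl w1 w2 w' : flips w1 w2 -> extends w1 w' -> extends w2 w'.
Proof.
move=> F [v r E]; exists v; first exact: reduced_flips (flips_cons v F) r.
exact: flips_trans E (flips_cons v F).
Qed.

Lemma extends_flipsr w w1 w2 : flips w1 w2 -> extends w w1 -> extends w w2.
Proof.
by move=> F [v r E]; exists v => //; exact: flips_trans (flips_sym F) E.
Qed.

Lemma neighbours_flips w1 w2 w3 w4 :
  flips w1 w3 -> flips w2 w4 -> neighbours w1 w2 -> neighbours w3 w4.
Proof.
move=> F G [h|h]; [left|right];
  by [exact: extends_flipsl F (extends_flipsr G h)|
      exact: extends_flipsl G (extends_flipsr F h)].
Qed.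

Lemma neighbour_exists v r u : reduced (v :: r) -> adj v u ->
  exists r', reduced (u :: r') /\ neighbours (v :: r) (u :: r').
Proof.
move=> rv vu; case: (pselect (descent (v :: r) u)) => [[v' [q F]]|nd].
  have ? := flips_hd F; subst v'; have rvu := reduced_flips F rv.
  exists q; split; first exact: reduced_tail rvu.
  by right; exists v.
have ruv : reduced [:: u, v & r] by [].
by exists (v :: r); split => //; left; exists u => //; exact: flips_refl.
Qed.

(** A reduced word cannot extend to a reduced word across a descent, so the two
    kinds of neighbours exclude each other and edges lift uniquely. *)
Lemma neighbour_uniq v r u r1 r2 :
  neighbours (v :: r) (u :: r1) -> neighbours (v :: r) (u :: r2) ->
  flips (u :: r1) (u :: r2).
Proof.
have mix p q : extends (v :: r) (u :: p) -> extends (u :: q) (v :: r) -> False.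
  move=> [u' R1 F1] [v' R2 F2].
  have ? := flips_hd F1; subst u'; have ? := flips_hd F2; subst v'.
  by move: (reduced_flips (flips_cons u F2) R1) => -[_ _]; apply; exists v, q; exact: flips_refl.
move=> [A|A] [B|B]; do ?by [case: (mix _ _ A B)|case: (mix _ _ B A)].
  move: A B => [a _ F] [b _ G]; have ? := flips_hd F; have ? := flips_hd G; subst a b.
  exact: flips_trans F (flips_sym G).
move: A B => [a _ F] [b _ G]; have ? := flips_hd F; have ? := flips_hd G; subst a b.
case: (flips_last_step (flips_trans (flips_sym F) G)) => // -[e [e' [s [q [S E1 E2]]]]].
by have ? := flips_hd E1; have ? := flips_hd E2; subst e e'; case: (sq_neq sg S).
Qed.

Let reduced_neigh w w' : reduced w -> neighbours w w' -> reduced w'.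
Proof.
move=> rw [[v r F]|[v r F]]; first exact: reduced_flips (flips_sym F) r.
exact: reduced_tail r.
Qed.

(** Whether the edges from [a] to [b] and from [b] to [c] lengthen or shorten the
    word gives four cases; in each of them flipping the square yields the lift
    of the other two sides. *)
Lemma neighbour_square a b c d ra rb rc rd : reduced (a :: ra) -> sq a b c d ->
  neighbours (a :: ra) (b :: rb) -> neighbours (a :: ra) (d :: rd) ->
  neighbours (b :: rb) (c :: rc) -> neighbours (d :: rd) (c :: rc).
Proof.
move=> R S NB ND BC.
have Rb := reduced_neigh R NB; have Rc := reduced_neigh Rb BC.
have via rd' : neighbours (a :: ra) (d :: rd') -> neighbours (d :: rd') (c :: rc) ->
    neighbours (d :: rd) (c :: rc).
  move=> N' C'; apply: neighbours_flips (flips_refl _) C'.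
  exact: neighbour_uniq N' ND.
have S' : sq b a d c by apply: (sq_rev sg); exact: (sq_rot sg S).
case: (NB) => [[b' Rab Fb]|[a' Rba Fa]].
  have ? := flips_hd Fb; subst b'.
  case: (BC) => [[c' Rbc Fc]|[b' Rcb Fb']].
    have ? := flips_hd Fc; subst c'.
    have Fc' : flips (c :: rc) [:: c, d, a & ra].
      apply: flips_trans Fc _; apply: flips_trans (flips_cons c Fb) _.
      by apply: flips_sq; exact: (sq_rev sg (sq_rot sg (sq_rot sg S))).
    have Rc' := reduced_flips Fc' Rc.
    apply: (via (a :: ra)); last by left; exists c => //.
    by left; exists d; [exact: reduced_tail Rc'|exact: flips_refl].
  have ? := flips_hd Fb'; subst b'.
  case: (flips_last_step (flips_trans (flips_sym Fb) Fb')) => [F|].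
    by case: (sq_neq sg (sq_rot sg S)); rewrite (flips_hd F).
  move=> [e [e' [s [q [T E1 E2]]]]].
  have ? := flips_hd E1; have ? := flips_hd E2; subst e e'.
  have ? : s = d by exact: (sq_uniq sg T S').
  subst s; have Ra' := reduced_flips E1 R; have Rc' := reduced_flips E2 Rc.
  apply: (via q); first by right; exists a.
  by left; exists c.
have ? := flips_hd Fa; subst a'.
case: (BC) => [[c' Rbc Fc]|[b' Rcb Fb']].
  have ? := flips_hd Fc; subst c'.
  case: (ND) => [[d' Rda Fd]|[a' Rad Fa']].
    have ? := flips_hd Fd; subst d'.
    right; exists d => //; last first.
      apply: flips_trans Fd _; apply: flips_trans (flips_cons d Fa) _.
      apply: flips_trans (flips_sym (flips_cons d Fc)).
      by apply: flips_sq; exact: sqr3.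
    have Rd := reduced_neigh R ND.
    apply: reduced_flips Rd.
    apply: flips_trans Fd _; apply: flips_trans (flips_cons d Fa) _.
    apply: flips_trans (flips_sym (flips_cons d Fc)).
    by apply: flips_sq; exact: sqr3.
  have ? := flips_hd Fa'; subst a'.
  case: (flips_last_step (flips_trans (flips_sym Fa) Fa')) => [F|].
    by case: (sq_neq sg S); rewrite (flips_hd F).
  move=> [e [e' [s [q [T E1 E2]]]]].
  have ? := flips_hd E1; have ? := flips_hd E2; subst e e'.
  have ? : s = c by exact: (sq_uniq sg T S).
  by subst s; case: Rbc => _ _; case; exists b, q.
have ? := flips_hd Fb'; subst b'.
have Fa2 : flips (a :: ra) [:: a, d, c & rc].
  apply: flips_trans Fa _; apply: flips_trans (flips_cons a Fb') _.
  exact: flips_sq.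
have Ra2 := reduced_flips Fa2 R.
apply: (via (c :: rc)); first by right; exists a.
right; exists d; [exact: reduced_tail Ra2|exact: flips_refl].
Qed.

End UniversalCover.

(** * Systems of combinatorial cubes *)

Definition bits n := {ffun 'I_n -> bool}.

Definition flipb n (b : bits n) (i : 'I_n) : bits n :=
  [ffun j => if j == i then ~~ b j else b j].

Lemma flipbK n (i : 'I_n) : involutive (fun b : bits n => flipb b i).
Proof.
by move=> b; apply/ffunP => j; rewrite !ffunE; case: eqP => // _; rewrite negbK.
Qed.

Lemma flipbC n (b : bits n) i j : flipb (flipb b i) j = flipb (flipb b j) i.
Proof. by apply/ffunP => k; rewrite !ffunE; case: eqP; case: eqP. Qed.

Lemma flipb_eq n (b : bits n) i : flipb b i i = ~~ b i.
Proof. by rewrite ffunE eqxx. Qed.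

Lemma flipb_neq n (b : bits n) i j : j != i -> flipb b i j = b j.
Proof. by rewrite ffunE => /negbTE ->. Qed.

Lemma flipb_id n (b : bits n) i : flipb b i <> b.
Proof. by move=> /ffunP/(_ i); rewrite flipb_eq; case: (b i). Qed.

Lemma flipb_inj n (b : bits n) : injective (flipb b).
Proof.
move=> i j /ffunP/(_ i); rewrite flipb_eq; have [//|ij] := eqVneq i j.
by rewrite flipb_neq//; case: (b i).
Qed.

Definition hamming n (b b' : bits n) := #|[pred i | b i != b' i]|.

Lemma hamming_flip n (b b' : bits n) i : b i != b' i ->
  (hamming (flipb b i) b' < hamming b b')%N.
Proof.
move=> bi; apply: proper_card; apply/properP; split.
  apply/fintype.subsetP => j; rewrite !inE; have [->|ji] := eqVneq j i; first by [].
  by rewrite flipb_neq.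
by exists i; rewrite !inE// flipb_eq; move: bi; case: (b i); case: (b' i).
Qed.

(** Induction along a shortest path from [b] to [b']. *)
Lemma bits_ind n (P : bits n -> Prop) b' :
  P b' -> (forall (b : bits n) i, b i != b' i -> P (flipb b i) -> P b) -> forall b, P b.
Proof.
move=> P0 Pf b; move: {2}(hamming b b').+1 (ltnSn (hamming b b')) => k.
elim: k b => // k IH b; rewrite ltnS => bk.
have [->//|/eqP nbb'] := eqVneq b b'.
have [i bi] : exists i, b i != b' i.
  by apply: contra_notP nbb' => /forallNP h; apply/ffunP => i; apply/eqP/contraT => /h.
apply: (Pf _ i) => //; apply: IH; exact: leq_trans (hamming_flip bi) bk.
Qed.

Section CubeSystem.
Variables (V C : Type) (dim : C -> nat) (vx : forall c, bits (dim c) -> V).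

Definition adj u v := exists c b i, u = @vx c b /\ v = vx (flipb b i).

Definition sq u v w x := exists c b i j, [/\ i != j, u = @vx c b,
  v = vx (flipb b i), w = vx (flipb (flipb b i) j) & x = vx (flipb b j)].

Definition incell c v := exists b, v = @vx c b.

(** [vx_meet] is what remains, on vertices, of the fact that two cells meet along
    a face of each: with two opposite corners of a subcube, a cell contains the
    neighbours of one corner in the directions of the other. *)
Record cube_family : Prop := CubeFamily {
  vx_inj : forall c, injective (@vx c);
  vx_meet : forall c d (b b1 : bits (dim c)) (b' b1' : bits (dim d)) i,
    vx b = vx b' -> vx b1 = vx b1' -> b i != b1 i ->
    exists i', vx (flipb b i) = vx (flipb b' i')
}.

(** [vx_flag] is the flag condition on the link of [a]. *)
Record cube_system : Prop := CubeSystem {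
  cube_system_family :> cube_family;
  vx_flag : forall a (S : set V), finite_set S -> S !=set0 ->
    (forall u, S u -> adj a u) ->
    (forall u v, S u -> S v -> u <> v -> exists w, sq a u w v) ->
    exists c b, @vx c b = a /\ forall u, S u -> exists i, u = vx (flipb b i)
}.

Section CubeFamily.
Hypothesis cs : cube_family.

Lemma adj_incell c b v : adj (@vx c b) v -> incell c v ->
  exists i, v = vx (flipb b i).
Proof.
move=> [d [b' [i [E E']]]] [b1 E1].
have [|j Ej] := vx_meet cs (i := i) (esym E) (etrans (esym E') E1).
  by rewrite flipb_eq; case: (b' i).
by exists j; rewrite -Ej E'.
Qed.

Lemma adj_symm u v : adj u v -> adj v u.
Proof. by move=> [c [b [i [-> ->]]]]; exists c, (flipb b i), i; rewrite flipbK. Qed.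

Lemma adj_neq u v : adj u v -> u <> v.
Proof. by move=> [c [b [i [-> ->]]]] /(vx_inj cs)/esym; exact: flipb_id. Qed.

(** The vertex opposite to [a] belongs, by [vx_meet], to every cell which
    contains the corner at [a], and is located there by its two neighbours. *)
Lemma sq_corner a b c d : sq a b c d -> forall e (s : bits (dim e)) i j,
  i != j -> a = vx s ->
  b = vx (flipb s i) -> d = vx (flipb s j) -> c = vx (flipb (flipb s i) j).
Proof.
move=> [e' [t [k [l [kl -> -> -> ->]]]]] e s i j ij E Ei Ej.
have tk : flipb t k l != flipb t l l.
  by rewrite flipb_eq flipb_neq 1?eq_sym//; case: (t l).
have tl : flipb t l k != flipb t k k.
  by rewrite flipb_eq flipb_neq//; case: (t k).
have [m Em] := vx_meet cs Ei Ej tk; have [m' Em'] := vx_meet cs Ej Ei tl.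
rewrite Em; congr vx; congr flipb.
have sim : flipb (flipb s i) m = flipb (flipb s j) m'.
  by apply: (vx_inj cs); rewrite -Em -Em' flipbC.
have [//|mj] := eqVneq m j.
have jj : m' = j.
  move: sim => /ffunP/(_ j); rewrite [LHS]flipb_neq 1?eq_sym//.
  rewrite [LHS]flipb_neq 1?eq_sym// [RHS]ffunE flipb_eq negbK.
  by case: eqP => [->|_] //; case: (s j).
have : flipb (flipb t k) l = t.
  by apply: (vx_inj cs); rewrite E flipbC Em' jj flipbK.
by move=> /ffunP/(_ k); rewrite flipb_neq// flipb_eq; case: (t k).
Qed.

Lemma sq_rotate a b c d : sq a b c d -> sq b c d a.
Proof.
move=> [e [s [i [j [ij -> -> -> ->]]]]]; exists e, (flipb s i), j, i.
by rewrite eq_sym (flipbC s i j) !flipbK.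
Qed.

Lemma sq_reverse a b c d : sq a b c d -> sq a d c b.
Proof.
by move=> [e [s [i [j [ij -> -> -> ->]]]]]; exists e, s, j, i; rewrite eq_sym flipbC.
Qed.

Lemma sq_adjacent a b c d : sq a b c d -> adj a b.
Proof. by move=> [e [s [i [j [ij -> -> _ _]]]]]; exists e, s, i. Qed.

Lemma sq_neqbd a b c d : sq a b c d -> b <> d.
Proof.
by move=> [e [s [i [j [ij _ -> _ ->]]]]] /(vx_inj cs)/flipb_inj/eqP; rewrite (negbTE ij).
Qed.

Lemma sq_unique a b c c' d : sq a b c d -> sq a b c' d -> c = c'.
Proof.
move=> h [e [s [i [j [ij Ea Eb -> Ed]]]]]; exact: sq_corner h _ _ _ _ ij Ea Eb Ed.
Qed.

End CubeFamily.

Section Flag.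
Hypothesis cs : cube_system.

Lemma sq_cubical a b d f c g k : sq a b c d -> sq a d g f -> sq a f k b ->
  exists t, [/\ sq b c t k, sq d c t g & sq f g t k].
Proof.
move=> S1 S2 S3.
have [||||e [s [Ea H]]] := @vx_flag cs a [set b; d; f].
- by rewrite !finite_setU; do !split; exact: finite_set1.
- by exists b; left; left.
- move=> u [[->|->]|->]; [exact: sq_adjacent S1|exact: sq_adjacent S2|exact: sq_adjacent S3].
- move=> u v [[->|->]|->] [[->|->]|->] // _;
  by [exists c|exists k; exact: sq_reverse|exists c; exact: sq_reverse|exists g|
      exists k|exists g; exact: sq_reverse].
have [i Eb] := H b (or_introl (or_introl erefl)).
have [j Ed] := H d (or_introl (or_intror erefl)).
have [l Ef] := H f (or_intror erefl).
have ij : i != j by apply/eqP => ij; apply: (sq_neqbd cs S1); rewrite Eb Ed ij.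
have jl : j != l by apply/eqP => ee; apply: (sq_neqbd cs S2); rewrite Ed Ef ee.
have li : l != i by apply/eqP => ee; apply: (sq_neqbd cs S3); rewrite Eb Ef ee.
have Ec := sq_corner cs S1 ij (esym Ea) Eb Ed.
have Eg := sq_corner cs S2 jl (esym Ea) Ed Ef.
have Ek := sq_corner cs S3 li (esym Ea) Ef Eb.
exists (vx (flipb (flipb (flipb s i) j) l)); split.
- exists e, (flipb s i), j, l; split => //; by rewrite Ek flipbC.
- exists e, (flipb s j), i, l; split; rewrite 1?eq_sym// ?Eg//.
    by rewrite Ec flipbC.
  by rewrite (flipbC s i).
- exists e, (flipb s l), j, i; split; rewrite 1?eq_sym//.
    by rewrite Eg flipbC.
  by congr vx; rewrite (flipbC s l) (flipbC _ l) (flipbC s j).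
Qed.

Lemma cube_system_squares : square_graph adj sq.
Proof.
split; [exact: adj_symm|exact: sq_rotate|exact: sq_reverse|exact: sq_adjacent|
  exact: (sq_neqbd cs)|exact: (sq_unique cs)|exact: sq_cubical].
Qed.

End Flag.

(** * Coverings of cube systems *)

(** A covering of the 1-skeleton which lifts squares to squares. *)
Record covering (W : Type) (pi : W -> V) (mv : W -> W -> Prop) : Prop := Covering {
  mv_sym : forall w w', mv w w' -> mv w' w;
  mv_lift : forall w u, adj (pi w) u -> exists2 w', pi w' = u & mv w w';
  mv_uniq : forall w w1 w2, mv w w1 -> mv w w2 -> pi w1 = pi w2 -> w1 = w2;
  mv_square : forall w wb wc wd, sq (pi w) (pi wb) (pi wc) (pi wd) ->
    mv w wb -> mv w wd -> mv wb wc -> mv wd wc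
}.

Section Covering.
Variables (W : Type) (pi : W -> V) (mv : W -> W -> Prop).
Hypothesis fam : cube_family.
Hypothesis cov : covering pi mv.
Implicit Types w : W.

(** A sheet is a lift of all vertices of a cell. *)
Definition sheet c (f : bits (dim c) -> W) :=
  (forall b, pi (f b) = vx b) /\ forall b i, mv (f b) (f (flipb b i)).

(** Transport inside a cell: [w'] is obtained from [w] by following any path of
    some cell. *)
Definition samecell w w' := exists c f,
  [/\ @sheet c f, exists b, f b = w & exists b', f b' = w'].

(** The lift over a subcube is built one direction at a time, and the squares of
    the cell make the new edges in the old directions match. *)
Let sheet_on c w (b0 : bits (dim c)) (s : seq 'I_(dim c)) : pi w = vx b0 -> uniq s ->
  exists f : bits (dim c) -> W, [/\ f b0 = w,
    forall b : bits (dim c), (forall i, i \notin s -> b i = b0 i) -> pi (f b) = vx b &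
    forall (b : bits (dim c)) j, (forall i, i \notin s -> b i = b0 i) -> j \in s ->
      mv (f b) (f (flipb b j))].
Proof.
move=> wb0; elim: s => [|i s IH] /=.
  move=> _; exists (fun=> w); split => // b bb0.
  by rewrite wb0; congr vx; apply/ffunP => i; rewrite bb0.
move=> /andP[nis /IH[f [f0 fpi fmv]]].
have agree (b : bits (dim c)) : (forall k, k \notin i :: s -> b k = b0 k) -> b i = b0 i ->
    forall k, k \notin s -> b k = b0 k.
  move=> h bi k ks; have [->//|ki] := eqVneq k i.
  by apply: h; rewrite inE negb_or ki.
have agree' (b : bits (dim c)) : (forall k, k \notin i :: s -> b k = b0 k) -> b i != b0 i ->
    forall k, k \notin s -> flipb b i k = b0 k.
  move=> h bi; apply: agree => [k ks|].
    rewrite flipb_neq ?h//; move: ks; rewrite inE negb_or; by case/andP.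
  by rewrite flipb_eq; move: bi; case: (b i); case: (b0 i).
have nextP (b : bits (dim c)) : exists w', (b i != b0 i) ->
    (forall k, k \notin i :: s -> b k = b0 k) ->
    pi w' = vx b /\ mv (f (flipb b i)) w'.
  have [h|h] := pselect ((b i != b0 i) /\ forall k, k \notin i :: s -> b k = b0 k).
    have [|w' w'1 w'2] := mv_lift cov (w := f (flipb b i)) (u := vx b).
      rewrite fpi; last by apply: agree' h.2 h.1.
      by exists c, (flipb b i), i; rewrite flipbK.
    by exists w'.
  by exists w => h1 h2; case: h.
have [g gP] := choice nextP.
pose f' (b : bits (dim c)) := if b i == b0 i then f b else g b.
exists f'; rewrite /f' eqxx; split => // [b bb0|b j bb0].
  by case: ifPn => [/eqP bi|bi]; [rewrite fpi//; exact: agree|case: (gP b bi bb0)].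
have key (b1 : bits (dim c)) : (forall k, k \notin i :: s -> b1 k = b0 k) -> b1 i != b0 i ->
    mv (f (flipb b1 i)) (g b1) /\ pi (g b1) = vx b1.
  by move=> h1 h2; have [] := gP b1 h2 h1.
rewrite inE => /orP[/eqP ->|js].
  rewrite flipb_eq; case: ifPn => bi; case: ifPn => bi' //.
  - by move: bi bi'; case: (b i); case: (b0 i).
  - have [|//|h _] := key (flipb b i).
      move=> k; rewrite inE negb_or => /andP[ki ks].
      by rewrite flipb_neq// bb0// inE negb_or ki.
    + by rewrite flipb_eq.
    + by rewrite flipbK in h.
  - by apply: (mv_sym cov); have [] := key b bb0 bi.
  - by move: bi bi'; case: (b i); case: (b0 i).
have ji : j != i by apply: contraNneq nis => <-.
have ij : i != j by rewrite eq_sym.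
have bb0' : forall k, k \notin i :: s -> flipb b j k = b0 k.
  move=> k; rewrite inE negb_or => /andP[ki ks].
  rewrite flipb_neq; first by rewrite bb0// inE negb_or ki.
  by apply: contraNneq ks => ->.
rewrite (flipb_neq b ij); case: ifPn => [/eqP bi|bi].
  by apply: fmv => //; exact: agree.
have [m1 p1] := key _ bb0 bi.
have bij : flipb b j i != b0 i by rewrite (flipb_neq b ij).
have [m2 p2] := key _ bb0' bij.
have e1 := fpi _ (agree' _ bb0 bi); have e2 := fpi _ (agree' _ bb0' bij).
have m3 := fmv _ j (agree' _ bb0 bi) js.
rewrite flipbC in e2 m2.
apply: (mv_square cov (w := f (flipb b i)) (wb := f (flipb (flipb b i) j))) => //.
rewrite e1 e2 p1 p2; exists c, (flipb b i), j, i.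
by rewrite (flipbC b i j) !flipbK; split.
Qed.

Lemma sheet_exists c b0 w : pi w = @vx c b0 -> exists2 f, sheet f & f b0 = w.
Proof.
move=> wb; have [f [f0 f1 f2]] := sheet_on wb (enum_uniq 'I_(dim c)).
exists f => //; split => [b|b i].
  by apply: f1 => i; rewrite mem_enum.
by apply: f2 => [j|]; rewrite mem_enum.
Qed.

(** The common vertices of two cells are connected inside both of them, by
    [vx_meet], so transport does not depend on the cell. *)
Lemma sheet_uniq c d (f : bits (dim c) -> W) (g : bits (dim d) -> W)
    (b b1 : bits (dim c)) (b' b1' : bits (dim d)) :
  sheet f -> sheet g -> f b = g b' -> vx b1 = vx b1' -> f b1 = g b1'.
Proof.
move=> [f1 f2] [g1 g2] fg E1.
have E : vx b = vx b' by rewrite -f1 fg g1.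
move: b b' fg E; apply: (bits_ind (b' := b1)) => [|b i bi IH] b' fg E.
  rewrite fg; congr g.
  by apply: (vx_inj fam); rewrite -E1 -E.
have [i' Ei] := vx_meet fam E E1 bi.
apply: (IH (flipb b' i')) => //.
apply: (mv_uniq cov) (f2 b i) _ _; first by rewrite fg.
by rewrite f1 g1.
Qed.

Lemma samecell_exists c w u : incell c (pi w) -> incell c u ->
  exists2 w', pi w' = u & samecell w w'.
Proof.
move=> [b wb] [b' ->]; have [f [f1 f2] fb] := sheet_exists wb.
by exists (f b') => //; exists c, f; split => //; [exists b|exists b'].
Qed.

Lemma samecell_uniq w w1 w2 :
  samecell w w1 -> samecell w w2 -> pi w1 = pi w2 -> w1 = w2.
Proof.
move=> [c [f [sf [b <-] [b1 <-]]]] [d [g [sg [b' E] [b1' <-]]]].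
rewrite sf.1 sg.1; exact: sheet_uniq sf sg (esym E).
Qed.

Lemma samecell_sym w w' : samecell w w' -> samecell w' w.
Proof. by move=> [c [f [sf h1 h2]]]; exists c, f. Qed.

Lemma samecell_refl c w : incell c (pi w) -> samecell w w.
Proof.
move=> [b wb]; have [f sf fb] := sheet_exists wb.
by exists c, f; split => //; exists b.
Qed.

Lemma samecell_trans c w w1 w2 : incell c (pi w) -> incell c (pi w1) ->
  incell c (pi w2) -> samecell w w1 -> samecell w1 w2 -> samecell w w2.
Proof.
move=> [b wb] [b1 wb1] [b2 wb2] h h1; have [f sf fb] := sheet_exists wb.
have e1 : f b1 = w1.
  apply: samecell_uniq _ h _; last by rewrite sf.1.
  by exists c, f; split => //; [exists b|exists b1].
have e2 : f b2 = w2.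
  apply: samecell_uniq _ h1 _; last by rewrite sf.1.
  by exists c, f; split => //; [exists b1|exists b2].
by exists c, f; split => //; [exists b|exists b2].
Qed.

Lemma samecell_mv w w' : mv w w' -> adj (pi w) (pi w') -> samecell w w'.
Proof.
move=> m [c [b [i [E E']]]]; have [f sf fb] := sheet_exists E.
exists c, f; split => //; first by exists b.
exists (flipb b i); apply: (mv_uniq cov) m _; last by rewrite sf.1.
by rewrite -fb; exact: sf.2.
Qed.

End Covering.
End CubeSystem.

Section Simply.
Variables (V C : Type) (dim : C -> nat) (vx : forall c, bits (dim c) -> V).
Local Notation adj := (adj vx).
Local Notation sq := (sq vx).

Inductive walk : nat -> V -> V -> Prop :=
| walk0 v : walk 0 v v
| walkS n u v w : walk n u v -> adj v w -> walk n.+1 u w.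

Inductive mvs (W : Type) (pi : W -> V) (mv : W -> W -> Prop) (w : W) : W -> Prop :=
| mvs0 : mvs pi mv w w
| mvsS w1 w2 : mvs pi mv w w1 -> mv w1 w2 -> adj (pi w1) (pi w2) -> mvs pi mv w w2.

Definition combinatorially_connected := forall u v, exists n, walk n u v.

(** The combinatorial form of simple connectedness. *)
Definition trivial_coverings := forall (W : Type) (pi : W -> V) mv,
  covering vx pi mv -> forall w w', mvs pi mv w w' -> pi w = pi w' -> w = w'.

End Simply.

Section UniversalCoverWords.
Variables (V C : Type) (dim : C -> nat) (vx : forall c, bits (dim c) -> V).
Local Notation adj := (adj vx).
Local Notation sq := (sq vx).
Hypothesis cs : cube_system vx.
Variable x : V.
Let sg := cube_system_squares cs.
Local Notation flips := (flips sq).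
Local Notation reduced := (reduced adj sq).

Let flips_inhabited w : exists w', flips w w'.
Proof. by exists w; exact: flips_refl. Qed.

(** A chosen representative, so that equality of normal words is equality up to
    flips. *)
Definition normal_word (w : seq V) : seq V := sval (cid (flips_inhabited w)).

Lemma normal_wordP w : flips w (normal_word w).
Proof. exact: svalP (cid (flips_inhabited w)). Qed.

Lemma normal_word_eq w w' : flips w w' -> normal_word w = normal_word w'.
Proof.
move=> ww'; rewrite /normal_word.
move: (flips_inhabited w) (flips_inhabited w').
have -> : flips w = flips w'.
  apply/funext => z; apply/propext; split=> h; last exact: flips_trans ww' h.
  exact: flips_trans (flips_sym sg ww') h.
by move=> e e'; rewrite (Prop_irrelevance e e').
Qed.

Record cover_point := CoverPoint {
  word : seq V;
  word_proper : exists v r, word = v :: r;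
  word_reduced : reduced word;
  word_last : last x word = x;
  word_normal : normal_word word = word
}.

Definition cover_vertex (w : cover_point) : V := head x (word w).

Definition cover_adj (w w' : cover_point) := neighbours adj sq (word w) (word w').

Lemma cover_point_eq w w' : flips (word w) (word w') -> w = w'.
Proof.
case: w w' => [w p r l n] [w' p' r' l' n'] /= /normal_word_eq; rewrite n n' => E.
by subst w'; congr CoverPoint; exact: Prop_irrelevance.
Qed.

Lemma cover_point_of v r : reduced (v :: r) -> last v r = x ->
  exists2 w, flips (v :: r) (word w) & cover_vertex w = v.
Proof.
move=> red_vr last_vr; have F := normal_wordP (v :: r).
have hF := flips_head x F.
have P0 : exists a s, normal_word (v :: r) = a :: s.
  by case: (normal_word _) (flips_size F) => // a s _; exists a, s.
have P1 : reduced (normal_word (v :: r)) by exact: (reduced_flips sg F red_vr).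
have P2 : last x (normal_word (v :: r)) = x by rewrite -(flips_last x F).
have P3 : normal_word (normal_word (v :: r)) = normal_word (v :: r).
  exact/esym/normal_word_eq.
by exists (CoverPoint P0 P1 P2 P3).
Qed.

Lemma word_vertex w : exists r, word w = cover_vertex w :: r.
Proof. by case: w => w [v [r E]] ? ? ?; exists r; rewrite /cover_vertex /= E. Qed.

Lemma cover_covering : covering vx cover_vertex cover_adj.
Proof.
split.
- by move=> w w'; exact: neighbours_sym.
- move=> w u vu; have [r E] := word_vertex w.
  have R := word_reduced w; rewrite E in R.
  have [r' [R' N]] := neighbour_exists sg R vu.
  have [|w' F w'u] := cover_point_of R'.
    have lw := word_last w; rewrite E in lw.
    case: N => -[a _ F].
      by have /= := flips_last x F; rewrite -[last _ r]/(last x (cover_vertex w :: r)) lw.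
    by have /= := flips_last x F; rewrite -[last _ r]/(last x (cover_vertex w :: r)) lw.
  exists w' => //; rewrite /cover_adj E.
  exact: (neighbours_flips sg (flips_refl _ _) F N).
- move=> w w1 w2; rewrite /cover_adj.
  have [r ->] := word_vertex w; have [r1 E1] := word_vertex w1.
  have [r2 E2] := word_vertex w2 => N1 N2 E; apply: cover_point_eq.
  rewrite E1 E2 E in N1 N2 *; exact: (neighbour_uniq sg N1 N2).
- move=> w wb wc wd S; rewrite /cover_adj.
  have [r E] := word_vertex w; have [rb ->] := word_vertex wb.
  have [rc ->] := word_vertex wc; have [rd ->] := word_vertex wd.
  have R := word_reduced w; rewrite E in R *.
  exact: (neighbour_square sg R S).
Qed.

Hypothesis conn : combinatorially_connected vx.
Hypothesis triv : trivial_coverings vx.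

Let reach := mvs vx cover_vertex cover_adj.

Lemma cover_base : exists2 w0, word w0 = [:: x] & cover_vertex w0 = x.
Proof.
have [||w0 F w0x] := @cover_point_of x [::] => //.
have [r E] := word_vertex w0.
exists w0 => //; move: (flips_size F); rewrite E w0x /= => -[]; by case: r {E}.
Qed.

(** When the covering by reduced words is trivial it has a section, which picks
    for every vertex a reduced word ending there. *)
Lemma geodesic_words : exists f : V -> seq V, [/\ f x = [:: x],
  forall v, exists r, f v = v :: r, forall v, reduced (f v),
  forall v, last x (f v) = x &
  forall u v, adj u v -> neighbours adj sq (f u) (f v)].
Proof.
have [w0 W0 pw0] := cover_base.
have lift n v : walk vx n x v -> exists2 w, cover_vertex w = v & reach w0 w.
  move E : x => x' h; elim: h E => [{}v E|{}n u {}v w _ IH vw E].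
    by exists w0; [rewrite pw0|exact: mvs0].
  have [w1 E1 h1] := IH E; rewrite -E1 in vw.
  have [w2 E2 h2] := mv_lift cover_covering vw.
  by exists w2 => //; apply: mvsS h1 h2 _; rewrite E2.
have ex v : exists w, cover_vertex w = v /\ reach w0 w.
  by have [n /lift[w]] := conn x v; exists w.
have [f fP] := choice ex.
have reach_trans w1 w2 w3 : reach w1 w2 -> reach w2 w3 -> reach w1 w3.
  move=> h; elim=> // w4 w5 _ h1 m a; exact: mvsS h1 m a.
have reach_sym w1 w2 : reach w1 w2 -> reach w2 w1.
  elim=> [|w4 w5 _ h1 m a]; first exact: mvs0.
  apply: reach_trans h1; apply: mvsS (mvs0 _ _ _ _) _ _.
    exact: (mv_sym cover_covering).
  exact: adj_symm.
have uniq w1 w2 : reach w0 w1 -> reach w0 w2 -> cover_vertex w1 = cover_vertex w2 -> w1 = w2.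
  move=> h1 h2; apply: (triv cover_covering); apply: reach_trans h2; exact: reach_sym.
exists (word \o f); split => //=.
- have -> // : f x = w0.
  by apply: uniq; [exact: (fP x).2|exact: mvs0|rewrite (fP x).1].
- by move=> v; have [r E] := word_vertex (f v); exists r; rewrite E (fP v).1.
- by move=> v; exact: word_reduced.
- by move=> v; exact: word_last.
- move=> u v; have [E h] := fP u; rewrite -{1}E => uv.
  have [w pw m] := mv_lift cover_covering uv.
  rewrite -pw in uv *; suff -> : f (cover_vertex w) = w by exact: m.
  have [E' h'] := fP (cover_vertex w); apply: uniq => //.
  exact: mvsS h m uv.
Qed.

End UniversalCoverWords.

(** * The distance and the half-spaces of a CAT(0) cube system *)

(** [dist_square] is the property from which all separation properties of walls
    are derived: two neighbours of [v] closer to [x] have a common neighbour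
    closer still. *)
Record cube_distance (V : Type) (adj : V -> V -> Prop)
    (sq : V -> V -> V -> V -> Prop) (d : V -> V -> nat) : Prop := CubeDistance {
  dist_eq0 : forall x v, d x v = 0 -> x = v;
  dist_xx : forall x, d x x = 0;
  dist_adj : forall x u v, adj u v -> d x v = (d x u).+1 \/ d x u = (d x v).+1;
  dist_down : forall x v, d x v != 0 -> exists2 u, adj v u & d x v = (d x u).+1;
  dist_square : forall x v u u', adj v u -> adj v u' -> u <> u' ->
    (d x u < d x v)%N -> (d x u' < d x v)%N ->
    exists2 s, sq v u s u' & (d x s < d x u)%N
}.

(** The distance is the length of reduced words; two neighbours closer to [x]
    are descents of the word of [v], and [flips_last_step] gives the square. *)
Lemma cube_distance_exists (V C : Type) (dim : C -> nat)
    (vx : forall c, bits (dim c) -> V) :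
  cube_system vx -> combinatorially_connected vx -> trivial_coverings vx ->
  exists d, cube_distance (adj vx) (sq vx) d.
Proof.
move=> cs conn triv; have sg := cube_system_squares cs.
have [f fP] := choice (fun x => geodesic_words cs x conn triv).
have fR x v : reduced (adj vx) (sq vx) (f x v) by have [_ _ h] := fP x.
have fw x v : exists r, f x v = v :: r by have [_ h] := fP x.
pose d x v := (size (f x v)).-1.
have fadj x u v : adj vx u v -> neighbours (adj vx) (sq vx) (f x u) (f x v).
  by have [_ _ _ _ h] := fP x; exact: h.
have fext x v u r : flips (sq vx) (f x v) [:: v, u & r] ->
    adj vx v u /\ flips (sq vx) (f x u) (u :: r).
  move=> F; have R := reduced_flips sg F (fR x v).
  have vu : adj vx v u by apply: adj_symm; case: R.
  split => //; have [ru Eu] := fw x u; rewrite Eu.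
  apply: (neighbour_uniq sg (v := v) (r := u :: r)); last by right; exists v => //; exact: flips_refl.
  apply: (neighbours_flips sg F (flips_refl _ _)); rewrite -Eu; exact: fadj.
exists d; split.
- move=> x v; rewrite /d; have [r E] := fw x v; rewrite E /= => /size0nil r0.
  by have [_ _ _ /(_ v)] := fP x; rewrite E r0.
- by move=> x; rewrite /d; have [-> _ _ _ _] := fP x.
- move=> x u v uv; rewrite /d; have [ru Eu] := fw x u; have [rv Ev] := fw x v.
  by case: (fadj x _ _ uv) => -[a _ /flips_size]; rewrite Eu Ev /=; lia.
- move=> x v; rewrite /d; have [[|u r] E] := fw x v; first by rewrite E.
  have [|vu F] := fext x v u r; first by rewrite E; exact: flips_refl.
  by exists u => //; rewrite E (flips_size F).
- move=> x v u u' vu vu' uu'; rewrite /d => du du'.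
  have [r E] := fw x v; have [ru Eu] := fw x u; have [ru' Eu'] := fw x u'.
  have down w rw : adj vx v w -> (f x w) = w :: rw ->
      (size (f x w)).-1 < (size (f x v)).-1 ->
      flips (sq vx) (f x v) [:: v, w & rw].
    move=> vw Ew; rewrite E Ew /= => lt.
    case: (fadj x _ _ vw) => -[a _ G].
      by have := flips_size G; rewrite E Ew /=; lia.
    by rewrite E Ew in G; have ? := flips_hd G; subst a.
  have G := down _ _ vu Eu du; have G' := down _ _ vu' Eu' du'.
  case: (flips_last_step sg (flips_trans (flips_sym sg G) G')) => [H|].
    by case: uu'; exact: flips_hd H.
  move=> [e [e' [s [q [S E1 E2]]]]].
  have ? := flips_hd E1; have ? := flips_hd E2; subst e e'.
  exists s => //; rewrite -Eu in E1; have [_ H] := fext _ _ _ _ E1.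
  by rewrite (flips_size H) (flips_size E1).
Qed.

Section HalfSpaces.
Variables (V : Type) (adj : V -> V -> Prop) (sq : V -> V -> V -> V -> Prop).
Variable d : V -> V -> nat.
Hypothesis sg : square_graph adj sq.
Hypothesis cd : cube_distance adj sq d.
Implicit Types u v w x y p q : V.

Lemma geodesic_exists x v : exists2 p : nat -> V, p 0 = x /\ p (d x v) = v &
  forall i, i < d x v -> adj (p i) (p i.+1) /\ d x (p i) = i.
Proof.
move E : (d x v) => n; elim: n v E => [|n IH] v E.
  by exists (fun=> x) => //; split => //; exact: (dist_eq0 cd).
have [|u vu Eu] := dist_down cd (x := x) (v := v); first by rewrite E.
have En : d x u = n by move: Eu; rewrite E => -[].
have [p [p0 pn] pP] := IH u En.
exists (fun i => if i <= n then p i else v); first by rewrite ltnn.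
move=> i; rewrite ltnS leq_eqVlt => /orP[/eqP ->|lt].
  by rewrite eqxx ltnn pn; split => //; exact: (adj_sym sg).
by rewrite lt orbT; exact: pP.
Qed.

Lemma dist_lip x u v : adj u v -> d x v <= (d x u).+1.
Proof. by move=> /(dist_adj cd x)[->|->] //; apply: leq_trans (leqnSn _) _; exact: leqnSn. Qed.

Lemma dist_triangle x y z : d x z <= d x y + d y z.
Proof.
have [p [p0 pn] pP] := geodesic_exists y z.
suff h i : i <= d y z -> d x (p i) <= d x y + i by rewrite -{1}pn h.
elim: i => [|i IH] lt; first by rewrite p0 addn0.
rewrite addnS; have [a _] := pP i lt.
by apply: leq_trans (dist_lip x a) _; rewrite ltnS; exact: IH (ltnW lt).
Qed.

Lemma dist_sym x y : d x y = d y x.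
Proof.
suff h a b : d b a <= d a b by apply/eqP; rewrite eqn_leq !h.
have [p [p0 pn] pP] := geodesic_exists a b.
have h i : i <= d a b -> d b (p (d a b - i)) <= i.
  elim: i => [|i IH] lt; first by rewrite subn0 pn (dist_xx cd).
  have lt' : d a b - i.+1 < d a b by lia.
  have [aa _] := pP _ lt'; have E : (d a b - i.+1).+1 = d a b - i by lia.
  rewrite E in aa; apply: leq_trans (dist_lip b (adj_sym sg aa)) _.
  by rewrite ltnS; exact: IH (ltnW lt).
by have := h _ (leqnn _); rewrite subnn p0.
Qed.

Lemma dist1 u v : adj u v -> d u v = 1.
Proof. by move=> /(dist_adj cd u)[|]; rewrite (dist_xx cd). Qed.

(** The combinatorial half-space into which the edge from [u] to [v] leads. *)
Definition side u v : set V := [set w | d w v < d w u].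

Lemma sideN u v w : adj u v -> ~ side u v w <-> side v u w.
Proof. by move=> /(dist_adj cd w); rewrite /side /=; lia. Qed.

Lemma side_r u v : adj u v -> side u v v.
Proof. by move=> uv; rewrite /side/= (dist_xx cd) dist_sym dist1. Qed.

Lemma side_l u v : adj u v -> ~ side u v u.
Proof. by move=> uv; rewrite /side/= (dist_xx cd). Qed.

Let sqr3 a b c e : sq a b c e -> sq e a b c.
Proof. by do 3 move/(sq_rot sg). Qed.

(** If a vertex [w] of the side of [b] were closer to [e] than to [c], then [b]
    and [e] would both be closer to [w] than [a], and so would be [c], the
    opposite vertex of the square. *)
Let side_sq_sub a b c e w : sq a b c e -> side a b w -> side e c w.
Proof.
move=> S; rewrite /side/= => lt; rewrite ltnNge; apply/negP => le.
have ab := sq_adj sg S; have bc := sq_adj sg (sq_rot sg S).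
have ce := sq_adj sg (sq_rot sg (sq_rot sg S)).
have ea := sq_adj sg (sqr3 S); have ae := adj_sym sg ea.
have dab := dist_adj cd w ab; have dbc := dist_adj cd w bc.
have dce := dist_adj cd w ce; have dea := dist_adj cd w ea.
have lt' : d w e < d w a by lia.
have [s S' ls] := dist_square cd ab ae (sq_neq sg S) lt lt'.
have E : s = c by exact: (sq_uniq sg S' S).
by subst s; lia.
Qed.

Lemma side_sq a b c e : sq a b c e -> side a b = side e c.
Proof.
move=> S; apply/seteqP; split=> w; first exact: side_sq_sub S.
by apply: side_sq_sub; exact/sqr3/(sq_rev sg)/(sq_rot sg)/(sq_rot sg).
Qed.

Inductive parallel : V -> V -> V -> V -> Prop :=
| parallel_refl u v : parallel u v u v
| parallel_sq u v u' v' p q : sq u v v' u' -> parallel u' v' p q -> parallel u v p q.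

Lemma parallel_side u v p q : parallel u v p q -> side u v = side p q.
Proof. by elim=> // {}u {}v u' v' {}p {}q /side_sq -> _. Qed.

(** Induction on the distance from [p] to [u]: the first edge from [u] towards
    [p] also comes closer to [q], as does the edge to [v], so both span a square
    and the edge opposite to [u], [v] is nearer to [p], [q]. *)
Lemma crossing_parallel u v p q : adj u v -> adj p q ->
  ~ side u v p -> side u v q -> parallel u v p q.
Proof.
move=> uv pq; move E : (d p u) => k; elim: k u v uv E => [|k IH] u v uv E np nq.
  have ? := dist_eq0 cd E; subst p.
  have dqu : d q u = 1 by rewrite dist_sym dist1.
  have ? : q = v by apply: (dist_eq0 cd); move: nq; rewrite /side/= dqu; case: (d q v).
  by subst q; exact: parallel_refl.
have [|u' uu' Eu'] := dist_down cd (x := p) (v := u); first by rewrite E.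
have np' := np; rewrite sideN// in np'; rewrite /side/= in np' nq.
have dpuv := dist_adj cd p uv; have dquv := dist_adj cd q uv.
have dq z : d q z = (d p z).+1 \/ d p z = (d q z).+1.
  by rewrite (dist_sym q) (dist_sym p); exact: (dist_adj cd).
have q1 := dq u; have q2 := dq v; have q3 := dq u'.
have lt1 : d q u' < d q u by lia.
have uv' : v <> u' by move=> ?; subst u'; lia.
have [s S ls] := dist_square cd uv uu' uv' nq lt1.
apply: (parallel_sq S).
have sideE := side_sq S.
apply: IH; rewrite -?sideE //; last by lia.
exact: (adj_sym sg (sq_adj sg (sq_rot sg (sq_rot sg S)))).
Qed.

Lemma crossing_side u v p q : adj u v -> adj p q ->
  ~ side u v p -> side u v q -> side p q = side u v.
Proof. by move=> *; apply/esym/parallel_side/crossing_parallel. Qed.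

(** The edges at [x] leading into two intersecting half-spaces not containing
    [x] span a square. *)
Lemma side_meet_square x y y' w : adj x y -> adj x y' -> y <> y' ->
  side x y w -> side x y' w -> exists c, sq x y c y'.
Proof. by move=> xy xy' yy' sy sy'; have [c] := dist_square cd xy xy' yy' sy sy'; exists c. Qed.

Lemma side_down u v w : adj u v -> side u v w -> w <> v ->
  exists w', [/\ adj w w', side u v w' & d w' v < d w v].
Proof.
move=> uv sw wv; have [|w' ww' Ew'] := dist_down cd (x := v) (v := w).
  by apply/eqP => /(dist_eq0 cd)/esym.
exists w'; split => //; last by rewrite !(dist_sym _ v) Ew'.
move: sw; rewrite /side/= !(dist_sym w).
have := dist_adj cd u ww'; rewrite !(dist_sym w'); lia.
Qed.

Lemma side_separates x y : x <> y -> exists2 x', adj x x' & side x x' y.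
Proof.
move=> xy; have [|x' xx' E] := dist_down cd (x := y) (v := x).
  by apply/eqP => /(dist_eq0 cd)/esym.
by exists x' => //; rewrite /side/= E.
Qed.

End HalfSpaces.

Local Open Scope ring_scope.

(** * The cube system of a cube complex *)

Section Vertices.
Import Defs.
Context {R : realType}.

Definition bvec n (b : bits n) : 'rV[R]_n := \row_i (b i)%:R.

Lemma bvecE n (b : bits n) i : bvec b 0 i = (b i)%:R.
Proof. by rewrite mxE. Qed.

Lemma bvec_icube n (b : bits n) : icube (bvec b).
Proof. by move=> i; rewrite bvecE; case: (b i); rewrite ?lexx ?ler01. Qed.

Lemma bvec_inj n : injective (@bvec n).
Proof.
move=> b b' /matrixP E; apply/ffunP => i; have := E 0 i; rewrite !bvecE => /eqP.
by rewrite eqr_nat; case: (b i); case: (b' i).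
Qed.

(** Distances between corners count coordinates, so that isometries of faces
    preserve adjacency. *)
Lemma edist_bvec n (b b' : bits n) : edist (bvec b) (bvec b') ^+ 2 = (hamming b b')%:R :> R.
Proof.
rewrite sqr_sqrtr; last by apply: sumr_ge0 => i _; exact: sqr_ge0.
rewrite /hamming -sum1_card natr_sum [RHS]big_mkcond /=; apply: eq_bigr => i _.
rewrite !bvecE inE; case: (b i); case: (b' i) => /=; rewrite ?subrr ?expr0n//;
by rewrite ?subr0 ?sub0r ?sqrrN ?expr1n.
Qed.

Lemma hamming_flipb n (b : bits n) i : hamming b (flipb b i) = 1%N.
Proof.
rewrite /hamming -(card1 i); apply: eq_card => j; rewrite !inE.
have [->|ji] := eqVneq j i; first by rewrite flipb_eq; case: (b i).
by rewrite flipb_neq// eqxx.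
Qed.

Lemma hamming1 n (b b' : bits n) : hamming b b' = 1%N -> exists i, b' = flipb b i.
Proof.
move=> /mem_card1[i iP].
exists i; apply/ffunP => j; have := iP j; rewrite !inE.
have [->|ji] := eqVneq j i; first by rewrite flipb_eq; case: (b i); case: (b' i).
by rewrite flipb_neq//; case: (b j); case: (b' j).
Qed.

Variable X : cubeComplex R.

Definition vert := {v : X | vertex v}.

Lemma chart_eq (c : cell X) (s t : 'rV[R]_(dim c)) : icube s -> icube t ->
  chart (c := c) s = chart (c := c) t -> s = t.
Proof. by move=> cs ct; apply: (@chart_inj _ X c); rewrite inE. Qed.

Lemma in_cell (c : cell X) (t : 'rV[R]_(dim c)) : icube t -> closed_cell c (chart t).
Proof. by exists t. Qed.

Lemma meet_edist (c d : cell X) (s s' : 'rV[R]_(dim c)) (t t' : 'rV[R]_(dim d)) :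
  icube s -> icube s' -> icube t -> icube t' ->
  chart (c := c) s = chart (c := d) t -> chart (c := c) s' = chart (c := d) t' ->
  edist s s' = edist t t'.
Proof.
move=> cs cs' ct ct' E E'.
have [|F [F' [FI FI' iso]]] := @cell_meet _ X c d.
  by exists (chart s); split; [exists s|exists t].
have inI (u : 'rV[R]_(dim c)) (v : 'rV[R]_(dim d)) : icube u -> icube v -> chart (c := c) u = chart (c := d) v ->
    cube_face F u /\ cube_face F' v.
  move=> cu cv uv.
  have Iu : (chart (c := c) @` icube (n := _) `&` chart (c := d) @` icube (n := _)) (chart u).
    by split; [exists u|exists v].
  split.
    move: (Iu); rewrite -FI => -[u' fu' uu'].
    by rewrite (chart_eq cu _ (esym uu')) //; exact: fu'.1.
  move: Iu; rewrite -FI' uv => -[v' fv' vv'].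
  by rewrite (chart_eq cv _ (esym vv')) //; exact: fv'.1.
have [f1 f2] := inI _ _ cs ct E; have [f1' f2'] := inI _ _ cs' ct' E'.
exact: iso.
Qed.

Lemma meet_face (c d : cell X) p : closed_cell c p -> closed_cell d p ->
  exists F : 'I_(dim c) -> option bool, forall t : 'rV[R]_(dim c), icube t ->
    closed_cell d (chart t) <-> cube_face F t.
Proof.
move=> cp dp; have [|F [_ [FI _ _]]] := @cell_meet _ X c d; first by exists p.
exists F => t ct; split=> [dt|ft].
  have : (chart (c := c) @` icube (n := _) `&` chart (c := d) @` icube (n := _)) (chart t).
    by split => //; exact: in_cell.
  rewrite -FI => -[t' ft' tt'].
  by rewrite (chart_eq ct _ (esym tt')) //; exact: ft'.1.
have : (chart (c := c) @` cube_face F) (chart t) by exists t.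
by rewrite FI => -[].
Qed.

(** A vertex of the complex inside a cell spans a face with one point, which
    leaves no coordinate free. *)
Lemma vertex_bits (c : cell X) p : vertex p -> closed_cell c p ->
  exists b : bits (dim c), p = chart (bvec b).
Proof.
move=> [e _ ep] cp; have epp : closed_cell e p by rewrite ep.
have [F FP] := meet_face cp epp.
have [t ct tp] := cp.
have ft : cube_face F t by apply/FP => //; rewrite tp.
have Fs i : F i != None.
  apply/eqP => Fi; pose x : R := if t 0 i == 0 then 1 else 0.
  pose t' : 'rV[R]_(dim c) := \row_j if j == i then x else t 0 j.
  have ct' : icube t'.
    move=> j; rewrite mxE; case: eqP => [_|_]; last exact: ct.
    by rewrite /x; case: ifP; rewrite lexx ler01.
  have /FP : cube_face F t'.
    split => // j b Fj; rewrite mxE; case: eqP => [ji|_]; last exact: ft.2.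
    by rewrite ji Fi in Fj.
  rewrite ep => /(_ ct') E; have /(chart_eq ct' ct) tt' : chart t' = chart t by rewrite E.
  have := congr1 (fun u : 'rV[R]_(dim c) => u 0 i) tt'; rewrite mxE eqxx /x.
  case: ifP => [/eqP -> /eqP|/eqP h /esym//]; by rewrite oner_eq0.
exists [ffun i => odflt false (F i)]; rewrite -tp; congr chart; apply/rowP => i.
by rewrite bvecE ffunE; have := Fs i; case Fi : (F i) => [b|]//= _; exact: ft.2.
Qed.

Lemma corner_vertex (c : cell X) (b : bits (dim c)) : vertex (chart (c := c) (bvec b)).
Proof.
have [e eE] := @cell_face _ X c (fun i => Some (b i)).
have e1 : closed_cell e = [set chart (c := c) (bvec b)].
  rewrite [LHS]eE; apply/seteqP; split=> [_ [t [ct tb] <-]|_ ->].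
    by congr chart; apply/rowP => i; rewrite bvecE; exact: tb.
  by exists (bvec b) => //; split=> [|i b' [<-]]; [exact: bvec_icube|exact: bvecE].
exists e => //; case E : (dim e) => [//|n].
have c0 : icube (0 : 'rV[R]_(dim e)) by move=> j; rewrite mxE lexx ler01.
have c1 : icube (const_mx 1 : 'rV[R]_(dim e)) by move=> j; rewrite mxE lexx ler01.
have h0 := in_cell c0; have h1 := in_cell c1; rewrite e1 in h0 h1.
have /matrixP /(_ 0 (cast_ord (esym E) ord0)) : (0 : 'rV[R]_(dim e)) = const_mx 1.
  by apply: (chart_eq c0 c1); rewrite h0 h1.
by rewrite !mxE => /esym/eqP; rewrite oner_eq0.
Qed.

Definition vx (c : cell X) (b : bits (dim c)) : vert :=
  exist _ (chart (c := c) (bvec b)) (corner_vertex b).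

Lemma vert_eq (u v : vert) : sval u = sval v -> u = v.
Proof. by case: u v => [u pu] [v pv] /= E; subst v; rewrite (Prop_irrelevance pu pv). Qed.

Lemma incellP (c : cell X) (v : vert) : incell vx c v <-> closed_cell c (sval v).
Proof.
split=> [[b ->]|h]; first by apply: in_cell; exact: bvec_icube.
by have [b E] := vertex_bits (svalP v) h; exists b; exact: vert_eq.
Qed.

Lemma vx_injective (c : cell X) : injective (@vx c).
Proof.
move=> b b' /(congr1 sval) /= E; apply: bvec_inj.
by apply: chart_eq E; exact: bvec_icube.
Qed.

(** Two corners in a common face which differ in direction [i] show that the
    face is free in that direction, hence contains the flipped corner; the
    isometry between the two descriptions of the face keeps it adjacent. *)
Lemma vx_family : cube_family vx.
Proof.
split; first exact: vx_injective.
move=> c d b b1 b' b1' i E E1 bi.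
have db : closed_cell d (chart (c := c) (bvec b)).
  by rewrite [chart _](congr1 sval E); apply: in_cell; exact: bvec_icube.
have db1 : closed_cell d (chart (c := c) (bvec b1)).
  by rewrite [chart _](congr1 sval E1); apply: in_cell; exact: bvec_icube.
have [F FP] := meet_face (in_cell (bvec_icube b)) db.
have /FP : closed_cell d (chart (c := c) (bvec b)) by [].
move=> /(_ (bvec_icube _)) fb.
have /FP : closed_cell d (chart (c := c) (bvec b1)) by [].
move=> /(_ (bvec_icube _)) fb1.
have Fi : F i = None.
  case Fi : (F i) => [s|]//; have := fb.2 _ _ Fi; have := fb1.2 _ _ Fi.
  rewrite !bvecE => /eqP + /eqP; rewrite !eqr_nat.
  by move: bi; case: (b i); case: (b1 i); case: (s).
have dfl : closed_cell d (chart (c := c) (bvec (flipb b i))).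
  apply/FP; first exact: bvec_icube.
  split=> [|j s Fj]; first exact: bvec_icube.
  rewrite bvecE flipb_neq; first by rewrite -bvecE; exact: fb.2.
  by apply/eqP => ji; rewrite ji Fi in Fj.
have [b2 E2] := vertex_bits (corner_vertex _) dfl.
have /hamming1[i' Ei'] : hamming b' b2 = 1%N.
  apply/eqP; rewrite -(eqr_nat R) -edist_bvec.
  rewrite -(meet_edist (bvec_icube b) (bvec_icube (flipb b i)) _ _ (congr1 sval E) E2).
  - by rewrite edist_bvec hamming_flipb.
  - exact: bvec_icube.
  - exact: bvec_icube.
by exists i'; apply: vert_eq; rewrite -Ei'.
Qed.

Lemma face_cell (c : cell X) (F : 'I_(dim c) -> option bool) :
  exists d : cell X, closed_cell d `<=` closed_cell c /\
    forall b : bits (dim c), closed_cell d (sval (vx b)) <->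
      forall i s, F i = Some s -> b i = s.
Proof.
have [d dE] := @cell_face _ X c F; exists d; split.
  by rewrite [closed_cell d]dE => _ [t [ct _] <-]; exact: in_cell.
move=> b; rewrite [closed_cell d]dE; split=> [[t [ct ft] /= E] i s Fi|h].
  have := ft _ _ Fi; rewrite (chart_eq ct (bvec_icube b) E) bvecE => /eqP.
  by rewrite eqr_nat; case: (b i); case: s {Fi}.
exists (bvec b) => //; split=> [|i s Fi]; first exact: bvec_icube.
by rewrite bvecE (h _ _ Fi).
Qed.

(** The edge with ends [a] and [u], as the smallest cell containing both. *)
Definition edge_cell (a u : vert) (e : cell X) :=
  [/\ dim e = 1%N, closed_cell e (sval a), closed_cell e (sval u) &
      forall d : cell X, closed_cell d (sval a) -> closed_cell d (sval u) ->
        closed_cell e `<=` closed_cell d].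

Lemma bits_dim1 n (b b' : bits n) : n = 1%N -> b <> b' -> forall i, b i != b' i.
Proof.
move=> n1 bb' i; apply/eqP => E; apply: bb'; apply/ffunP => j.
by suff -> : j = i by []; apply: val_inj; case: i j {E} => i /= + [j /= +]; rewrite n1; case: i; case: j.
Qed.

Lemma edge_cell_min (e : cell X) (a u : vert) : dim e = 1%N -> a <> u ->
  closed_cell e (sval a) -> closed_cell e (sval u) -> edge_cell a u e.
Proof.
move=> e1 au ea eu; split => // d da du.
have [F FP] := meet_face ea da.
have /incellP[b Eb] := ea; have /incellP[b' Eb'] := eu.
have bb' : b <> b' by move=> E; apply: au; rewrite Eb Eb' E.
have FN i : F i = None.
  case Fi : (F i) => [s|]//; have neq := bits_dim1 e1 bb' i.
  move: da; rewrite Eb => /(FP _ (bvec_icube b))[_ /(_ _ _ Fi)].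
  move: du; rewrite Eb' => /(FP _ (bvec_icube b'))[_ /(_ _ _ Fi)].
  rewrite !bvecE => /eqP + /eqP; rewrite !eqr_nat.
  by move: neq; case: (b i); case: (b' i); case: (s).
by move=> _ [t ct <-]; apply/FP => //; split => // i s; rewrite FN.
Qed.

Lemma edge_cell_exists a u : adj vx a u -> exists e, edge_cell a u e.
Proof.
move=> [c [b [i [-> ->]]]].
have [e [ec eP]] := face_cell (fun j => if j == i then None else Some (b j)).
have ea : closed_cell e (sval (vx b)).
  by apply/eP => j s; case: eqP => // _ [].
have eu : closed_cell e (sval (vx (flipb b i))).
  by apply/eP => j s; case: eqP => // /eqP ji [<-]; rewrite flipb_neq.
have au : vx b <> vx (flipb b i) by move=> /vx_injective/esym; exact: flipb_id.
exists e; apply: edge_cell_min => //.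
have only v : closed_cell e (sval v) -> v <> vx b -> v = vx (flipb b i).
  move=> ev vb; have /incellP[b' Eb'] := ec _ ev; subst v.
  congr vx; apply/ffunP => j; have [->|ji] := eqVneq j i.
    rewrite flipb_eq; have : b' i != b i; last by case: (b i); case: (b' i).
    apply/eqP => E; apply: vb; congr vx; apply/ffunP => k.
    have [->//|ki] := eqVneq k i.
    by have /eP := ev; apply; rewrite (negbTE ki).
  rewrite flipb_neq//; have /eP := ev; apply; by rewrite (negbTE ji).
have /incellP[b0 E0] := ea.
have other (k : 'I_(dim e)) : vx (flipb b0 k) = vx (flipb b i).
  apply: only; first by apply/incellP; exists (flipb b0 k).
  by rewrite E0 => /vx_injective; exact: flipb_id.
case E : (dim e) => [|[|n]] //.
  exfalso; have /incellP[b1 E1] := eu; apply: au; rewrite E0 E1; congr vx.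
  by apply/ffunP => j; have := ltn_ord j; rewrite {2}E.
exfalso; have lt0 : (0 < dim e)%N by rewrite E.
have lt1 : (1 < dim e)%N by rewrite E.
have := etrans (other (Ordinal lt0)) (esym (other (Ordinal lt1))).
by move=> /vx_injective/flipb_inj/(congr1 val).
Qed.

Lemma edge_cell_uniq a u e e' : edge_cell a u e -> edge_cell a u e' -> e = e'.
Proof.
move=> [_ ea eu em] [_ ea' eu' em']; apply: cell_inj.
by apply/seteqP; split; [exact: em|exact: em'].
Qed.

Lemma edge_cell_other (e : cell X) (a : vert) : dim e = 1%N -> closed_cell e (sval a) ->
  exists2 u, adj vx a u & edge_cell a u e.
Proof.
move=> e1 /[dup] ea /incellP[b Eb]; have lt0 : (0 < dim e)%N by rewrite e1.
have au : adj vx a (vx (flipb b (Ordinal lt0))).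
  by exists e, b, (Ordinal lt0).
exists (vx (flipb b (Ordinal lt0))) => //; apply: edge_cell_min => //.
  exact: (adj_neq vx_family au).
by apply/incellP; eexists.
Qed.

Lemma edge_cell_end (a u u' : vert) (e : cell X) : edge_cell a u e -> adj vx a u ->
  adj vx a u' -> closed_cell e (sval u') -> u' = u.
Proof.
move=> [e1 /incellP[b Eb] /incellP eu _] au au' /incellP eu'; subst a.
have [i ->] := adj_incell vx_family au eu.
have [i' ->] := adj_incell vx_family au' eu'.
congr vx; congr flipb; apply: val_inj.
by case: i i' => i /= + [i' /=]; rewrite e1; case: i; case: i'.
Qed.

(** A set of neighbours of [a] which pairwise span squares is a clique of the
    link of [a]; the flag condition fills it with a cell. *)
Lemma vx_cube_system : (forall v : X, vertex v -> flag_complex (link v)) -> cube_system vx.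
Proof.
move=> flag; split; first exact: vx_family.
move=> a S finS [u0 Su0] Sadj Ssq.
have [_ flagK] := flag _ (svalP a).
have [E EP] : exists E : vert -> cell X, forall u, S u -> edge_cell a u (E u).
  have [e0 _] := edge_cell_exists (Sadj _ Su0).
  suff /choice[E EP] : forall u, exists e, S u -> edge_cell a u e by exists E.
  move=> u; have [Su|nSu] := pselect (S u); last by exists e0.
  by have [e eP] := edge_cell_exists (Sadj _ Su); exists e.
have neq u : S u -> a <> u by move=> /Sadj; exact: (adj_neq vx_family).
have pos (c : cell X) (u v : vert) : u <> v -> closed_cell c (sval u) ->
    closed_cell c (sval v) -> (0 < dim c)%N.
  move=> uv /incellP[b Eb] /incellP[b' Eb']; case dc : (dim c) => [|//].
  case: uv; rewrite Eb Eb'; congr vx; apply/ffunP => j.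
  by have := ltn_ord j; rewrite {2}dc.
have edges_sub (c : cell X) w : closed_cell c (sval a) -> S w ->
    closed_cell c (sval w) -> edges_at (sval a) c (E w).
  by move=> ca Sw cw; have [g1 ga gw gm] := EP _ Sw; split => //; split => //; exact: gm.
have [|||c c0 ca_Ac] := flagK (E @` S).
- exact: finite_image.
- by exists (E u0), u0.
- move=> _ _ [u Su <-] [v Sv <-].
  have [e1 ea eu em] := EP _ Su; have [f1 fa fv fm] := EP _ Sv.
  have [?|uv] := pselect (u = v).
    subst v; exists (E u); first by rewrite e1.
    apply/seteqP; split=> [_ [->|->]|e [d1 [da dE]]]; do ?exact: edges_sub.
    have [u' au' E'] := edge_cell_other d1 da.
    have ? : u' = u.
      by apply: edge_cell_end (EP _ Su) (Sadj _ Su) au' _; apply: dE; case: E'.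
    by subst u'; left; exact: edge_cell_uniq E' (EP _ Su).
  have [w [c [b [i [j [ij Ea Eu Ew Ev]]]]]] := Ssq _ _ Su Sv uv.
  have [s [sc sP]] := face_cell (fun k => if (k == i) || (k == j) then None else Some (b k)).
  have sa : closed_cell s (sval a).
    by rewrite Ea; apply/sP => k t; case: ifP => // _ [].
  have su : closed_cell s (sval u).
    rewrite Eu; apply/sP => k t; case: ifPn => // + [<-].
    by rewrite negb_or => /andP[ki _]; rewrite flipb_neq.
  have sv : closed_cell s (sval v).
    rewrite Ev; apply/sP => k t; case: ifPn => // + [<-].
    by rewrite negb_or => /andP[_ kj]; rewrite flipb_neq.
  exists s; first by split => //; exact: (pos s a u (neq _ Su)).
  apply/seteqP; split=> [_ [->|->]|e [d1 [da dE]]]; do ?exact: edges_sub.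
  have [u' au' E'] := edge_cell_other d1 da.
  have su' : closed_cell s (sval u') by apply: dE; case: E'.
  have [k Ek] : exists k, u' = vx (flipb b k).
    apply: (adj_incell vx_family); first by rewrite -Ea.
    by apply/incellP; exact: sc.
  have : (k == i) || (k == j).
    apply/negPn/negP => nk; move: su'; rewrite Ek => /sP /(_ k (b k)).
    rewrite (negbTE nk) flipb_eq => /(_ erefl); by case: (b k).
  move=> /orP[/eqP ki|/eqP kj]; subst k.
    by left; apply: edge_cell_uniq (EP _ Su); rewrite Eu -Ek.
  by right; apply: edge_cell_uniq (EP _ Sv); rewrite Ev -Ek.
have [ca Ac] := c0.
have /incellP[b Eb] := Ac; exists c, b; split => // u Su.
have : edges_at (sval a) c (E u) by rewrite -ca_Ac; exists u.
move=> [_ [_ sub]]; apply: (adj_incell vx_family); first by rewrite -Eb; exact: Sadj.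
by apply/incellP; apply: sub; case: (EP _ Su).
Qed.

End Vertices.

(** * Interval gluing *)

Section Cousin.
Context {R : realType}.

(** A property of intervals which holds for small intervals around each point
    and which passes to unions of adjacent intervals holds for all: the supremum
    of the right ends that can be reached from [lo] can be passed. *)
Lemma interval_gluing (P : R -> R -> Prop) (lo hi : R) : lo <= hi ->
  (forall a b c, lo <= a -> a <= b -> b <= c -> c <= hi -> P a b -> P b c -> P a c) ->
  (forall x, lo <= x <= hi -> exists2 e, 0 < e &
    forall a b, lo <= a -> a <= x -> x <= b -> b <= hi -> x - a < e -> b - x < e -> P a b) ->
  P lo hi.
Proof.
move=> lohi glue loc.
pose S := [set x | lo <= x <= hi /\ P lo x].
have S0 : S lo.
  split; first by rewrite lexx.
  have [|e e0 h] := loc lo; first by rewrite lexx.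
  by apply: h; rewrite ?lexx ?subrr.
have Sub : has_sup S by split; [exists lo|exists hi => x [/andP[]]].
have slo : lo <= sup S by exact: (ub_le_sup Sub.2 S0).
have shi : sup S <= hi by apply: ge_sup; [exists lo|move=> x [/andP[]]].
have [|e e0 h] := loc (sup S); first by rewrite slo.
have [y [/andP[ly yh] Py] sy] := sup_adherent e0 Sub.
have ys : y <= sup S by apply: (ub_le_sup Sub.2); split => //; rewrite ly.
have [s' [s's s'e s'h s'hi]] : exists s', [/\ sup S <= s', s' - sup S < e, s' <= hi &
    sup S < s' \/ s' = hi].
  have [le|lt] := leP hi (sup S + e / 2); last by exists (sup S + e / 2); split; lra.
  by exists hi; split; rewrite ?lexx//; [lra|right].
have Ps' : P lo s'.
  by apply: (glue lo y) => //; [lra|apply: h => //; lra].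
have : S s' by split => //; rewrite s'h (le_trans slo s's).
move=> /(ub_le_sup Sub.2) s's'; case: s'hi => [lt|<-//].
by have := lt_le_trans lt s's'; rewrite ltxx.
Qed.

End Cousin.

(** * Monodromy of coverings along continuous maps *)

Section Stars.
Import Defs.
Context {R : realType} (X : cubeComplex R).
Local Notation vert := (vert X).
Local Notation vx := (@vx R X).

(** The vertices of the smallest cell containing a point. *)
Definition carrier (p : X) : set vert :=
  [set v | forall c : cell X, closed_cell c p -> closed_cell c (sval v)].

Lemma carrier_incell p v (c : cell X) : carrier p v -> closed_cell c p -> incell vx c v.
Proof. by move=> cv cp; apply/incellP; exact: cv. Qed.

(** A corner belongs to the smallest face containing [t] unless some coordinate
    of [t] pins it to the opposite face. *)
Lemma carrier_chart (c : cell X) (b : bits (dim c)) (t : 'rV[R]_(dim c)) : icube t ->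
  carrier (chart t) (vx b) <-> forall i, t 0 i <> (~~ b i)%:R.
Proof.
move=> ct; split=> [cv i ti|h d dt].
  have [d dE] := @cell_face _ X c (fun j => if j == i then Some (~~ b i) else None).
  have : closed_cell d (chart t).
    by rewrite [closed_cell d]dE; exists t => //; split => // j s; case: eqP => // -> [<-].
  move=> /cv; rewrite [closed_cell d]dE => -[s [cs fs] E].
  have := fs i (~~ b i); rewrite eqxx => /(_ erefl).
  rewrite (chart_eq cs (bvec_icube b) E) bvecE => /eqP.
  by rewrite eqr_nat; case: (b i).
have [F FP] := meet_face (in_cell ct) dt.
apply/FP; first exact: bvec_icube.
have /FP : closed_cell d (chart t) by [].
move=> /(_ ct) ft; split=> [|i s Fi]; first exact: bvec_icube.
rewrite bvecE; have := ft.2 _ _ Fi; have := h i.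
by case: (b i); case: s {Fi}.
Qed.

Lemma carrier_nonempty p : carrier p !=set0.
Proof.
have [c [t ct <-]] := chart_cover p.
exists (vx [ffun i => t 0 i != 0]); apply/carrier_chart => // i; rewrite ffunE negbK.
by case: eqP => [->|h] //= /eqP; rewrite eq_sym oner_eq0.
Qed.

Lemma carrier_vertex (u v : vert) : carrier (sval u) v <-> v = u.
Proof.
split=> [h|-> //]; apply: vert_eq; have [c _ cu] := svalP u.
have : closed_cell c (sval u) by rewrite cu.
by move=> /h; rewrite cu.
Qed.

(** Stars of vertices form the open cover over which coverings are trivial. *)
Lemma star_open v : open [set p | carrier p v].
Proof.
move=> c; apply/open_subspaceP.
have [/incellP[b Eb]|ncv] := pselect (closed_cell c (sval v)); last first.
  exists set0; first exact: open0.
  rewrite set0I; apply/seteqP; split=> // t [/= tv ct].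
  by apply: ncv; apply: tv; exact: in_cell.
exists [set t : 'rV[R]_(dim c) | forall i, t 0 i <> (~~ b i)%:R]; last first.
  apply/seteqP; split=> t [/= h ct]; split => //; rewrite ?Eb.
    by apply/carrier_chart.
  by move: h; rewrite Eb; move/(carrier_chart _ ct).
rewrite openE => t /= h.
apply: (@filter_forall _ _ (fun i => [set u : 'rV[R]_(dim c) | u 0 i <> (~~ b i)%:R]) (nbhs t)) => i.
have : nbhs (t 0 i) (~` [set (~~ b i)%:R]).
  apply: open_nbhs_nbhs; split; last exact: h.
  by apply: closed_openC; exact: closed_eq.
exact: coord_continuous.
Qed.

Lemma star_nbhs p v : carrier p v -> nbhs p [set q | carrier q v].
Proof. by move=> pv; apply: open_nbhs_nbhs; split => //; exact: star_open. Qed.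

Lemma chart_continuous (c : cell X) :
  {within icube (n := dim c), continuous (chart (c := c))}.
Proof. by apply/continuousP => U oU; exact: oU. Qed.

Lemma incell_walk (c : cell X) u v : incell vx c u -> incell vx c v ->
  exists n, walk vx n u v.
Proof.
move=> [b ->] [b' ->]; move: b'; apply: (bits_ind (b' := b)).
  by exists 0%N; exact: walk0.
move=> b1 i _ [n h]; exists n.+1; apply: walkS h _.
by exists c, (flipb b1 i), i; rewrite flipbK.
Qed.

Definition rdist (s t : R) := `|s - t|.
Definition boxdist (p q : R * R) := Num.max (rdist p.1 q.1) (rdist p.2 q.2).

Section Lifts.
Variables (W : Type) (pi : W -> vert) (mv : W -> W -> Prop).
Hypothesis cov : covering vx pi mv.
Local Notation same := (samecell vx pi mv).
Let fam := vx_family X.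

(** [stable] and [islift] are continuity statements with an explicit distance on
    the parameter, which serves both paths and maps on a square. *)
Definition stable (T : Type) (dist : T -> T -> R) (h : T -> X) (A : set T) :=
  forall q v, A q -> carrier (h q) v -> exists2 e, 0 < e &
    forall q', A q' -> dist q q' < e -> carrier (h q') v.

Definition islift (T : Type) (dist : T -> T -> R) (h : T -> X) (A : set T) (L : T -> W) :=
  (forall q, A q -> carrier (h q) (pi (L q))) /\
  forall q, A q -> exists2 e, 0 < e &
    forall q', A q' -> dist q q' < e -> same (L q) (L q').

Let same_at p w w1 w2 : carrier p (pi w) -> carrier p (pi w1) -> carrier p (pi w2) ->
  same w w1 -> same w1 w2 -> same w w2.
Proof.
move=> h h1 h2; have [c cp] := chart_cover p.
apply: (samecell_trans fam cov (c := c)); exact: (carrier_incell _ cp).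
Qed.

Let same_refl_at p w : carrier p (pi w) -> same w w.
Proof.
move=> h; have [c cp] := chart_cover p; apply: (samecell_refl cov (c := c)).
exact: (carrier_incell _ cp).
Qed.

Let same_exists_at p w u : carrier p (pi w) -> carrier p u ->
  exists2 w', pi w' = u & same w w'.
Proof.
move=> h1 h2; have [c cp] := chart_cover p.
by apply: (samecell_exists cov (c := c)); exact: (carrier_incell _ cp).
Qed.

Lemma islift_pull T T' (dist : T -> T -> R) (dist' : T' -> T' -> R) h A L
    (j : T' -> T) h' A' :
  (forall q, A' q -> A (j q) /\ h (j q) = h' q) ->
  (forall q q', dist (j q) (j q') <= dist' q q') ->
  islift dist h A L -> islift dist' h' A' (L \o j).
Proof.
move=> jA jd [L1 L2]; split=> [q /jA[Aq <-]|q /jA[Aq _]]; first exact: L1.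
have [e e0 he] := L2 _ Aq; exists e => // q' /jA[Aq' _] lt.
by apply: he => //; exact: le_lt_trans (jd _ _) lt.
Qed.

Lemma islift_sub T (dist : T -> T -> R) h A B L : B `<=` A -> islift dist h A L ->
  islift dist h B L.
Proof.
move=> BA [L1 L2]; split=> [q /BA|q /BA /L2[e e0 he]]; first exact: L1.
by exists e => // q' /BA; exact: he.
Qed.

(** Two lifts along a segment agree everywhere or nowhere. *)
Lemma lifts_agree f lo hi L L' : lo <= hi -> stable rdist f `[lo, hi] ->
  islift rdist f `[lo, hi] L -> islift rdist f `[lo, hi] L' ->
  same (L lo) (L' lo) <-> same (L hi) (L' hi).
Proof.
move=> lohi st [L1 L2] [L1' L2'].
apply: (@interval_gluing R (fun a b => same (L a) (L' a) <-> same (L b) (L' b)) lo hi lohi).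
  by move=> a b c _ _ _ _ [h1 h2] [h3 h4]; split=> h; [apply/h3/h1|apply/h2/h4].
move=> x xlh; have Ax : `[lo, hi]%classic x by rewrite /= in_itv.
have [e1 e10 h1] := st _ _ Ax (L1 _ Ax).
have [e2 e20 h2] := st _ _ Ax (L1' _ Ax).
have [e3 e30 h3] := L2 _ Ax; have [e4 e40 h4] := L2' _ Ax.
pose e := Num.min (Num.min e1 e2) (Num.min e3 e4).
have near y : `[lo, hi]%classic y -> `|x - y| < e -> same (L x) (L' x) <-> same (L y) (L' y).
  move=> Ay; rewrite !lt_min => /andP[/andP[d1 d2] /andP[d3 d4]].
  have k1 := h1 _ Ay d1; have k2 := h2 _ Ay d2.
  have k3 := h3 _ Ay d3; have k4 := h4 _ Ay d4.
  have k5 := L1 _ Ay; have k6 := L1' _ Ay.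
  split=> h.
    apply: (same_at k5 k1 k6); first exact: samecell_sym.
    exact: (same_at k1 k2 k6).
  apply: (same_at k1 k5 k2 k3).
  by apply: (same_at k5 k6 k2 h); exact: samecell_sym.
exists e; first by rewrite !lt_min e10 e20 e30 e40.
move=> a b la ax xb bh ea eb.
have Aa : `[lo, hi]%classic a by rewrite /= in_itv/= la; lra.
have Ab : `[lo, hi]%classic b by rewrite /= in_itv/= bh andbT; lra.
have /(near a Aa) na : `|x - a| < e by rewrite ger0_norm ?subr_ge0.
have /(near b Ab) nb : `|x - b| < e by rewrite distrC ger0_norm ?subr_ge0.
by split=> h; [apply/nb/na|apply/na/nb].
Qed.

Definition liftable (h : R * R -> X) (A : set (R * R)) := forall q w, A q ->
  carrier (h q) (pi w) -> exists2 L, islift boxdist h A L & same (L q) w.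

(** Two lifts are glued after making them agree at one common point [q1], hence
    on the whole intersection. *)
Lemma liftable_union h A B q1 : stable boxdist h (A `|` B) ->
  (forall q, A q -> ~ B q -> exists2 e, 0 < e & forall q', boxdist q q' < e -> ~ B q') ->
  (forall q, B q -> ~ A q -> exists2 e, 0 < e & forall q', boxdist q q' < e -> ~ A q') ->
  A q1 -> B q1 ->
  (forall L L', islift boxdist h (A `&` B) L -> islift boxdist h (A `&` B) L' ->
    same (L q1) (L' q1) -> forall q, A q -> B q -> same (L q) (L' q)) ->
  liftable h A -> liftable h B -> liftable h (A `|` B).
Proof.
move=> st nB nA Aq1 Bq1 agree lA lB.
have glue L1 L2 : islift boxdist h A L1 -> islift boxdist h B L2 -> same (L2 q1) (L1 q1) ->
    let L q := if `[< A q >] then L1 q else L2 q in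
    islift boxdist h (A `|` B) L /\ forall q, B q -> same (L q) (L2 q).
  move=> l1 l2 s12 L.
  have ag q : A q -> B q -> same (L1 q) (L2 q).
    move=> Aq Bq; apply: samecell_sym; apply: agree Aq Bq => //.
      by apply: islift_sub l2 => ? [].
    by apply: islift_sub l1 => ? [].
  have LA q : A q -> L q = L1 q by rewrite /L => Aq; rewrite asboolT.
  have LB q : ~ A q -> L q = L2 q by rewrite /L => Aq; rewrite asboolF.
  have sB q : B q -> same (L q) (L2 q).
    move=> Bq; have [Aq|nAq] := pselect (A q); first by rewrite LA//; exact: ag.
    by rewrite LB//; apply: same_refl_at; exact: l2.1.
  have c1 q : (A `|` B) q -> carrier (h q) (pi (L q)).
    move=> ABq; have [Aq|nAq] := pselect (A q); first by rewrite LA//; exact: l1.1.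
    by rewrite LB//; apply: l2.1; case: ABq.
  split=> //; split=> // q ABq.
  have [Aq|nAq] := pselect (A q).
    have [e1 e10 h1] := l1.2 _ Aq.
    have [Bq|nBq] := pselect (B q); last first.
      have [e2 e20 h2] := nB _ Aq nBq.
      exists (Num.min e1 e2); first by rewrite lt_min e10.
      move=> q' ABq'; rewrite lt_min => /andP[d1 /h2 nBq'].
      have Aq' : A q' by case: ABq'.
      by rewrite LA// LA//; exact: h1.
    have [e2 e20 h2] := l2.2 _ Bq.
    have [e3 e30 h3] := st _ _ ABq (l1.1 _ Aq).
    have [e4 e40 h4] := st _ _ ABq (l2.1 _ Bq).
    exists (Num.min (Num.min e1 e2) (Num.min e3 e4)).
      by rewrite !lt_min e10 e20 e30 e40.
    move=> q' ABq'; rewrite !lt_min => /andP[/andP[d1 d2] /andP[d3 d4]].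
    have [Aq'|nAq'] := pselect (A q'); first by rewrite LA// LA//; exact: h1.
    have Bq' : B q' by case: ABq'.
    rewrite LA// LB//.
    apply: (same_at (h3 _ ABq' d3) (h4 _ ABq' d4) (l2.1 _ Bq') (ag _ Aq Bq)).
    exact: h2.
  have Bq : B q by case: ABq.
  have [e1 e10 h1] := l2.2 _ Bq; have [e2 e20 h2] := nA _ Bq nAq.
  exists (Num.min e1 e2); first by rewrite lt_min e10.
  move=> q' ABq'; rewrite lt_min => /andP[d1 /h2 nAq'].
  have Bq' : B q' by case: ABq'.
  by rewrite LB// LB//; exact: h1.
move=> q w [Aq|Bq] cw.
  have [L1 l1 s1] := lA _ _ Aq cw; have [L2 l2 s2] := lB _ _ Bq1 (l1.1 _ Aq1).
  have [gl _] := glue _ _ l1 l2 s2; eexists; first exact: gl.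
  by rewrite /= asboolT.
have [L2 l2 s2] := lB _ _ Bq cw; have [L1 l1 s1] := lA _ _ Aq1 (l2.1 _ Bq1).
have [gl gB] := glue _ _ l1 l2 (samecell_sym s1); eexists; first exact: gl.
have ABq : (A `|` B) q by right.
exact: (same_at (gl.1 _ ABq) (l2.1 _ Bq) cw (gB _ Bq) s2).
Qed.

Definition rect (a b c d : R) : set (R * R) := [set q | a <= q.1 <= b /\ c <= q.2 <= d].

(** Near [q] the image stays in the star of one vertex [v], and a constant lift
    over [v] will do. *)
Lemma liftable_local h A q : stable boxdist h A -> A q -> exists2 e, 0 < e &
  forall B, B `<=` A -> (forall q', B q' -> boxdist q q' < e) -> liftable h B.
Proof.
move=> st Aq; have [v cv] := carrier_nonempty (h q).
have [e e0 he] := st _ _ Aq cv; exists e => // B BA Be q0 w Bq0 cw.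
have cv0 : carrier (h q0) v by apply: he; [exact: BA|exact: Be].
have [w' E s] := same_exists_at cw cv0; exists (fun=> w'); last exact: samecell_sym.
have cB q' : B q' -> carrier (h q') (pi w').
  by move=> Bq'; rewrite E; apply: he; [exact: BA|exact: Be].
split => // q' Bq'; exists 1 => // q'' Bq'' _.
by apply: same_refl_at; exact: cB Bq''.
Qed.

Let stable_sub T (dist : T -> T -> R) h A B : B `<=` A -> stable dist h A -> stable dist h B.
Proof.
move=> BA st q v /BA Aq cv; have [e e0 he] := st _ _ Aq cv.
by exists e => // q' /BA; exact: he.
Qed.

Let boxdist_pair (s s' t t' : R) : boxdist (s, t) (s', t') = Num.max `|s - s'| `|t - t'|.
Proof. by []. Qed.

Lemma liftable_rect_h h a b b' c d : a <= b -> b <= b' -> c <= d ->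
  stable boxdist h (rect a b' c d) ->
  liftable h (rect a b c d) -> liftable h (rect b b' c d) -> liftable h (rect a b' c d).
Proof.
move=> ab bb' cd st l1 l2.
have E : rect a b' c d = rect a b c d `|` rect b b' c d.
  rewrite /rect; apply/seteqP; split=> [[s t] /= [/andP[s1 s2] ->]|[s t] /= [] [/andP[s1 s2] ->]].
  - by case: (leP s b) => sb; [left|right]; rewrite ?s1 ?s2 ?sb ?(ltW sb).
  - by rewrite s1 (le_trans s2 bb').
  - by rewrite s2 (le_trans ab s1).
rewrite E in st *; apply: (liftable_union (q1 := (b, c)) st _ _ _ _ _ l1 l2).
- rewrite /rect => -[s t] /= [/andP[s1 s2] t1] n; exists (b - s).
    rewrite subr_gt0 lt_neqAle s2 andbT; apply/eqP => sb; apply: n.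
    by rewrite sb lexx bb' t1.
  move=> [s' t']; rewrite boxdist_pair gt_max => /andP[+ _] [/= /andP[s1' _] _].
  by rewrite ltr_distl => /andP[] /=; lra.
- rewrite /rect => -[s t] /= [/andP[s1 s2] t1] n; exists (s - b).
    rewrite subr_gt0 lt_neqAle s1 andbT; apply/eqP => sb; apply: n.
    by rewrite -sb lexx ab t1.
  move=> [s' t']; rewrite boxdist_pair gt_max => /andP[+ _] [/= /andP[_ s1'] _].
  by rewrite ltr_distl => /andP[] /=; lra.
- by rewrite /rect/= lexx ab cd lexx.
- by rewrite /rect/= lexx bb' cd lexx.
- move=> L L' lL lL' s1; rewrite {1 2}/rect => -[s t] /= [/andP[sa sb] /andP[tc td]] [/andP[sb' _] _].
  have {sb sb' sa} -> : s = b by apply/eqP; rewrite eq_le sb.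
  have sub : forall u, `[c, t]%classic u ->
      (rect a b c d `&` rect b b' c d) (b, u) /\ h (b, u) = h (b, u).
    move=> u; rewrite /= in_itv/= => /andP[u1 u2].
    by split => //; split; rewrite /rect/= lexx ?ab ?bb' u1 (le_trans u2 td).
  have jd (u v : R) : boxdist (b, u) (b, v) <= rdist u v.
    by rewrite boxdist_pair subrr normr0 ge_max normr_ge0 lexx.
  apply/(lifts_agree tc _ (islift_pull sub jd lL) (islift_pull sub jd lL')) => //.
  move=> u v Au cv; have [[Au1 _] _] := sub _ Au.
  have [e e0 he] := st _ _ (or_introl Au1) cv.
  exists e => // u' Au' lt; have [[Au1' _] _] := sub _ Au'; apply: he; first by left.
  exact: le_lt_trans (jd _ _) lt.
Qed.

Lemma liftable_rect_v h a b c c' d : a <= b -> c <= c' -> c' <= d ->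
  stable boxdist h (rect a b c d) ->
  liftable h (rect a b c c') -> liftable h (rect a b c' d) -> liftable h (rect a b c d).
Proof.
move=> ab cc' cd st l1 l2.
have E : rect a b c d = rect a b c c' `|` rect a b c' d.
  rewrite /rect; apply/seteqP; split=> [[s t] /= [-> /andP[s1 s2]]|[s t] /= [] [-> /andP[s1 s2]]].
  - by case: (leP t c') => sb; [left|right]; rewrite ?s1 ?s2 ?sb ?(ltW sb).
  - by rewrite s1 (le_trans s2 cd).
  - by rewrite s2 (le_trans cc' s1).
rewrite E in st *; apply: (liftable_union (q1 := (a, c')) st _ _ _ _ _ l1 l2).
- rewrite /rect => -[s t] /= [t1 /andP[s1 s2]] n; exists (c' - t).
    rewrite subr_gt0 lt_neqAle s2 andbT; apply/eqP => sb; apply: n.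
    by rewrite sb lexx cd t1.
  move=> [s' t']; rewrite boxdist_pair gt_max => /andP[_ +] [/= _ /andP[s1' _]].
  by rewrite ltr_distl => /andP[] /=; lra.
- rewrite /rect => -[s t] /= [t1 /andP[s1 s2]] n; exists (t - c').
    rewrite subr_gt0 lt_neqAle s1 andbT; apply/eqP => sb; apply: n.
    by rewrite -sb lexx cc' t1.
  move=> [s' t']; rewrite boxdist_pair gt_max => /andP[_ +] [/= _ /andP[_ s1']].
  by rewrite ltr_distl => /andP[] /=; lra.
- by rewrite /rect/= lexx ab cc' lexx.
- by rewrite /rect/= lexx ab cd lexx.
- move=> L L' lL lL' s1; rewrite {1 2}/rect => -[s t] /= [/andP[sa sb] /andP[tc td]] [_ /andP[sb' _]].
  have {tc td sb'} -> : t = c' by apply/eqP; rewrite eq_le td.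
  have sub : forall u, `[a, s]%classic u ->
      (rect a b c c' `&` rect a b c' d) (u, c') /\ h (u, c') = h (u, c').
    move=> u; rewrite /= in_itv/= => /andP[u1 u2].
    by split => //; split; rewrite /rect/= lexx ?cc' ?cd u1 (le_trans u2 sb).
  have jd (u v : R) : boxdist (u, c') (v, c') <= rdist u v.
    by rewrite boxdist_pair subrr normr0 ge_max normr_ge0 lexx.
  apply/(lifts_agree sa _ (islift_pull sub jd lL) (islift_pull sub jd lL')) => //.
  move=> u v Au cv; have [[Au1 _] _] := sub _ Au.
  have [e e0 he] := st _ _ (or_introl Au1) cv.
  exists e => // u' Au' lt; have [[Au1' _] _] := sub _ Au'; apply: he; first by left.
  exact: le_lt_trans (jd _ _) lt.
Qed.

(** Interval gluing in the first direction lifts the map over a thin strip around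
    every height, and then interval gluing of these strips lifts it over the
    square. *)
Lemma liftable_square h : stable boxdist h (rect 0 1 0 1) -> liftable h (rect 0 1 0 1).
Proof.
move=> st.
have sub a b c d : 0 <= a -> b <= 1 -> 0 <= c -> d <= 1 -> rect a b c d `<=` rect 0 1 0 1.
  by move=> *; rewrite /rect => -[s t] /= [/andP[? ?] /andP[? ?]]; split; apply/andP; split; lra.
apply: (@interval_gluing R (fun c d => liftable h (rect 0 1 c d)) 0 1 ler01).
  move=> a b c a0 ab bc c1; apply: liftable_rect_v => //.
  by apply: stable_sub st; exact: sub.
move=> t /andP[t0 t1].
suff : exists2 e, 0 < e & forall c d, 0 <= c -> c <= t -> t <= d -> d <= 1 ->
    t - c < e -> d - t < e -> liftable h (rect 0 1 c d) by [].
apply: (@interval_gluing R (fun a b => exists2 e, 0 < e & forall c d, 0 <= c -> c <= t ->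
  t <= d -> d <= 1 -> t - c < e -> d - t < e -> liftable h (rect a b c d)) 0 1 ler01).
  move=> a b b' a0 ab bb' b1 [e1 e10 h1] [e2 e20 h2].
  exists (Num.min e1 e2); first by rewrite lt_min e10.
  move=> c d c0 ct td d1; rewrite !lt_min => /andP[x1 x2] /andP[y1 y2].
  apply: (liftable_rect_h (b := b)) => //; [lra| |exact: h1|exact: h2].
  by apply: stable_sub st; exact: sub.
move=> s /andP[s0 s1].
have Aq : rect 0 1 0 1 (s, t) by rewrite /rect/= s0 s1 t0 t1.
have [e e0 he] := liftable_local st Aq; exists e => // a b a0 as_ sb b1 ea eb.
exists e => // c d c0 ct td d1 ec ed; apply: he; first exact: sub.
move=> [s' t'] [/= /andP[? ?] /andP[? ?]]; rewrite boxdist_pair gt_max !ltr_distl.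
by rewrite -!andbA; apply/and4P; split; lra.
Qed.

End Lifts.
End Stars.

Section Loops.
Import Defs.
Context {R : realType} (X : cubeComplex R).
Local Notation vert := (vert X).
Local Notation vx := (@vx R X).

Definition segment n (t t' : 'rV[R]_n) (s : R) : 'rV[R]_n :=
  \row_i ((1 - s) * t 0 i + s * t' 0 i).

Lemma segment0 n (t t' : 'rV[R]_n) : segment t t' 0 = t.
Proof. by apply/rowP => i; rewrite mxE; ring. Qed.

Lemma segment1 n (t t' : 'rV[R]_n) : segment t t' 1 = t'.
Proof. by apply/rowP => i; rewrite mxE; ring. Qed.

Lemma segment_between (x y s lo hi : R) : lo <= x <= hi -> lo <= y <= hi ->
  0 <= s <= 1 -> lo <= (1 - s) * x + s * y <= hi.
Proof. by move=> /andP[? ?] /andP[? ?] /andP[? ?]; apply/andP; split; nra. Qed.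

Lemma segment_icube n (t t' : 'rV[R]_n) s : icube t -> icube t' -> 0 <= s <= 1 ->
  icube (segment t t' s).
Proof. by move=> ct ct' s01 i; rewrite mxE; apply: segment_between. Qed.

Lemma segment_continuous n (t t' : 'rV[R]_n) : continuous (segment t t').
Proof.
move=> s U [P Pn PU]; rewrite /nbhs/=.
suff H : \forall s' \near s, forall i j, P i j (segment t t' s' i j).
  by apply: filterS H => s' H; apply: PU.
apply: (@filter_forall _ _ (fun i s' => forall j, P i j (segment t t' s' i j)) (nbhs s)) => i.
apply: (@filter_forall _ _ (fun j s' => P i j (segment t t' s' i j)) (nbhs s)) => j.
pose f s' := (1 - s') * t 0 j + s' * t' 0 j.
have fE s' : segment t t' s' i j = f s' by rewrite mxE.
suff H : f @ s --> f s.
  have := H (P i j); rewrite -fE => /(_ (Pn i j)) h.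
  by apply: (@filterS _ (nbhs s) _ (f @^-1` P i j)) h => s' h; rewrite /= fE.
apply: cvgD; apply: cvgM; [|exact: cvg_cst|exact: cvg_id|exact: cvg_cst].
by apply: cvgB; [exact: cvg_cst|exact: cvg_id].
Qed.

Lemma chart_segment_continuous (c : cell X) (t t' : 'rV[R]_(dim c)) :
  icube t -> icube t' ->
  {within `[0, 1], continuous (fun s => chart (c := c) (segment t t' s))}.
Proof.
move=> ct ct'; apply/subspace_continuousP => s s01 U /= nU.
have s01' : 0 <= s <= 1 by move: s01; rewrite /= in_itv.
have /subspace_continuousP/(_ _ (segment_icube ct ct' s01') U nU) := @chart_continuous R X c.
move=> /(@segment_continuous _ t t' s) H.
apply: (@filterS _ (nbhs s) _ _ _ _ H) => s' /= {}H s01''; apply: H.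
by apply: segment_icube => //; move: s01''; rewrite /= in_itv.
Qed.

(** Before its end, the straight path along an edge has the origin of the edge
    among the vertices which carry it. *)
Lemma edge_path u v : adj vx u v -> exists g : R -> X,
  [/\ {within `[0, 1], continuous g}, g 0 = sval u, g 1 = sval v &
      forall s, 0 <= s < 1 -> carrier (g s) u].
Proof.
move=> [c [b [i [-> ->]]]].
have c1 := bvec_icube (R := R) b; have c2 := bvec_icube (R := R) (flipb b i).
exists (fun s => chart (segment (bvec b) (bvec (flipb b i)) s)); split.
- exact: chart_segment_continuous.
- by rewrite segment0.
- by rewrite segment1.
- move=> s /andP[s0 s1]; apply/carrier_chart.
    by apply: segment_icube => //; rewrite s0 ltW.
  move=> j; rewrite mxE !bvecE; have [->|ji] := eqVneq j i.
    by rewrite flipb_eq; case: (b i) => /=; lra.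
  by rewrite flipb_neq//; case: (b j) => /=; lra.
Qed.

Lemma continuous_stable f (A : set R) : {within A, continuous f} -> @stable R X _ rdist f A.
Proof.
move=> /subspace_continuousP fc q v Aq cv.
have := fc q Aq [set p | carrier p v] (star_nbhs cv).
move=> /nbhs_ballP[e /= e0 he]; exists e => // q' Aq' lt; exact: he.
Qed.

Lemma continuous_stable2 h (A : set (R * R)) :
  {within A, continuous h} -> @stable R X _ boxdist h A.
Proof.
move=> /subspace_continuousP fc q v Aq cv.
have := fc q Aq [set p | carrier p v] (star_nbhs cv).
move=> /nbhs_ballP[e /= e0 he]; exists e => // q' Aq'.
by rewrite gt_max => /andP[h1 h2]; apply: he => //; split.
Qed.

Definition concat (f g : R -> X) (s : R) := if s <= 2^-1 then f (2 * s) else g (2 * s - 1).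

Lemma within_continuous_affine (f : R -> X) (A B : set R) (k l : R) :
  (forall s, A s -> B (k * s + l)) ->
  {within B, continuous f} -> {within A, continuous (fun s => f (k * s + l))}.
Proof.
move=> AB /subspace_continuousP fc; apply/subspace_continuousP => s As U nU.
have H0 := fc _ (AB _ As) U nU.
have ac : (fun s' => k * s' + l) @ s --> k * s + l.
  by apply: cvgD; [apply: cvgM; [exact: cvg_cst|exact: cvg_id]|exact: cvg_cst].
have H := ac _ H0; apply: (@filterS _ (nbhs s) _ _ _ _ H) => s' /= {}H As'.
by apply: H; exact: AB.
Qed.

Lemma within_eq (f g : R -> X) (A : set R) : (forall s, A s -> f s = g s) ->
  {within A, continuous f} -> {within A, continuous g}.
Proof.
move=> fg /subspace_continuousP fc; apply/subspace_continuousP => s As U /= nU.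
have H : within A (nbhs s) (f @^-1` U) by apply: (fc s As U); rewrite /from_subspace fg.
by apply: (@filterS _ (nbhs s) _ _ _ _ H) => s' /= {}H As'; rewrite /from_subspace -fg //; exact: H.
Qed.

Lemma concat_continuous (f g : R -> X) : {within `[0, 1], continuous f} ->
  {within `[0, 1], continuous g} -> f 1 = g 0 -> {within `[0, 1], continuous (concat f g)}.
Proof.
move=> fc gc fg.
have -> : `[0, 1]%classic = `[0, 2^-1]%classic `|` `[2^-1, 1]%classic :> set R.
  apply/seteqP; split=> s; rewrite /= !in_itv /=.
    by move=> /andP[s0 s1]; case: (leP s 2^-1) => h; [left|right]; rewrite ?s0 ?s1 ?h ?(ltW h).
  by move=> [|] /andP[? ?]; apply/andP; split; lra.
apply: withinU_continuous; try exact: itv_closed.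
  apply: (@within_eq (fun s => f (2 * s + 0))).
    by move=> s; rewrite /= in_itv/= => /andP[_ h]; rewrite /concat h addr0.
  by apply: (within_continuous_affine _ fc) => s; rewrite /= !in_itv /= => /andP[? ?];
    apply/andP; split; lra.
apply: (@within_eq (fun s => g (2 * s + -1))).
  move=> s; rewrite /= in_itv/= => /andP[h _]; rewrite /concat; case: leP => // h'.
  have -> : s = 2^-1 by lra.
  by rewrite mulfV // subrr fg.
by apply: (within_continuous_affine _ gc) => s; rewrite /= !in_itv /= => /andP[? ?];
  apply/andP; split; lra.
Qed.


Section Monodromy.
Variables (W : Type) (pi : W -> vert) (mv : W -> W -> Prop).
Hypothesis cov : covering vx pi mv.
Local Notation same := (samecell vx pi mv).
Local Notation islift := (@islift R X W pi mv).
Let fam := vx_family X.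

Let I01 (s : R) : `[0, 1]%classic s <-> 0 <= s <= 1.
Proof. by rewrite /= in_itv. Qed.

Let same_refl (p : X) w : carrier p (pi w) -> same w w.
Proof.
move=> h; have [c cp] := chart_cover p; apply: (samecell_refl cov (c := c)).
exact: (carrier_incell _ cp).
Qed.

(** Along each edge the lift is compared with the one which jumps from [w1] to
    [w2] at the end of the edge. *)
Lemma mvs_realized w w' : mvs vx pi mv w w' -> exists f : R -> X,
  [/\ {within `[0, 1], continuous f}, f 0 = sval (pi w), f 1 = sval (pi w') &
      forall L, islift rdist f `[0, 1] L -> L 0 = w -> L 1 = w'].
Proof.
have in0 : `[0, 1]%classic (0 : R) by apply/I01; rewrite lexx ler01.
have in1 : `[0, 1]%classic (1 : R) by apply/I01; rewrite lexx ler01.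
have agree (f : R -> X) L L' : {within `[0, 1], continuous f} ->
    islift rdist f `[0, 1] L -> islift rdist f `[0, 1] L' ->
    (exists v : vert, f 1 = sval v) -> L 0 = L' 0 -> L 1 = L' 1.
  move=> fc lL lL' [v f1] E.
  have /(lifts_agree cov ler01 (continuous_stable fc) lL lL') h : same (L 0) (L' 0).
    by rewrite -E; apply: same_refl; exact: lL.1.
  have := lL.1 _ in1; have := lL'.1 _ in1; rewrite f1 => /carrier_vertex E1 /carrier_vertex E2.
  apply: (samecell_uniq fam cov (w := L 1)) => //; last by rewrite E1.
  by apply: (@same_refl (sval v)); apply/carrier_vertex.
elim=> [|w1 w2 _ [f [fc f0 f1 fL]] m a].
  pose k : R -> X := fun=> sval (pi w).
  have cc : {within `[0, 1], continuous k}.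
    by apply: continuous_subspaceT => s; exact: cvg_cst.
  exists k; split => // L lL L0.
  rewrite -[RHS](_ : (fun=> w) (1 : R) = w) //; apply: (agree _ _ _ cc lL) => //; last by exists (pi w).
  split=> [s _|s _]; first exact/carrier_vertex.
  exists 1 => // s' _ _; apply: (@same_refl (sval (pi w))); exact/carrier_vertex.
have [g [gc g0 g1 gcar]] := edge_path a.
have fg : f 1 = g 0 by rewrite f1 g0.
exists (concat f g); split.
- exact: concat_continuous.
- by rewrite /concat ifT ?mulr0//; lra.
- rewrite /concat ifF; first by rewrite mulr1 (_ : 2 - 1 = 1)//; lra.
  by apply/negbTE; rewrite -ltNge; lra.
move=> L lL L0.
have lf : islift rdist f `[0, 1] (L \o (fun s => 2^-1 * s)).
  apply: islift_pull lL => [s /I01/andP[s0 s1]|s s'].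
    split; first by apply/I01/andP; split; lra.
    rewrite /concat ifT; last by lra.
    by congr f; lra.
  by rewrite /rdist -mulrBr normrM ger0_norm; [have := normr_ge0 (s - s'); lra|lra].
have L1 : L (2^-1 * 1) = w1 by apply: (fL _ lf); rewrite /= mulr0.
have lg : islift rdist g `[0, 1] (L \o (fun s => 2^-1 * s + 2^-1)).
  apply: islift_pull lL => [s /I01/andP[s0 s1]|s s'].
    split; first by apply/I01/andP; split; lra.
    rewrite /concat; case: leP => h; last by congr g; lra.
    have -> : s = 0 by lra.
    by rewrite -fg; congr f; lra.
  rewrite /rdist opprD addrACA subrr addr0 -mulrBr normrM ger0_norm; last by lra.
  by have := normr_ge0 (s - s'); lra.
pose L' (s : R) := if s < 1 then w1 else w2.
have s12 : same w1 w2 by exact: (samecell_mv cov m a).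
have lL' : islift rdist g `[0, 1] L'.
  have s11 : same w1 w1 by apply: (@same_refl (sval (pi w1))); exact/carrier_vertex.
  have s22 : same w2 w2 by apply: (@same_refl (sval (pi w2))); exact/carrier_vertex.
  split=> [s /I01/andP[s0 s1]|s _].
    rewrite /L'; case: ltP => s1'; first by apply: gcar; rewrite s0.
    have -> : s = 1 by lra.
    by rewrite g1; exact/carrier_vertex.
  exists 1 => // s' _ _; rewrite /L'; case: ltP => _; case: ltP => _ //.
  exact: samecell_sym.
have := agree _ _ _ gc lg lL'; rewrite /L' ltr01 ltxx /= => <- //.
- by congr L; lra.
- by exists (pi w2).
- by rewrite -L1; congr L; lra.
Qed.

End Monodromy.

(** A lift of a null-homotopy of a closed path is constant on three sides of the
    square, so its two values over the ends of the fourth side coincide. *)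
Lemma simply_connected_trivial : simply_connected R X -> trivial_coverings vx.
Proof.
move=> [_ _ sc] W pi mv cov w w' ww' pw.
have [f [fc f0 f1 fL]] := mvs_realized cov ww'.
have f01 : f 0 = f 1 by rewrite f0 f1 pw.
have [h hc hb] := sc f fc f01.
have Q01 (s t : R) : 0 <= s <= 1 -> 0 <= t <= 1 -> rect 0 1 0 1 (s, t) by [].
have in0 : 0 <= (0 : R) <= 1 by rewrite lexx ler01.
have in1 : 0 <= (1 : R) <= 1 by rewrite lexx ler01.
have hst : stable boxdist h (rect 0 1 0 1).
  have <- : `[0, 1]%classic `*` `[0, 1]%classic = rect (0 : R) 1 0 1.
    by apply/seteqP; split=> -[s t]; rewrite /rect /= !in_itv /=.
  exact: continuous_stable2.
have h0 : h (0, 0) = f 0 by have [] := hb 0 _; rewrite // in_itv.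
have cw : carrier (h (0, 0)) (pi w) by rewrite h0 f0; exact/carrier_vertex.
have [L lL sL] := liftable_square cov hst (Q01 _ _ in0 in0) cw.
have fam := vx_family X.
have refl (v : vert) u : carrier (sval v) (pi u) -> samecell vx pi mv u u.
  move=> /carrier_vertex E; have [c cp] := chart_cover (sval v).
  apply: (samecell_refl cov (c := c)); rewrite E.
  by apply: (carrier_incell _ cp); exact/carrier_vertex.
have L00 : L (0, 0) = w.
  have := lL.1 _ (Q01 _ _ in0 in0); rewrite h0 f0 => c0.
  apply: (samecell_uniq fam cov (w := L (0, 0))) => //; first exact: refl c0.
  by move: c0 => /carrier_vertex.
have bottom : L (1, 0) = w'.
  apply: (fL (L \o (fun s => (s, 0)))) => //.
  apply: islift_pull lL => [s|s s'].
    rewrite /= in_itv => s01; split; first exact: Q01.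
    by have [] := hb s _; rewrite // in_itv.
  by rewrite /boxdist /rdist /= subrr normr0 ge_max normr_ge0 lexx.
(* It applies to the three sides which the homotopy maps to one point. *)
have side (j : R -> R * R) : (forall s, 0 <= s <= 1 -> rect 0 1 0 1 (j s) /\ h (j s) = f 0) ->
    (forall s s', boxdist (j s) (j s') <= rdist s s') -> L (j 0) = L (j 1).
  move=> jP jd.
  have jP' s : `[0, 1]%classic s -> rect 0 1 0 1 (j s) /\ h (j s) = sval (pi w).
    by rewrite /= in_itv -f0; exact: jP.
  have lj := islift_pull (h' := fun=> sval (pi w)) jP' jd lL.
  have c s : 0 <= s <= 1 -> carrier (sval (pi w)) (pi (L (j s))).
    by move=> s01; apply: lj.1; rewrite /= in_itv.
  have lc : islift pi mv rdist (fun=> sval (pi w)) `[0, 1] (fun=> L (j 0)).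
    split=> [s _|s _]; first exact: c.
    by exists 1 => // s' _ _; exact: refl (c _ in0).
  have st : stable rdist (fun=> sval (pi w)) `[0, 1]%classic.
    by move=> s v _ cv; exists 1.
  have /(lifts_agree cov ler01 st lc lj) /= s01 : samecell vx pi mv (L (j 0)) (L (j 0)).
    exact: refl (c _ in0).
  apply: (samecell_uniq fam cov (w := L (j 0))) => //; first exact: refl (c _ in0).
  by move: (c _ in0) (c _ in1) => /carrier_vertex -> /carrier_vertex ->.
have left : L (0, 0) = L (0, 1).
  apply: (side (fun s => (0, s))) => [s s01|s s']; last first.
    by rewrite /boxdist /rdist /= subrr normr0 ge_max normr_ge0 lexx.
  by split; [exact: Q01|have [] := hb s _; rewrite // in_itv].
have right : L (1, 0) = L (1, 1).
  apply: (side (fun s => (1, s))) => [s s01|s s']; last first.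
    by rewrite /boxdist /rdist /= subrr normr0 ge_max normr_ge0 lexx.
  by split; [exact: Q01|have [] := hb s _; rewrite // in_itv].
have top : L (0, 1) = L (1, 1).
  apply: (side (fun s => (s, 1))) => [s s01|s s']; last first.
    by rewrite /boxdist /rdist /= subrr normr0 ge_max normr_ge0 lexx.
  by split; [exact: Q01|have [] := hb s _; rewrite // in_itv].
by rewrite -bottom right -top -left L00.
Qed.

Lemma simply_connected_connected :
  simply_connected R X -> combinatorially_connected vx.
Proof.
move=> [_ pc _] u v; have [f fc [f0 f1]] := pc (sval u) (sval v).
have fs := continuous_stable fc.
have walk_trans n m a b c : walk vx n a b -> walk vx m b c -> exists k, walk vx k a c.
  move=> h h2; elim: h2 h => [b0 h|k b1 b2 b3 _ IH a2 /IH[k' h']]; first by exists n.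
  by exists k'.+1; exact: walkS h' a2.
suff : forall u v, carrier (f 0) u -> carrier (f 1) v -> exists n, walk vx n u v.
  by apply; rewrite ?f0 ?f1; exact/carrier_vertex.
apply: (@interval_gluing R (fun a b => forall u v, carrier (f a) u -> carrier (f b) v ->
  exists n, walk vx n u v) 0 1 ler01).
  move=> a b c _ _ _ _ h1 h2 x z fx fz; have [y fy] := carrier_nonempty (f b).
  have [n hn] := h1 _ _ fx fy; have [m hm] := h2 _ _ fy fz.
  exact: walk_trans hn hm.
move=> s s01; have [y fy] := carrier_nonempty (f s).
have As : `[0, 1]%classic s by rewrite /= in_itv.
have [e e0 he] := fs _ _ As fy; exists e => // a b a0 as_ sb b1 ea eb x z fx fz.
have ya : carrier (f a) y.
  apply: he; first by rewrite /= in_itv /= a0; lra.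
  by rewrite /rdist ger0_norm ?subr_ge0.
have yb : carrier (f b) y.
  apply: he; first by rewrite /= in_itv /= b1 andbT; lra.
  by rewrite /rdist distrC ger0_norm ?subr_ge0.
have [c ca] := chart_cover (f a); have [d db] := chart_cover (f b).
have [n hn] := incell_walk (carrier_incell fx ca) (carrier_incell ya ca).
have [m hm] := incell_walk (carrier_incell yb db) (carrier_incell fz db).
exact: walk_trans hn hm.
Qed.

Theorem CAT0_cube_distance : CAT0_cube_complex X ->
  exists d, cube_distance (adj vx) (sq vx) d.
Proof.
move=> [sc flag]; apply: cube_distance_exists.
- exact: vx_cube_system.
- exact: simply_connected_connected.
- exact: simply_connected_trivial.
Qed.

End Loops.

(** * Hyperplanes and half-spaces of a CAT(0) cube complex *)

Section TransverseCoordinate.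
Import Defs.
Context {R : realType} (X : cubeComplex R).
Local Notation vert := (vert X).
Local Notation vx := (@vx R X).
Local Notation adj := (adj vx).
Implicit Types (A : set vert) (c : cell X) (p : X).

(** The coordinate of [p] in the direction transverse to the wall between [A] and
    its complement: 0 on the part of the complex inside [A], 1 on the part
    outside, and in a cell crossed by the wall the coordinate along the crossing
    edges, which is expressed through distances to the ends of such an edge to
    make it invariant under automorphisms and independent of the chart. *)
Definition transverse A p (r : R) := exists2 c, closed_cell c p &
  [\/ exists a b, [/\ A a, ~ A b, adj a b, closed_cell c (sval a) &
        closed_cell c (sval b) /\
        r = (1 + cell_dist c p (sval a) ^+ 2 - cell_dist c p (sval b) ^+ 2) / 2],
      (forall v : vert, closed_cell c (sval v) -> A v) /\ r = 0 |
      (forall v : vert, closed_cell c (sval v) -> ~ A v) /\ r = 1].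

Definition hs A : set X := [set p | exists2 r, r < 2^-1 & transverse A p r].

Definition wall A : set X := [set p | transverse A p 2^-1].

Lemma coord_chart c (t : 'rV[R]_(dim c)) : icube t -> coord c (chart t) = t.
Proof.
move=> ct; rewrite /coord; set P : set 'rV[R]_(dim c) := (X in xget _ X).
have [|ct' E] := @xgetPex _ (0 : 'rV[R]_(dim c)) P; first by exists t.
exact: chart_eq E.
Qed.

Lemma edist_flip n (b : bits n) i (t : 'rV[R]_n) :
  edist t (bvec b) ^+ 2 - edist t (bvec (flipb b i)) ^+ 2 =
  (t 0 i - (b i)%:R) ^+ 2 - (t 0 i - (~~ b i)%:R) ^+ 2.
Proof.
rewrite !sqr_sqrtr; [|by apply: sumr_ge0 => j _; exact: sqr_ge0..].
rewrite (bigD1 i)//= [X in _ - X](bigD1 i)//= !bvecE flipb_eq.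
rewrite [X in _ + X - _](eq_bigr (fun j => (t 0 j - bvec (flipb b i) 0 j) ^+ 2)); last first.
  by move=> j ji; rewrite !bvecE flipb_neq.
ring.
Qed.

Definition dirval (s : bool) (x : R) := if s then 1 - x else x.

(** The transverse coordinate read in the coordinates of one given cell; in the
    last case [s] is the value of coordinate [i] on the side of [A]. *)
Definition local_transverse A c (t : 'rV[R]_(dim c)) (r : R) :=
  [\/ (forall b, A (vx (c := c) b)) /\ r = 0,
      (forall b, ~ A (vx (c := c) b)) /\ r = 1 |
      exists i s, (forall b, A (vx (c := c) b) <-> b i = s) /\ r = dirval s (t 0 i)].

(** The squared distances from [t] to the ends of an edge differ by an affine
    function of the coordinate along the edge. *)
Lemma local_edge A c t r a b : icube t -> @local_transverse A c t r -> A a -> ~ A b ->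
  adj a b -> closed_cell c (sval a) -> closed_cell c (sval b) ->
  r = (1 + cell_dist c (chart t) (sval a) ^+ 2 - cell_dist c (chart t) (sval b) ^+ 2) / 2.
Proof.
move=> ct L Aa Ab ab /incellP[b1 E1] /incellP cb.
rewrite E1 in ab Aa; have [i Eb] := adj_incell (vx_family X) ab cb.
rewrite Eb in Ab; rewrite E1 Eb /cell_dist !coord_chart//; do ?exact: bvec_icube.
rewrite -addrA edist_flip.
case: L => [[/(_ _)/Ab //]|[/(_ _)/(_ Aa) //]|[j [s [h ->]]]].
have bj : b1 j = s by apply/h.
have ij : i = j.
  apply/eqP/negPn/negP => ij; apply: Ab; apply/h.
  by rewrite flipb_neq// eq_sym.
by subst i s; rewrite /dirval; case: (b1 j) => /=; field.
Qed.

Lemma local_all A c t r : icube t -> @local_transverse A c t r ->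
  (forall v, carrier (chart t) v -> A v) -> r = 0.
Proof.
move=> ct L h; have [v cv] := carrier_nonempty (chart t).
have [b Eb] := carrier_incell cv (in_cell ct).
case: L => [[]//|[/(_ b)]|[i [s [k ->]]]].
  by case; rewrite -Eb; exact: h.
suff : t 0 i = s%:R by rewrite /dirval => ->; case: (s); rewrite ?subrr.
apply/eqP/negPn/negP => /eqP n.
suff : A (vx (if b i == s then flipb b i else b)).
  move/k; case: ifPn => [/eqP <-|/eqP//]; rewrite flipb_eq; by case: (b i).
apply: h; move: cv; rewrite Eb => /(carrier_chart _ ct) cb.
apply/(carrier_chart _ ct) => j; case: ifPn => bs; last exact: cb.
have [->|ji] := eqVneq j i; last by rewrite flipb_neq.
by rewrite flipb_eq negbK (eqP bs).
Qed.

Lemma local_transverseC A c t r : @local_transverse A c t r ->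
  local_transverse (~` A) t (1 - r).
Proof.
move=> [[h ->]|[h ->]|[i [s [h ->]]]].
- by apply: Or32; split=> [b /(_ (h b))|]; rewrite ?subr0.
- by apply: Or31; split=> //; rewrite subrr.
- apply: Or33; exists i, (~~ s); split=> [b|].
    rewrite /setC/=; split=> [n|bi /h]; last by rewrite bi; case: (s).
    have : b i <> s by move=> /h.
    by case: (b i); case: (s).
  by rewrite /dirval; case: (s) => //=; ring.
Qed.

Lemma local_none A c t r : icube t -> @local_transverse A c t r ->
  (forall v, carrier (chart t) v -> ~ A v) -> r = 1.
Proof.
by move=> ct /local_transverseC L /(local_all ct L) /eqP; rewrite subr_eq0 => /eqP.
Qed.

Lemma local_mixed A c t r u v : icube t -> @local_transverse A c t r ->
  carrier (chart t) u -> A u -> carrier (chart t) v -> ~ A v ->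
  exists a b, [/\ A a, ~ A b, adj a b, carrier (chart t) a & carrier (chart t) b].
Proof.
move=> ct L cu Au cv Av; have [b Eb] := carrier_incell cu (in_cell ct).
have [b' Eb'] := carrier_incell cv (in_cell ct).
case: L => [[h _]|[h _]|[i [s [h _]]]].
- by case: Av; rewrite Eb'.
- by case: (h b); rewrite -Eb.
exists u, (vx (flipb b i)); have bi : b i = s by apply/h; rewrite -Eb.
have b'i : b' i = ~~ s.
  have : b' i <> s by move=> /h; rewrite -Eb'.
  by case: (b' i); case: (s).
split=> //.
- by move/h; rewrite flipb_eq bi; case: (s).
- by rewrite Eb; exists c, b, i.
apply/(carrier_chart _ ct) => j; have [->|ji] := eqVneq j i.
  by rewrite flipb_eq; move: cv; rewrite Eb' => /(carrier_chart _ ct) /(_ i); rewrite b'i bi.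
by rewrite flipb_neq//; move: cu; rewrite Eb => /(carrier_chart _ ct).
Qed.

(** All cells containing the point contain its carrier.  If the carrier meets
    both [A] and its complement it has a crossing edge, which determines the
    coordinate; otherwise the coordinate is 0 or 1. *)
Lemma local_uniq A c d t t' r r' : icube t -> icube t' ->
  chart (c := c) t = chart (c := d) t' ->
  @local_transverse A c t r -> @local_transverse A d t' r' -> r = r'.
Proof.
move=> ct ct' E L L'.
have [h|/existsNP[v /not_implyP[cv nv]]] := pselect (forall w, carrier (chart t) w -> A w).
  by rewrite (local_all ct L h) (local_all ct' L')// -E.
have [h|/existsNP[u /not_implyP[cu /contrapT nu]]] :=
    pselect (forall w, carrier (chart t) w -> ~ A w).
  by rewrite (local_none ct L h) (local_none ct' L')// -E.
have [a [b [Aa nAb ab ca cb]]] := local_mixed ct L cu nu cv nv.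
have cc := in_cell ct; have cd : closed_cell d (chart t) by rewrite E; exact: in_cell.
rewrite (local_edge ct L Aa nAb ab (ca _ cc) (cb _ cc)).
rewrite (local_edge ct' L' Aa nAb ab (ca _ cd) (cb _ cd)).
have dE w : carrier (chart t) w ->
    cell_dist c (chart t) (sval w) = cell_dist d (chart t') (sval w).
  move=> /[dup] /(_ _ cc) /incellP[b1 E1] /(_ _ cd) /incellP[b2 E2].
  have w1 : sval w = chart (bvec b1) by rewrite E1.
  have w2 : sval w = chart (bvec b2) by rewrite E2.
  rewrite /cell_dist {1}w1 w2 !coord_chart//; do ?exact: bvec_icube.
  apply: (meet_edist ct (bvec_icube _) ct' (bvec_icube _) E).
  by rewrite -w1 w2.
by rewrite !dE.
Qed.

Variable A : set vert.
Hypothesis A_local : forall c, [\/ forall b, A (vx (c := c) b),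
  forall b, ~ A (vx (c := c) b) |
  exists i s, forall b, A (vx (c := c) b) <-> b i = s].

Lemma local_exists c t : exists r, @local_transverse A c t r.
Proof.
case: (A_local c) => [h|h|[i [s h]]].
- by exists 0; apply: Or31.
- by exists 1; apply: Or32.
- by exists (dirval s (t 0 i)); apply: Or33; exists i, s.
Qed.

Lemma transverseP c t r : icube t ->
  transverse A (chart (c := c) t) r <-> @local_transverse A c t r.
Proof.
move=> ct; split=> [[d [t' ct' E] H]|L]; last first.
  have cc := in_cell ct; exists c => //; case: (L) => [[h ->]|[h ->]|[i [s [h rE]]]].
  - by apply: Or32; split => // v /incellP[b ->].
  - by apply: Or33; split => // v /incellP[b ->].
  - pose b : bits (dim c) := [ffun=> s].
    apply: Or31; exists (vx b), (vx (flipb b i)).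
    have Aa : A (vx b) by apply/h; rewrite ffunE.
    have nA : ~ A (vx (flipb b i)) by move/h; rewrite flipb_eq ffunE; case: (s).
    have ab : adj (vx b) (vx (flipb b i)) by exists c, b, i.
    have ca : closed_cell c (sval (vx b)) by apply/incellP; exists b.
    have cb : closed_cell c (sval (vx (flipb b i))) by apply/incellP; exists (flipb b i).
    by split => //; split => //; exact: local_edge ct L Aa nA ab ca cb.
have [r' L] := local_exists t; have [r'' L''] := local_exists t'.
have e : r'' = r' by exact: (local_uniq ct' ct E L'' L).
suff -> : r = r' by [].
rewrite -e; rewrite -E in H.
case: H => [[a [b [Aa nA ab ca [cb ->]]]]|[h ->]|[h ->]].
- exact/esym/(local_edge ct' L'' Aa nA ab ca cb).
- by apply/esym; apply: (local_all ct' L'') => v cv; apply: h; apply: cv; exact: in_cell.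
- by apply/esym; apply: (local_none ct' L'') => v cv; apply: h; apply: cv; exact: in_cell.
Qed.

Lemma transverse_exists p : exists r, transverse A p r.
Proof.
have [c [t ct <-]] := chart_cover p; have [r L] := local_exists t.
by exists r; apply/transverseP.
Qed.

Lemma transverse_uniq p r r' : transverse A p r -> transverse A p r' -> r = r'.
Proof.
have [c [t ct <-]] := chart_cover p => /(transverseP _ ct) L /(transverseP _ ct) L'.
exact: local_uniq erefl L L'.
Qed.

Lemma transverse_vertex v r : transverse A (sval v) r -> A v <-> r = 0.
Proof.
have [c [t ct E]] := chart_cover (sval v); rewrite -E => /(transverseP _ ct) L.
split=> [Av|r0].
  by apply: (local_all ct L) => u; rewrite E => /carrier_vertex ->.
apply: contrapT => nv; have /eqP : r = 1.
  by apply: (local_none ct L) => u; rewrite E => /carrier_vertex ->.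
by rewrite r0 eq_sym oner_eq0.
Qed.

Lemma hs_open : open (hs A).
Proof.
move=> c; apply/open_subspaceP.
have key t : icube t -> hs A (chart (c := c) t) <-> exists2 r, r < 2^-1 & @local_transverse A c t r.
  by move=> ct; split=> -[r r2 /(transverseP _ ct) h]; exists r.
case: (A_local c) => [h|h|[i [s h]]].
- exists setT; first exact: openT.
  apply/seteqP; split=> t [_ ct]; split => //.
  by apply/(key _ ct); exists 0; [lra|apply: Or31].
- exists set0; first exact: open0.
  apply/seteqP; split=> [t []//|t [ht ct]]; have [r r2 L] := (key _ ct).1 ht.
  have : r = 1 by apply: (local_uniq ct ct erefl L); apply: Or32.
  by move=> ?; lra.
- exists ((fun t : 'rV[R]_(dim c) => t 0 i) @^-1` (dirval s @^-1` [set x | x < 2^-1])).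
    apply: open_comp => [t _|]; first exact: coord_continuous.
    apply: open_comp => [x _|]; last exact: open_lt.
    rewrite /dirval; case: (s); last exact: cvg_id.
    by apply: cvgB; [exact: cvg_cst|exact: cvg_id].
  have L t : local_transverse A t (dirval s (t 0 i)) by apply: Or33; exists i, s.
  apply/seteqP; split=> t [ht ct]; split => //.
    by apply: (key _ ct).2; exists (dirval s (t 0 i)).
  have [r r2 L'] := (key _ ct).1 ht; rewrite /preimage /=.
  by rewrite -(local_uniq ct ct erefl L' (L t)).
Qed.

Lemma connected_segment c (t t' : 'rV[R]_(dim c)) (S : set X) : icube t -> icube t' ->
  (forall s, 0 <= s <= 1 -> S (chart (segment t t' s))) ->
  connected_component S (chart t) (chart t').
Proof.
move=> ct ct' h; pose f (s : R) := chart (c := c) (segment t t' s).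
have f0 : (f @` `[0, 1]%classic) (chart t).
  by exists 0; rewrite /f ?segment0//= in_itv /= lexx ler01.
have f1 : (f @` `[0, 1]%classic) (chart t').
  by exists 1; rewrite /f ?segment1//= in_itv /= lexx ler01.
apply: connected_component_max f1 => //.
- by move=> _ [s + <-]; rewrite /= in_itv; exact: h.
- apply: connected_continuous_connected; first exact: segment_connected.
  exact: chart_segment_continuous.
Qed.

Lemma dirval_segment n (t t' : 'rV[R]_n) i s x :
  dirval s (segment t t' x 0 i) = (1 - x) * dirval s (t 0 i) + x * dirval s (t' 0 i).
Proof. by rewrite mxE /dirval; case: s => //; ring. Qed.

Lemma dirval_bvec n (b : bits n) i : dirval (b i) (bvec b 0 i) = 0.
Proof. by rewrite bvecE /dirval; case: (b i); rewrite ?subrr. Qed.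

(** Moving straight to a corner on the side of [A] only lowers the transverse
    coordinate. *)
Lemma hs_to_vertex p : hs A p -> exists2 v, A v & connected_component (hs A) p (sval v).
Proof.
have [c [t ct <-]] := chart_cover p => -[r r2 /(transverseP _ ct) L].
case: (L) => [[h r0]|[h r1]|[i [s [h rE]]]].
- pose b : bits (dim c) := [ffun=> false].
  exists (vx b) => //; apply: connected_segment => //.
    exact: bvec_icube.
  move=> x x01; exists 0; first by lra.
  apply/transverseP; first by apply: segment_icube => //; exact: bvec_icube.
  exact: Or31.
- by lra.
- pose b : bits (dim c) := [ffun=> s].
  exists (vx b); first by apply/h; rewrite ffunE.
  apply: connected_segment => //; first exact: bvec_icube.
  move=> x x01; exists (dirval s (segment t (bvec b) x 0 i)).
    rewrite dirval_segment; have -> : dirval s (bvec b 0 i) = 0.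
      by rewrite -{1}[s](_ : b i = s) ?dirval_bvec// ffunE.
    rewrite mulr0 addr0; have r0 : 0 <= r.
      rewrite rE /dirval; have /andP[? ?] := ct i; by case: (s); lra.
    by rewrite -rE; move/andP: x01 => [? ?]; nra.
  apply/transverseP; first by apply: segment_icube => //; exact: bvec_icube.
  by apply: Or33; exists i, s.
Qed.

Lemma hs_edge u v : adj u v -> A u -> A v -> connected_component (hs A) (sval u) (sval v).
Proof.
move=> [c [b [i [-> ->]]]] Au Av; apply: connected_segment; do ?exact: bvec_icube.
move=> x x01.
have ct : icube (segment (bvec b) (bvec (flipb b i)) x : 'rV[R]_(dim c)).
  by apply: segment_icube => //; exact: bvec_icube.
exists 0; first by lra.
apply/transverseP => //; case: (A_local c) => [h|h|[j [s h]]]; first exact: Or31.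
  by case: (h b).
apply: Or33; exists j, s; split => //; rewrite dirval_segment.
have bs : b j = s by exact/h.
have fs : flipb b i j = s by exact/h.
by rewrite -{1}bs dirval_bvec -fs dirval_bvec !mulr0 addr0.
Qed.

Lemma wall_cell c p q : closed_cell c p -> closed_cell c q -> wall A p -> wall A q ->
  connected_component (wall A) p q.
Proof.
move=> [t ct <-] [t' ct' <-] /(transverseP _ ct) L /(transverseP _ ct') L'.
apply: connected_segment => // x x01.
apply/transverseP; first exact: segment_icube.
case: L => [[_ e]|[_ e]|[i [s [h e]]]]; [by exfalso; lra|by exfalso; lra|].
have e' : 2^-1 = dirval s (t' 0 i).
  apply: (local_uniq ct' ct' erefl L'); by apply: Or33; exists i, s.
by apply: Or33; exists i, s; split => //; rewrite dirval_segment -e -e'; ring.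
Qed.

Lemma wall_edge a b e : A a -> ~ A b -> adj a b -> edge_cell a b e ->
  exists2 p, closed_cell e p & wall A p.
Proof.
move=> Aa nA ab [e1 ea eb _].
pose t : 'rV[R]_(dim e) := const_mx 2^-1.
have ct : icube t by move=> i; rewrite mxE; apply/andP; split; lra.
exists (chart t); first exact: in_cell.
apply/transverseP => //; have /incellP[b1 E1] := ea; have /incellP[b2 E2] := eb.
case: (A_local e) => [h|h|[i [s h]]].
- by case: nA; rewrite E2.
- by case: (h b1); rewrite -E1.
- apply: Or33; exists i, s; split => //; rewrite mxE /dirval; case: (s) => //; lra.
Qed.

Lemma wall_trace c : wall A `&` closed_cell c = set0 \/
  exists i : 'I_(dim c), wall A `&` closed_cell c = chart (c := c) @` midcube i.
Proof.
case: (A_local c) => [h|h|[i [s h]]].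
- left; apply/seteqP; split => // p [/[swap] -[t ct <-] /(transverseP _ ct) L].
  have : 2^-1 = 0 :> R by apply: (local_uniq ct ct erefl L); exact: Or31.
  by move=> ?; lra.
- left; apply/seteqP; split => // p [/[swap] -[t ct <-] /(transverseP _ ct) L].
  have : 2^-1 = 1 :> R by apply: (local_uniq ct ct erefl L); exact: Or32.
  by move=> ?; lra.
- right; exists i; have L t : local_transverse A t (dirval s (t 0 i)).
    by apply: Or33; exists i, s.
  apply/seteqP; split=> [p [/[swap] -[t ct <-] /(transverseP _ ct) L']|_ [t [ct ti] <-]].
    exists t => //; split => //.
    by have := local_uniq ct ct erefl L' (L t); rewrite /dirval; case: (s) => ?; lra.
  split; last exact: in_cell.
  apply/(transverseP _ ct); rewrite (_ : 2^-1 = dirval s (t 0 i))//.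
  by rewrite /dirval ti; case: (s) => //; lra.
Qed.

End TransverseCoordinate.

Section Walls.
Import Defs.
Context {R : realType} (X : cubeComplex R).
Local Notation vert := (vert X).
Local Notation vx := (@vx R X).
Local Notation adj := (adj vx).
Local Notation sq := (sq vx).
Variable d : vert -> vert -> nat.
Hypothesis cs : cube_system vx.
Hypothesis cd : cube_distance adj sq d.
Local Notation side := (side d).
Let sg := cube_system_squares cs.
Implicit Types (u v : vert) (c : cell X) (p : X).

(** If one edge of a cell crosses the wall, then so do all edges of the cell
    parallel to it, by the squares of the cell, and these join the corners with
    the two values of one coordinate. *)
Lemma side_local u v : adj u v -> forall c, [\/ forall b, side u v (vx (c := c) b),
  forall b, ~ side u v (vx (c := c) b) |
  exists i s, forall b, side u v (vx (c := c) b) <-> b i = s].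
Proof.
move=> uv c; set A := side u v.
have cross (p q : vert) : adj p q -> ~ A p -> A q -> side p q = A.
  by move=> pq; exact: (crossing_side sg cd uv pq).
have [[b0 [i [A0 nA0]]]|nc] := pselect (exists (b : bits (dim c)) i,
    A (vx b) /\ ~ A (vx (flipb b i))).
  apply: Or33; exists i, (b0 i).
  suff H (b : bits (dim c)) : (A (vx b) <-> b i = b0 i) /\ (A (vx (flipb b i)) <-> b i <> b0 i).
    by move=> b; case: (H b).
  move: b; apply: (bits_ind (b' := b0)); first by split.
  move=> b j bj [IH1 IH2]; have [ji|ji] := eqVneq j i.
    subst j; rewrite flipbK !flipb_eq in IH1 IH2; split.
      by rewrite IH2; move: bj; case: (b i); case: (b0 i).
    by rewrite IH1; move: bj; case: (b i); case: (b0 i).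
  have ij : i != j by rewrite eq_sym.
  rewrite (flipb_neq b ij) in IH1 IH2.
  have S : sq (vx (flipb (flipb b j) i)) (vx (flipb b j)) (vx b) (vx (flipb b i)).
    exists c, (flipb (flipb b j) i), i, j; rewrite flipbK; split=> //.
      by rewrite flipbK.
    by rewrite (flipbC b j i) flipbK.
  have e1 := side_sq sg cd S.
  have e2 : side (vx (flipb b j)) (vx (flipb (flipb b j) i)) = side (vx b) (vx (flipb b i)).
    exact: (side_sq sg cd (sq_rev sg (sq_rot sg S))).
  have a1 : adj (vx b) (vx (flipb b i)) by exists c, b, i.
  have a1' := adj_symm a1.
  have a2 : adj (vx (flipb b j)) (vx (flipb (flipb b j) i)) by exists c, (flipb b j), i.
  have a2' := adj_symm a2.
  have [bi|bi] := pselect (b i = b0 i).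
    have Aj : A (vx (flipb b j)) by apply/IH1.
    have nAj : ~ A (vx (flipb (flipb b j) i)) by move/IH2.
    have := cross _ _ a2' nAj Aj; rewrite e1 => E.
    split; split=> // h; first by rewrite -E; exact: (side_r sg cd).
    by case: (side_l cd a1'); rewrite E.
  have nAj : ~ A (vx (flipb b j)) by move/IH1.
  have Aj : A (vx (flipb (flipb b j) i)) by apply/IH2.
  have := cross _ _ a2 nAj Aj; rewrite e2 => E.
  split; split=> // h; last by rewrite -E; exact: (side_r sg cd).
  by case: (side_l cd a1); rewrite E.
have [[b1 A1]|nA] := pselect (exists b : bits (dim c), A (vx b)); last first.
  by apply: Or32 => b Ab; apply: nA; exists b.
apply: Or31; apply: (bits_ind (b' := b1)) => // b i _ Ab.
apply: contrapT => nAb; apply: nc; exists (flipb b i), i; by rewrite flipbK.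
Qed.

Lemma setC_side u v : adj u v -> ~` side u v = side v u.
Proof. by move=> uv; apply/seteqP; split=> w /(sideN cd w uv). Qed.

Lemma transverseC u v p r : adj u v ->
  transverse (side u v) p r -> transverse (side v u) p (1 - r).
Proof.
move=> uv; have [c [t ct <-]] := chart_cover p.
move=> /(transverseP (side_local uv) _ ct)/local_transverseC.
by rewrite setC_side// => /(transverseP (side_local (adj_symm uv)) _ ct).
Qed.

Lemma wall_sym u v : adj u v -> wall (side u v) = wall (side v u).
Proof.
move=> uv; have half : 1 - 2^-1 = 2^-1 :> R by lra.
by apply/seteqP; split=> p /transverseC; rewrite half; apply; last exact: adj_symm.
Qed.

Lemma hs_disjoint u v p : adj u v -> hs (side u v) p -> hs (side v u) p -> False.
Proof.
move=> uv [r r2 /(transverseC uv) h] [r' r2' h'].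
have := transverse_uniq (side_local (adj_symm uv)) h h'; lra.
Qed.

Lemma setC_wall u v : adj u v -> ~` wall (side u v) = hs (side u v) `|` hs (side v u).
Proof.
move=> uv; have loc := side_local uv; apply/seteqP; split=> [p np|p].
  have [r h] := transverse_exists loc p.
  have [lt|lt|e] := ltgtP r 2^-1; last by case: np; rewrite /wall /= -e.
    by left; exists r.
  by right; exists (1 - r); [lra|exact: transverseC].
case=> -[r r2 h] w.
  by have := transverse_uniq loc h w => ?; lra.
rewrite wall_sym// in w.
by have := transverse_uniq (side_local (adj_symm uv)) h w => ?; lra.
Qed.

Lemma hs_vertex u v w : adj u v -> hs (side u v) (sval w) <-> side u v w.
Proof.
move=> uv; have loc := side_local uv; split=> [[r r2 h]|sw].
  have [c [t ct E]] := chart_cover (sval w); rewrite -E in h.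
  apply: contrapT => nw; have : r = 1; last by lra.
  move/(transverseP loc _ ct) : h => L; apply: (local_none ct L) => x.
  by rewrite E => /carrier_vertex ->.
have [r h] := transverse_exists loc (sval w).
by exists r => //; rewrite ((transverse_vertex loc h).1 sw); lra.
Qed.

(** From any point of the half-space a path leads to a vertex, and from there to
    [v] along edges which stay inside. *)
Lemma hs_component u v p : adj u v -> hs (side u v) p ->
  connected_component (hs (side u v)) (sval v) p.
Proof.
move=> uv /(hs_to_vertex (side_local uv))[w sw h].
apply: connected_component_trans (connected_component_sym h).
move: {h} w sw; suff H n w : (d w v < n)%N -> side u v w ->
    connected_component (hs (side u v)) (sval v) (sval w).
  by move=> w; exact: (H (d w v).+1).
elim: n w => // n IH w; rewrite ltnS => wn sw.
have [->|wv] := pselect (w = v).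
  by apply: connected_component_refl; apply/hs_vertex => //; exact: (side_r sg cd).
have [w' [ww' sw' lt]] := side_down sg cd uv sw wv.
apply: connected_component_trans (IH w' _ sw') _; first exact: leq_trans lt wn.
apply: hs_edge => //; [exact: side_local|exact: adj_symm].
Qed.

(** The two half-spaces are open, disjoint and connected, and cover the
    complement of the wall. *)
Lemma component_wall u v p : adj u v -> hs (side u v) p ->
  connected_component (~` wall (side u v)) p = hs (side u v).
Proof.
move=> uv hp; have vu := adj_symm uv; apply/seteqP; split=> q.
  move=> [C [Cp CW cC] Cq].
  have CU : C `<=` hs (side u v) `|` hs (side v u) by rewrite -setC_wall.
  suff E : C `&` hs (side u v) = C by move: Cq; rewrite -E => -[].
  have ou := hs_open (side_local uv).
  have ov := hs_open (side_local vu).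
  apply: cC; first by exists p.
    by exists (hs (side u v)).
  exists (~` hs (side v u)); first exact: open_closedC.
  apply/seteqP; split=> x [Cx hx]; split => //.
    by move=> /(hs_disjoint uv hx).
  by case: (CU _ Cx).
move=> hq; have h1 := hs_component uv hp; have h2 := hs_component uv hq.
have [C [Cp CW cC] Cq] := connected_component_trans (connected_component_sym h1) h2.
exists C => //; split=> // x /CW hx; rewrite setC_wall//; by left.
Qed.

Let through (x y : vert) (m : X) :=
  forall c, closed_cell c (sval x) -> closed_cell c (sval y) -> closed_cell c m.

Lemma wall_through u v x y : adj u v -> adj x y -> side x y = side u v ->
  exists2 m, wall (side u v) m & through x y m.
Proof.
move=> uv xy E; have [e he] := edge_cell_exists (adj_symm xy).
have [||m em wm] := wall_edge (side_local uv) (a := y) (b := x) _ _ (adj_symm xy) he.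
- by rewrite -E; exact: (side_r sg cd).
- by rewrite -E; exact: (side_l cd).
- by exists m => // c cx cy; case: he => _ _ _; apply; eassumption.
Qed.

(** Opposite sides of a square lie in a common cell, in which the wall is a
    connected midcube. *)
Lemma wall_parallel u v x y a b m m' : adj u v -> parallel sq x y a b -> adj x y ->
  side x y = side u v -> wall (side u v) m -> wall (side u v) m' ->
  through x y m -> through a b m' -> connected_component (wall (side u v)) m m'.
Proof.
move=> uv par; elim: par m => {x y a b} [x y m|x y x' y' a b S par IH m] xy E wm wm' tm tm'.
  have [c [b [i [Ex Ey]]]] := xy.
  have cx : closed_cell c (sval x) by apply/incellP; exists b.
  have cy : closed_cell c (sval y) by apply/incellP; exists (flipb b i).
  by apply: (wall_cell (side_local uv) (c := c)) => //; [exact: tm|exact: tm'].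
have xy' : adj x' y' by exact: (adj_symm (sq_adj sg (sq_rot sg (sq_rot sg S)))).
have E' : side x' y' = side u v by rewrite -E (side_sq sg cd S).
have [m1 wm1 tm1] := wall_through uv xy' E'.
apply: connected_component_trans (IH m1 _ _ _ _ _ _) => //.
have [c [b0 [i [j [_ Ex Ey Ey' Ex']]]]] := S.
have inc z (b' : bits (dim c)) : z = vx b' -> closed_cell c (sval z).
  by move=> ->; apply/incellP; exists b'.
apply: (wall_cell (side_local uv) (c := c)) => //.
  by apply: tm; [exact: inc Ex|exact: inc Ey].
by apply: tm1; [exact: inc Ex'|exact: inc Ey'].
Qed.

Lemma wall_hyperplane u v : adj u v -> hyperplane (wall (side u v)).
Proof.
have n0 : 2^-1 <> 0 :> R by lra.
have n1 : 2^-1 <> 1 :> R by lra.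
move=> uv; have [m0 w0 t0] := wall_through uv uv erefl; split; first by exists m0.
- suff -> : wall (side u v) = connected_component (wall (side u v)) m0.
    exact: component_connected.
  apply/seteqP; split; last exact: connected_component_sub.
  move=> p wp; have [c [t ct E]] := chart_cover p.
  have loc := side_local uv; move: (wp); rewrite -E => /(transverseP loc _ ct).
  case=> [[_ /n0//]|[_ /n1//]|[i [s [h _]]]].
  pose b : bits (dim c) := [ffun=> ~~ s].
  have nA : ~ side u v (vx b) by move/h; rewrite ffunE; case: (s).
  have Ab : side u v (vx (flipb b i)) by apply/h; rewrite flipb_eq ffunE negbK.
  have ab : adj (vx b) (vx (flipb b i)) by exists c, b, i.
  have par := crossing_parallel sg cd uv ab nA Ab.
  have [m1 w1 t1] := wall_through uv ab (crossing_side sg cd uv ab nA Ab).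
  apply: connected_component_trans (wall_parallel uv par uv erefl w0 w1 t0 t1) _.
  have cm : closed_cell c m1.
    by apply: t1; apply/incellP; [exists b|exists (flipb b i)].
  have cp : closed_cell c p by exists t.
  rewrite E; exact: (wall_cell loc cm cp w1 wp).
- exact: wall_trace (side_local uv).
Qed.

Lemma halfspace_of_wall u v h : adj u v ->
  halfspace_of (wall (side u v)) h <-> h = hs (side u v) \/ h = hs (side v u).
Proof.
move=> uv; have vu := adj_symm uv; split=> [[p np ->]|].
  have [hp|hp] : (hs (side u v) `|` hs (side v u)) p by rewrite -setC_wall.
    by left; exact: (component_wall uv hp).
  by right; rewrite wall_sym//; exact: (component_wall vu hp).
case=> ->.
  have hv : hs (side u v) (sval v) by apply/hs_vertex => //; exact: (side_r sg cd).
  exists (sval v); last by rewrite component_wall.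
  by rewrite setC_wall//; left.
have hu : hs (side v u) (sval u) by apply/hs_vertex => //; exact: (side_r sg cd).
exists (sval u); last by rewrite wall_sym// component_wall.
by rewrite setC_wall//; right.
Qed.

(** Both half-spaces are read in a cell; the inclusion of their corners leaves
    only the case where they cut the cell in the same direction. *)
Lemma hs_subset u v u' v' : adj u v -> adj u' v' -> side u v `<=` side u' v' ->
  hs (side u v) `<=` hs (side u' v').
Proof.
move=> uv uv' sub p; have [c [t ct <-]] := chart_cover p.
move=> -[r r2 /(transverseP (side_local uv) _ ct) L].
suff [r' r'2 L'] : exists2 r', r' < 2^-1 & local_transverse (side u' v') t r'.
  by exists r' => //; apply/(transverseP (side_local uv') _ ct).
case: L => [[h r0]|[h r1]|[i [s [h rE]]]].
- by exists 0; [lra|apply: Or31; split=> // b; exact: sub].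
- by exfalso; lra.
- pose b0 : bits (dim c) := [ffun=> s].
  have A0 : side u v (vx b0) by apply/h; rewrite ffunE.
  case: (side_local uv' c) => [k|k|[j [s' k]]].
  + by exists 0; [lra|apply: Or31].
  + by case: (k b0); exact: sub.
  + have ss : s = s' by have /k := sub _ A0; rewrite ffunE.
    subst s'; have [ij|ij] := eqVneq i j; first by subst j; exists r => //; apply: Or33; exists i, s.
    have /k : side u' v' (vx (flipb b0 j)).
      by apply: sub; apply/h; rewrite flipb_neq// ffunE.
    by rewrite flipb_eq ffunE; case: (s).
Qed.

End Walls.

HB.instance Definition _ (R : realType) (X : cubeComplex R) := gen_eqMixin (vert X).
HB.instance Definition _ (R : realType) (X : cubeComplex R) := gen_choiceMixin (vert X).

Section Orientation.
Import Defs.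
Context {R : realType} (X : cubeComplex R).
Local Notation vert := (vert X).
Local Notation vx := (@vx R X).
Local Notation adj := (adj vx).
Local Notation sq := (sq vx).
Variable d : vert -> vert -> nat.
Hypothesis cs : cube_system vx.
Hypothesis cd : cube_distance adj sq d.
Local Notation side := (side d).
Let sg := cube_system_squares cs.
Implicit Types (u v : vert) (c : cell X) (p : X).

Lemma hs_halfspace u v : adj u v -> halfspace (hs (side u v)).
Proof.
move=> uv; exists (wall (side u v)); first exact: (wall_hyperplane cs cd uv).
by apply/(halfspace_of_wall cs cd _ uv); left.
Qed.

Section Ultrafilter.
Variable a : set (set X).
Hypothesis ua : ultrafilter a.

Lemma ultrafilter_total u v : adj u v -> a (hs (side u v)) \/ a (hs (side v u)).
Proof.
move=> uv; case: ua => _ /(_ _ (wall_hyperplane cs cd uv))[h [[hh ah] _]] _.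
by move/(halfspace_of_wall cs cd _ uv) : hh => -[<-|<-]; [left|right].
Qed.

Lemma ultrafilter_excl u v : adj u v -> a (hs (side u v)) -> a (hs (side v u)) -> False.
Proof.
move=> uv auv avu; case: ua => _ /(_ _ (wall_hyperplane cs cd uv))[h [_ hu]] _.
have h1 : h = hs (side u v).
  by apply: hu; split=> //; apply/(halfspace_of_wall cs cd _ uv); left.
have h2 : h = hs (side v u).
  by apply: hu; split=> //; apply/(halfspace_of_wall cs cd _ uv); right.
have E : hs (side u v) = hs (side v u) by rewrite -h1 -h2.
have hv : hs (side u v) (sval v) by apply/(hs_vertex cs cd _ uv); exact: (side_r sg cd).
by apply: (hs_disjoint cs cd uv hv); rewrite -E.
Qed.

(** Two edges leaving [x] towards an ultrafilter span a square: otherwise the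
    half-spaces which they enter would be disjoint. *)
Lemma ultrafilter_square x y y' : adj x y -> adj x y' -> y <> y' ->
  a (hs (side x y)) -> a (hs (side x y')) -> exists w, sq x y w y'.
Proof.
move=> xy xy' yy' ay ay'.
have [[w [wy wy']]|nw] := pselect (exists w, side x y w /\ side x y' w).
  exact: (side_meet_square cd xy xy' yy' wy wy').
exfalso; apply: (ultrafilter_excl xy' ay'); case: ua => _ _ up.
apply: (up _ _ ay); first exact/hs_halfspace/adj_symm.
apply: (hs_subset cs cd xy (adj_symm xy')) => w wy.
by apply/(sideN cd _ xy') => wy'; apply: nw; exists w.
Qed.

End Ultrafilter.

Section Automorphism.
Variable g : aut X.

Lemma aut_vertex v : vertex (g (sval v)).
Proof.
have [c c0 cv] := svalP v; have [e ge _] := aut_cellular g c.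
have e1 : closed_cell e = [set g (sval v)] by rewrite -ge cv image_set1.
exists e => //; case E : (dim e) => [//|n].
have lt0 : (0 < dim e)%N by rewrite E.
pose b : bits (dim e) := [ffun=> false].
have h1 : closed_cell e (chart (bvec b)) by apply: in_cell; exact: bvec_icube.
have h2 : closed_cell e (chart (bvec (flipb b (Ordinal lt0)))).
  by apply: in_cell; exact: bvec_icube.
rewrite e1 in h1 h2; have : vx b = vx (flipb b (Ordinal lt0)).
  by apply: vert_eq; rewrite /= h1 h2.
by move=> /vx_injective/esym/flipb_id.
Qed.

Definition aut_vert v : vert := exist _ (g (sval v)) (aut_vertex v).

Lemma aut_vert_adj u v : adj u v -> adj (aut_vert u) (aut_vert v).
Proof.
move=> [c [b [i [Eu Ev]]]]; have [e ge gd] := aut_cellular g c.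
have cu : closed_cell c (sval u) by apply/incellP; exists b.
have cv : closed_cell c (sval v) by apply/incellP; exists (flipb b i).
have /incellP[b1 E1] : closed_cell e (sval (aut_vert u)) by rewrite -ge; exists (sval u).
have /incellP[b2 E2] : closed_cell e (sval (aut_vert v)) by rewrite -ge; exists (sval v).
have /hamming1[j Ej] : hamming b1 b2 = 1%N.
  apply/eqP; rewrite -(eqr_nat R) -edist_bvec.
  have := gd _ _ cu cv; rewrite -[g _]/(sval (aut_vert u)) -[g (sval v)]/(sval (aut_vert v)).
  rewrite E1 E2 Eu Ev /cell_dist !coord_chart; do ?exact: bvec_icube.
  by move=> ->; rewrite edist_bvec hamming_flipb.
by exists e, b1, j; rewrite -Ej.
Qed.

End Automorphism.

Lemma aut_vertK (g : aut X) : cancel (aut_vert g) (aut_vert (aut_rev g)).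
Proof. by move=> v; apply: vert_eq; rewrite /= aut_funK. Qed.

Lemma aut_vertVK (g : aut X) : cancel (aut_vert (aut_rev g)) (aut_vert g).
Proof. by move=> v; apply: vert_eq; rewrite /= aut_invK. Qed.

Lemma dist_aut (g : aut X) u v : d (aut_vert g u) (aut_vert g v) = d u v.
Proof.
suff le (h : aut X) x y : (d (aut_vert h x) (aut_vert h y) <= d x y)%N.
  apply/eqP; rewrite eqn_leq le -{1}(aut_vertK g u) -{1}(aut_vertK g v); exact: le.
have [q [q0 qn] qP] := geodesic_exists sg cd x y.
suff H i : (i <= d x y)%N -> (d (aut_vert h x) (aut_vert h (q i)) <= i)%N.
  by rewrite -{1}qn; exact: H.
elim: i => [|i IH] lt; first by rewrite q0 (dist_xx cd).
have [qq _] := qP _ lt; apply: leq_trans (dist_lip cd _ (aut_vert_adj h qq)) _.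
by rewrite ltnS; exact/IH/ltnW.
Qed.

Lemma side_aut (g : aut X) u v :
  side (aut_vert g u) (aut_vert g v) = aut_vert g @` side u v.
Proof.
apply/seteqP; split=> w; last by move=> [x sx <-]; rewrite /side/= !dist_aut.
move=> sw; exists (aut_vert (aut_rev g) w); last exact: aut_vertVK.
by move: sw; rewrite -{1}(aut_vertVK g w) /side/= !dist_aut.
Qed.

Lemma transverse_aut (g : aut X) (A : set vert) p r :
  transverse A p r -> transverse (aut_vert g @` A) (g p) r.
Proof.
have inj : injective (aut_vert g) := can_inj (aut_vertK g).
move=> [c cp H]; have [e ge gd] := aut_cellular g c.
have ec q : closed_cell c q -> closed_cell e (g q) by rewrite -ge; exists q.
have ec' (w : vert) : closed_cell e (sval w) -> exists2 v, closed_cell c (sval v) & w = aut_vert g v.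
  rewrite -ge => -[q cq gq]; exists (aut_vert (aut_rev g) w); last by rewrite aut_vertVK.
  by rewrite /= -gq aut_funK.
have nim v : ~ A v -> ~ (aut_vert g @` A) (aut_vert g v).
  by move=> nA [v' Av' /inj vv']; apply: nA; rewrite -vv'.
exists e; first exact: ec.
case: H => [[a [b [Aa nA ab ca [cb ->]]]]|[h ->]|[h ->]].
- apply: Or31; exists (aut_vert g a), (aut_vert g b); split.
  + by exists a.
  + exact: nim.
  + exact: aut_vert_adj.
  + exact: ec.
  + by split; [exact: ec|rewrite !gd].
- by apply: Or32; split=> // w /ec'[v cv ->]; exists v => //; exact: h.
- by apply: Or33; split=> // w /ec'[v cv ->]; apply: nim; exact: h.
Qed.

Lemma hs_aut (g : aut X) u v :
  hs (side (aut_vert g u) (aut_vert g v)) = g @` hs (side u v).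
Proof.
rewrite side_aut; apply/seteqP; split=> [p [r r2 h]|_ [p [r r2 h] <-]].
  exists (aut_inv g p); last exact: aut_invK.
  exists r => //; have := transverse_aut (aut_rev g) h; rewrite image_comp.
  by rewrite (_ : _ \o _ = id) ?image_id//; apply/funext => w /=; exact: aut_vertK.
by exists r => //; exact: transverse_aut.
Qed.

Lemma ultra_act_hs (g : aut X) (a : ultraNT X) u v :
  sval (ultra_act g a) (hs (side (aut_vert g u) (aut_vert g v))) <->
  sval a (hs (side u v)).
Proof.
rewrite hs_aut; split=> [[h ah E]|ah]; last by exists (hs (side u v)).
suff <- : h = hs (side u v) by [].
have inj : injective g := can_inj (aut_funK g).
apply/seteqP; split=> p hp.
  by have : (g @` h) (g p) by [exists p]; rewrite E => -[q hq /inj <-].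
by have : (g @` hs (side u v)) (g p) by [exists p]; rewrite -E => -[q hq /inj <-].
Qed.

Lemma locally_finite_adj : locally_finite X -> forall v, finite_set [set u | adj v u].
Proof.
move=> lf v; have fc := lf _ (svalP v).
apply: (@sub_finite_set _ _ (\bigcup_(c in [set c : cell X | closed_cell c (sval v)])
  range (vx (c := c)))).
  move=> u [c [b [i [Ev Eu]]]]; exists c; last by exists (flipb b i).
  by apply/incellP; exists b.
apply: bigcup_finite => // c _; apply: finite_image; exact: finite_finset.
Qed.

(** The neighbours lie in one cell by the flag condition. *)
Lemma dimension_bound n : (forall c, dim c <= n)%N -> forall x (S : {fset vert}),
  (forall u, u \in S -> adj x u) ->
  (forall u v, u \in S -> v \in S -> u <> v -> exists w, sq x u w v) ->
  (#|` S| <= n)%N.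
Proof.
move=> dn x S Sx Ssq; have [->|/fset0Pn[u0 u0S]] := eqVneq S fset0.
  by rewrite cardfs0.
have [||c [b [Eb h]]] := vx_flag cs (a := x) (S := [set` S]) _ _ Sx Ssq.
- exact: finite_fset.
- by exists u0.
apply: leq_trans (dn c).
pose f (i : 'I_(dim c)) := vx (flipb b i).
have sub : (S `<=` [fset f i | i in 'I_(dim c)])%fset.
  by apply/fsubsetP => u /h[i ->]; apply/imfsetP; exists i.
apply: leq_trans (fsubset_leq_card sub) _.
by apply: leq_trans (leq_imfset_card _ _ _) _; rewrite -[leqRHS]card_ord cardE; apply: leqnn.
Qed.

End Orientation.

(** * Weights on the interval from a vertex to an ultrafilter *)

(** What the half-spaces of an ultrafilter say about edges: [o u v] means that the
    edge from [u] to [v] leads towards the ultrafilter. *)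
Record orientation (V : choiceType) (adj : V -> V -> Prop)
    (sq : V -> V -> V -> V -> Prop) (d : V -> V -> nat) (N : nat)
    (o : V -> V -> Prop) : Prop := Orientation {
  orient_total : forall u v, adj u v -> o u v \/ o v u;
  orient_excl : forall u v, adj u v -> o u v -> o v u -> False;
  orient_side : forall u v u' v', adj u v -> adj u' v' -> side d u v = side d u' v' ->
    o u v -> o u' v';
  orient_square : forall x y y', adj x y -> adj x y' -> y <> y' -> o x y -> o x y' ->
    exists c, sq x y c y';
  orient_bound : forall x (S : {fset V}), (forall u, u \in S -> adj x u /\ o x u) ->
    (#|` S| <= N)%N
}.

Section Weights.
Variables (R : realFieldType) (V : choiceType).
Variables (adj : V -> V -> Prop) (sq : V -> V -> V -> V -> Prop) (d : V -> V -> nat).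
Variable N : nat.
Hypothesis sg : square_graph adj sq.
Hypothesis cd : cube_distance adj sq d.
Hypothesis nbf : forall v, finite_set [set u | adj v u].
Local Notation side := (side d).
Local Notation orientation := (orientation adj sq d N).

Definition ball_set x n := [set y | (d x y <= n)%N].

Lemma ball_finite x n : finite_set (ball_set x n).
Proof.
elim: n => [|n IH].
  apply: (@sub_finite_set _ _ [set x]); last exact: finite_set1.
  by move=> y; rewrite /ball_set/= leqn0 => /eqP/(dist_eq0 cd).
apply: (@sub_finite_set _ _ (ball_set x n `|` \bigcup_(y in ball_set x n) [set u | adj y u])).
  move=> y; rewrite /ball_set/= leq_eqVlt => /orP[/eqP E|]; last by left.
  have [|u yu Eu] := dist_down cd (x := x) (v := y); first by rewrite E.
  right; exists u; last exact: (adj_sym sg).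
  by rewrite /=; move: Eu; rewrite E => -[<-].
by rewrite finite_setU; split=> //; apply: bigcup_finite.
Qed.

Section FixedOrientation.
Variable o : V -> V -> Prop.
Hypothesis ho : orientation o.

Definition out x := [set y | adj x y /\ o x y].
Definition outdeg x := #|` fset_set (out x)|.

(** The vertices between [x] and the ultrafilter. *)
Definition interval x := [set y | forall a b, adj a b -> ~ side a b x -> side a b y -> o a b].

Definition weight n x y : R := 'C(n - d x y + (N - outdeg y), N - outdeg y)%:R.

Lemma out_finite x : finite_set (out x).
Proof. by apply: sub_finite_set (nbf x) => y []. Qed.

Lemma outdeg_le x : (outdeg x <= N)%N.
Proof.
by apply: (orient_bound ho (x := x)) => u; rewrite in_fset_set ?inE//; exact: out_finite.
Qed.

(** The half-spaces in [Cs] are those which the percolation has closed. *)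
Definition region x (Cs : {fset set V}) n :=
  [set y | [/\ interval x y, (d x y <= n)%N & forall A, A \in Cs -> ~ A y]].

Lemma region_finite x Cs n : finite_set (region x Cs n).
Proof. by apply: sub_finite_set (ball_finite x n) => y []. Qed.

Definition directions x : set (set V) := side x @` out x.

Lemma side_injl x y y' : adj x y -> adj x y' -> side x y = side x y' -> y = y'.
Proof.
move=> xy xy' E; have : side x y' y by rewrite -E; exact: (side_r sg cd).
rewrite /side/= (dist_sym sg cd y x) (dist1 cd xy) ltnS leqn0 => /eqP.
by move/(dist_eq0 cd).
Qed.

Lemma card_directions x : #|` fset_set (directions x)| = outdeg x.
Proof.
rewrite /directions fset_set_image; last exact: out_finite.
apply: card_in_imfset => y y'; rewrite !in_fset_set ?inE; do ?exact: out_finite.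
by move=> [xy _] [xy' _]; exact: side_injl.
Qed.

Lemma directions_finite x : finite_set (directions x).
Proof. by apply: finite_image; exact: out_finite. Qed.

(** The walls separating [x'] from [y] are those separating [x] from [y], except
    for the one between [x] and [x']. *)
Lemma region_step x x' Cs n : adj x x' -> o x x' ->
  region x Cs n.+1 `&` side x x' = region x' Cs n.
Proof.
move=> xx' oxx'; have x'x := adj_sym sg xx'.
apply/seteqP; split=> y.
  move=> [[Iy dy Cy] sy]; split=> //; last first.
    by move: sy; rewrite /side/= !(dist_sym sg cd y) => lt; rewrite -ltnS; exact: leq_trans lt dy.
  move=> a b ab na sb; have [sx|nx] := pselect (side a b x); last exact: Iy.
  have E := crossing_side sg cd ab x'x na sx.
  by move: sb; rewrite -E => /((sideN cd y xx').2).
move=> [Iy dy Cy].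
have sy : side x x' y.
  apply: contrapT => /(sideN cd y xx') sy.
  apply: (orient_excl ho xx' oxx'); apply: (Iy _ _ x'x) => //; exact: (side_l cd).
have dE := dist_adj cd y xx'; have lt := sy; rewrite /side/= in lt.
rewrite !(dist_sym sg cd y) in dE lt.
split=> //; split=> //; last by lia.
move=> a b ab na sb; have [sx'|nx'] := pselect (side a b x'); last exact: Iy.
have E := crossing_side sg cd ab xx' na sx'.
exact: (orient_side ho xx' ab E).
Qed.

Lemma weight_step x x' n y : adj x x' -> side x x' y -> weight n.+1 x y = weight n x' y.
Proof.
move=> xx' sy; rewrite /weight.
have dE := dist_adj cd y xx'; have lt := sy; rewrite /side/= in lt.
rewrite !(dist_sym sg cd y) in dE lt.
by have -> : (n.+1 - d x y = n - d x' y)%N by lia.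
Qed.

(** If all directions at [x] are closed, the region is [x] alone.  Otherwise an
    open direction, leading to [x'], splits the region: the part beyond its wall
    is the region of level [n-1] seen from [x'], where the closed directions
    persist because of the squares, and the rest is the region in which this
    direction is closed too. *)
Lemma region_mass x (Cs : {fset set V}) n : (forall A, A \in Cs -> directions x A) ->
  \sum_(y \in region x Cs n) weight n x y = 'C(n + (N - #|` Cs|), N - #|` Cs|)%:R.
Proof.
move: {2}(n + (N - #|` Cs|))%N.+1 (ltnSn (n + (N - #|` Cs|))%N) => m.
elim: m x Cs n => // m IH x Cs n; rewrite ltnS => le HCs.
have [sub|/existsNP[A /not_implyP[dA nA]]] := pselect (forall A, directions x A -> A \in Cs).
  have -> : region x Cs n = [set x].
    apply/seteqP; split=> [y [Iy _ Cy]|_ ->].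
      apply: contrapT => yx; have [|x' xx' sy] := side_separates cd (x := x) (y := y).
        by move=> xy; apply: yx.
      have oxx' : o x x' by apply: Iy => //; exact: (side_l cd).
      by apply: (Cy (side x x')) => //; apply: sub; exists x'.
    split=> [a b ab|| A /HCs[z [xz _] <-]]; last exact: (side_l cd).
      by move=> na /na.
    by rewrite (dist_xx cd).
  have EC : #|` Cs| = outdeg x.
    rewrite -card_directions; congr size; congr enum_fset; apply/fsetP => A.
    rewrite in_fset_set; last exact: directions_finite.
    by apply/idP/idP => [/HCs|]; rewrite inE//; exact: sub.
  by rewrite fsbig_set1 /weight (dist_xx cd) subn0 EC.
have {}nA : A \notin Cs by apply/negP.
have [x' [xx' oxx'] EA] := dA.
have ltC : (#|` Cs| < N)%N.
  have : (#|` (A |` Cs)%fset| <= #|` fset_set (directions x)|)%N.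
    apply: fsubset_leq_card; apply/fsubsetP => B; rewrite in_fset1U.
    rewrite in_fset_set; last exact: directions_finite.
    by move=> /orP[/eqP ->|/HCs]; rewrite inE.
  by rewrite cardfsU1 nA card_directions => h; exact: leq_trans h (outdeg_le x).
rewrite (fsbigID A) /=; last exact: region_finite.
have -> : region x Cs n `&` ~` A = region x (A |` Cs)%fset n.
  apply/seteqP; split=> y.
    move=> [[Iy dy Cy] nAy]; split=> // B; rewrite in_fset1U => /orP[/eqP ->//|]; exact: Cy.
  move=> [Iy dy Cy]; split; first split=> // B CB.
    by apply: Cy; rewrite in_fset1U CB orbT.
  by apply: Cy; rewrite in_fset1U eqxx.
rewrite (IH x (A |` Cs)%fset n); first last.
- by move=> B; rewrite in_fset1U => /orP[/eqP ->//|/HCs].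
- by rewrite cardfsU1 nA; lia.
have [k Ek] : exists k, (N - #|` Cs|)%N = k.+1 by exists (N - #|` Cs|).-1%N; lia.
have Ek' : (N - #|` (A |` Cs)%fset|)%N = k by rewrite cardfsU1 nA; lia.
rewrite Ek Ek'; case: n le => [|n] le.
  rewrite (_ : region x Cs 0 `&` A = set0) ?fsbig_set0 ?add0r ?add0n ?binn ?add0n ?binn//.
  apply/seteqP; split=> // y [[_ d0 _] Ay].
  have /(dist_eq0 cd) ? : d x y = 0%N by apply/eqP; rewrite -leqn0.
  by subst y; move: Ay; rewrite -EA => /(side_l cd).
rewrite -EA region_step//.
rewrite (eq_fsbigr (fun y => weight n x' y)); last first.
  move=> y /set_mem; rewrite -(region_step Cs n xx' oxx') => -[_ sy]; exact: weight_step.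
rewrite IH ?Ek -?natrD; first by congr (_%:R); rewrite [in RHS]addnS binS addSnnS.
- by lia.
- move=> B CB; have [z [xz oxz] EB] := HCs _ CB.
  have x'z : x' <> z by move=> ?; subst z; move: nA; rewrite -EA EB CB.
  have [c S] := orient_square ho xx' xz x'z oxx' oxz.
  have E : side x z = side x' c by exact: (side_sq sg cd (sq_rev sg S)).
  have x'c := sq_adj sg (sq_rot sg S).
  exists c; last by rewrite -E.
  by split=> //; exact: (orient_side ho xz x'c E).
Qed.

Definition phi n x y : R := if `[< region x fset0 n y >] then weight n x y else 0.

Definition total n : R := 'C(n + N, N)%:R.

Lemma phi_in n x y : region x fset0 n y -> phi n x y = weight n x y.
Proof. by rewrite /phi => h; rewrite asboolT. Qed.

Lemma phi_out n x y : ~ region x fset0 n y -> phi n x y = 0.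
Proof. by rewrite /phi => h; rewrite asboolF. Qed.

Lemma phi_ge0 n x y : 0 <= phi n x y.
Proof. by rewrite /phi; case: ifP => // _; exact: ler0n. Qed.

Lemma phi_support n x y : phi n x y != 0 -> (d x y <= n)%N.
Proof. by rewrite /phi; case: asboolP => [[_ h _]|]; rewrite ?eqxx. Qed.

Lemma phi_sum n x D : finite_set D -> ball_set x n `<=` D ->
  \sum_(y \in D) phi n x y = total n.
Proof.
move=> fD xD; rewrite -(@fsbig_widen _ _ _ _ (region x fset0 n)).
- rewrite (eq_fsbigr (weight n x)); last by move=> y /set_mem /phi_in.
  by rewrite region_mass ?cardfs0 ?subn0// => A; rewrite in_fset0.
- by move=> y [_ h _]; exact: xD.
- by move=> y [_ h] /=; exact: phi_out.
Qed.

Lemma phi_le n x y : phi n x y <= phi n.+1 x y.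
Proof.
have [h|h] := pselect (region x fset0 n y); last by rewrite phi_out// phi_ge0.
have h' : region x fset0 n.+1 y by case: h => Iy dy Cy; split=> //; exact: leqW.
rewrite !phi_in// ler_nat; apply: leq_bin2l; lia.
Qed.

(** Beyond the wall the difference is the gain of [x'] from level [n] to level
    [n+1]; before it, only the weights from [x] contribute. *)
Lemma phi_diff n x x' y : adj x x' -> o x x' ->
  `|phi n.+1 x y - phi n.+1 x' y| = phi n.+1 x y + phi n.+1 x' y - 2 * phi n x' y.
Proof.
move=> xx' oxx'; have [sy|ny] := pselect (side x x' y).
  have -> : phi n.+1 x y = phi n x' y.
    have E := region_step fset0 n xx' oxx'.
    have [h|h] := pselect (region x' fset0 n y).
      have hx : region x fset0 n.+1 y by move: h; rewrite -E => -[].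
      by rewrite !phi_in//; exact: weight_step.
    by rewrite !phi_out// => hx; apply: h; rewrite -E.
  by rewrite distrC ger0_norm ?subr_ge0 ?phi_le//; ring.
have z m : phi m x' y = 0.
  by apply: phi_out; rewrite -(region_step fset0 m xx' oxx') => -[].
by rewrite !z subr0 mulr0 subr0 addr0 ger0_norm// phi_ge0.
Qed.

Lemma phi_diff_sum n x x' D : adj x x' -> finite_set D ->
  ball_set x n.+1 `<=` D -> ball_set x' n.+1 `<=` D ->
  \sum_(y \in D) `|phi n.+1 x y - phi n.+1 x' y| = 2 * (total n.+1 - total n).
Proof.
have sub z : ball_set z n `<=` ball_set z n.+1 by move=> y; exact: leqW.
wlog oxx' : x x' / o x x'.
  move=> H xx' fD xD x'D; case: (orient_total ho xx') => oo; first exact: H.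
  rewrite -(H x' x) //; last exact: (adj_sym sg).
  by apply: eq_fsbigr => y _; rewrite distrC.
move=> xx' fD xD x'D.
rewrite (eq_fsbigr (fun y => (phi n.+1 x y + phi n.+1 x' y) + (-2) * phi n x' y)); last first.
  by move=> y _; rewrite phi_diff// mulNr.
rewrite fsbig_split// /= fsbig_split// /= -mulr_fsumr !phi_sum//; first by ring.
by move=> y /sub /x'D.
Qed.

Lemma phi_lipschitz n x x' D : finite_set D -> ball_set x (d x x' + n.+1) `<=` D ->
  \sum_(y \in D) `|phi n.+1 x y - phi n.+1 x' y| <=
  (d x x')%:R * (2 * (total n.+1 - total n)).
Proof.
move=> fD xD; have [p [p0 pk] pP] := geodesic_exists sg cd x x'.
suff H i : (i <= d x x')%N -> \sum_(y \in D) `|phi n.+1 x y - phi n.+1 (p i) y| <=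
    i%:R * (2 * (total n.+1 - total n)) by have := H _ (leqnn _); rewrite pk.
have pD j : (j <= d x x')%N -> ball_set (p j) n.+1 `<=` D.
  move=> le y; rewrite /ball_set/= => dy; apply: xD; rewrite /ball_set/=.
  apply: leq_trans (dist_triangle sg cd x (p j) y) _; apply: leq_add => //.
  move: le; rewrite leq_eqVlt => /orP[/eqP ->|lt]; first by rewrite pk.
  by have [_ ->] := pP _ lt; exact: ltnW.
elim: i => [|i IH] lt.
  rewrite p0 mul0r fsbig1// => y _; by rewrite subrr normr0.
have [a _] := pP _ lt.
have S := phi_diff_sum (n := n) a fD (pD _ (ltnW lt)) (pD _ lt).
rewrite -natr1 mulrDl mul1r.
rewrite -[X in _ + X]S; apply: le_trans (lerD (IH (ltnW lt)) (lexx _)).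
rewrite -fsbig_split//; rewrite !fsbig_finite//= ; apply: ler_sum => y _.
by rewrite -[X in `|X|](subrKA (phi n.+1 (p i) y)) ler_normD.
Qed.

Lemma total_gt0 n : 0 < total n.
Proof. by rewrite ltr0n bin_gt0 leq_addl. Qed.

Lemma total_ratio n : (total n.+1 - total n) / total n.+1 = N%:R / (n.+1 + N)%:R.
Proof.
have := mul_bin_down (n.+1 + N) N; rewrite addSn /= -addSn addnK => /(congr1 (fun k => k%:R : R)).
rewrite !natrM -/(total n) -/(total n.+1) => E.
have n0 : (n.+1 + N)%:R != 0 :> R by rewrite pnatr_eq0.
have t0 := lt0r_neq0 (total_gt0 n.+1).
apply/eqP; rewrite eqr_div//; apply/eqP.
rewrite mulrBl [total n * _]mulrC E; rewrite natrD; ring.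
Qed.

End FixedOrientation.

(** Every wall separating [x] from [y] is crossed by an edge of a geodesic, so the
    interval condition on [y] can be tested inside the ball. *)
Lemma phi_local o o' n x y : orientation o -> orientation o' ->
  (forall a b, adj a b -> (d x a <= n)%N -> o a b <-> o' a b) -> phi o n x y = phi o' n x y.
Proof.
move=> ho ho' oo'.
have sub o1 o2 : orientation o1 -> orientation o2 ->
    (forall a b, adj a b -> (d x a <= n)%N -> o1 a b <-> o2 a b) ->
    (d x y <= n)%N -> interval o1 x y -> interval o2 x y.
  move=> h1 h2 o12 dy Iy a b ab na sb.
  have [p [p0 pk] pP] := geodesic_exists sg cd x y.
  have [i lt [ni si]] : exists2 i, (i < d x y)%N & ~ side a b (p i) /\ side a b (p i.+1).
    apply: contrapT => /forall2NP h.
    suff : forall i, (i <= d x y)%N -> ~ side a b (p i).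
      by move=> /(_ _ (leqnn _)); rewrite pk; apply.
    elim=> [_|i IH lt]; first by rewrite p0.
    by move=> s; case: (h i) => [/(_ lt)//|]; apply; split=> //; exact: IH (ltnW lt).
  have [pp Ei] := pP _ lt; have E := crossing_side sg cd ab pp ni si.
  apply: (orient_side h2 pp ab E); apply/o12 => //; first by rewrite Ei; lia.
  by apply: Iy => //; rewrite E.
have [dy|dy] := leqP (d x y) n; last first.
  by rewrite !phi_out// => -[_ h _]; move: dy; rewrite ltnNge h.
have outE : out o y = out o' y.
  by apply/seteqP; split=> z [yz oz]; split=> //; apply/oo'.
have II : interval o x y <-> interval o' x y.
  split; first exact: sub.
  by apply: sub => // a b ab da; split=> /(oo' _ _ ab da).
rewrite /phi /weight /outdeg outE; congr (if _ then _ else _).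
by apply: asbool_equiv_eq; split=> -[/II].
Qed.

Lemma phi_equivariant o o' n (f f' : V -> V) x y : cancel f f' -> cancel f' f ->
  (forall u v, adj u v -> adj (f u) (f v)) -> (forall u v, adj u v -> adj (f' u) (f' v)) ->
  (forall u v, d (f u) (f v) = d u v) -> (forall u v, adj u v -> o' (f u) (f v) <-> o u v) ->
  phi o' n (f x) (f y) = phi o n x y.
Proof.
move=> fK f'K fadj f'adj fd fo.
have sideE a b z : side (f a) (f b) (f z) <-> side a b z by rewrite /side/= !fd.
have outE : out o' (f y) = f @` out o y.
  apply/seteqP; split=> z; last by move=> [w [yw ow] <-]; split; [exact: fadj|exact/fo].
  move=> [yz oz]; exists (f' z); last exact: f'K.
  have ad : adj y (f' z) by rewrite -(fK y); exact: f'adj.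
  by split=> //; apply/(fo _ _ ad); rewrite f'K.
have degE : outdeg o' (f y) = outdeg o y.
  rewrite /outdeg outE fset_set_image; last exact: out_finite.
  by apply: card_imfset; exact: can_inj fK.
have II : interval o' (f x) (f y) <-> interval o x y.
  split=> Iy a b ab na sb.
    by apply/(fo _ _ ab); apply: Iy; [exact: fadj|move/sideE|exact/sideE].
  rewrite -(f'K a) -(f'K b) in ab na sb *.
  have ab' : adj (f' a) (f' b) by rewrite -(fK (f' a)) -(fK (f' b)); exact: f'adj.
  by apply/(fo _ _ ab'); apply: Iy => //; [move=> /sideE|apply/sideE].
rewrite /phi /weight degE fd; congr (if _ then _ else _).
apply: asbool_equiv_eq; rewrite /region /= fd.
by split=> -[Iy dy _]; split=> //; exact/II.
Qed.

End Weights.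

(** * From measures on vertices to measures on the group *)

Section OrbitMeasures.
Variables (R : realType) (G : groupType) (V : choiceType) (act : G -> V -> V).
Hypothesis act1 : forall v, act 1%g v = v.
Hypothesis actM : forall g h v, act (g * h)%g v = act g (act h v).
Hypothesis stab_finite : forall v, finite_set [set g | act g v = v].
Implicit Types (g h : G) (v w : V).

Let actK g v : act g^-1%g (act g v) = v.
Proof. by rewrite -actM mulVg act1. Qed.

Let actVK g v : act g (act g^-1%g v) = v.
Proof. by rewrite -actM mulgV act1. Qed.

Definition same_orbit v w := exists g, act g w = v.

Variable x0 : V.

(** The default value does not depend on [v], so that vertices in one orbit have
    the same representative. *)
Definition orbit_rep v : V := xget x0 [set w | same_orbit v w].

Lemma orbit_repP v : same_orbit v (orbit_rep v).
Proof.
have := @xgetPex _ x0 [set w | same_orbit v w]; apply.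
by exists v; exists 1%g.
Qed.

Lemma orbit_rep_act g v : orbit_rep (act g v) = orbit_rep v.
Proof.
rewrite /orbit_rep; congr xget; apply/seteqP; split=> w [h hw].
  by exists (g^-1 * h)%g; rewrite actM hw.
by exists (g * h)%g; rewrite actM hw.
Qed.

Definition carriers v : set G := [set g | act g (orbit_rep v) = v].

Lemma carriers_act g v : carriers (act g v) = (fun h => (g * h)%g) @` carriers v.
Proof.
apply/seteqP; split=> h; rewrite /carriers/= ?orbit_rep_act.
  by move=> hv; exists (g^-1 * h)%g; rewrite ?mulVKg// /carriers/= actM hv actK.
by move=> [k kv <-]; rewrite actM kv.
Qed.

Lemma carriers_finite v : finite_set (carriers v).
Proof.
have [g gv] := orbit_repP v.
apply: (@sub_finite_set _ _ ((fun h => (g * h)%g) @` [set h | act h (orbit_rep v) = orbit_rep v])).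
  move=> h hv; exists (g^-1 * h)%g; last by rewrite mulVKg.
  by rewrite /= actM hv -{1}gv actK.
exact: finite_image.
Qed.

Definition ncarriers v := #|` fset_set (carriers v)|.

Lemma ncarriers_gt0 v : (0 < ncarriers v)%N.
Proof.
rewrite cardfs_gt0; have [g gv] := orbit_repP v; apply/fset0Pn; exists g.
by rewrite in_fset_set ?inE//; exact: carriers_finite.
Qed.

Lemma ncarriers_act g v : ncarriers (act g v) = ncarriers v.
Proof.
rewrite /ncarriers carriers_act fset_set_image; last exact: carriers_finite.
by apply: card_imfset; exact: mulgI.
Qed.

(** The uniform measure on the group elements carrying the representative of the
    orbit of [v] to [v]. *)
Definition orbit_mass v g : R :=
  if `[< carriers v g >] then (ncarriers v)%:R^-1 else 0.

Lemma orbit_mass_ge0 v g : 0 <= orbit_mass v g.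
Proof. by rewrite /orbit_mass; case: ifP => // _; rewrite invr_ge0. Qed.

Lemma orbit_mass_act g v h : orbit_mass (act g v) h = orbit_mass v (g^-1 * h)%g.
Proof.
rewrite /orbit_mass ncarriers_act; congr (if _ then _ else _).
apply: asbool_equiv_eq; rewrite carriers_act; split=> [[k kv <-]|hv].
  by rewrite mulKg.
by exists (g^-1 * h)%g; rewrite ?mulVKg.
Qed.

Lemma orbit_mass_sum v (E : set G) : finite_set E -> carriers v `<=` E ->
  \sum_(g \in E) orbit_mass v g = 1.
Proof.
move=> fE vE; rewrite -(@fsbig_widen _ _ _ _ (carriers v))//; last first.
  by move=> g [_ ng]; rewrite /orbit_mass/= asboolF.
rewrite (eq_fsbigr (fun=> (ncarriers v)%:R^-1)); last first.
  by move=> g /set_mem gv; rewrite /orbit_mass asboolT.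
rewrite fsbig_finite; last exact: carriers_finite.
rewrite big_const_seq count_predT iter_addr addr0 -[LHS]mulr_natr mulVf//.
by rewrite pnatr_eq0 -lt0n; exact: ncarriers_gt0.
Qed.

Section Push.
Variables (D : set V) (mu : V -> R).
Hypothesis fD : finite_set D.

Definition push_mass g : R := \sum_(v \in D) mu v * orbit_mass v g.

Definition push_range : set G := \bigcup_(v in D) carriers v.

Lemma push_range_finite : finite_set push_range.
Proof. by apply: bigcup_finite => // v _; exact: carriers_finite. Qed.

Lemma push_mass_out g : ~ push_range g -> push_mass g = 0.
Proof.
move=> ng; apply: fsbig1 => v Dv; rewrite /orbit_mass asboolF ?mulr0// => gv.
by apply: ng; exists v.
Qed.

Lemma push_support : finite_set [set g | push_mass g != 0].
Proof.
apply: sub_finite_set push_range_finite => g /=; apply: contraNP => ng.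
by rewrite push_mass_out.
Qed.

Lemma push_ge0 g : (forall v, 0 <= mu v) -> 0 <= push_mass g.
Proof. by move=> mu0; apply: fsumr_ge0 => v _; rewrite mulr_ge0// orbit_mass_ge0. Qed.

Lemma push_sum (E : set G) : finite_set E -> push_range `<=` E ->
  \sum_(g \in E) push_mass g = \sum_(v \in D) mu v.
Proof.
move=> fE rE; rewrite /push_mass exchange_fsbig//; apply: eq_fsbigr => v /set_mem Dv.
rewrite -mulr_fsumr orbit_mass_sum ?mulr1//.
by move=> g gv; apply: rE; exists v.
Qed.

Lemma push_sumT : \sum_(g \in [set: G]) push_mass g = \sum_(v \in D) mu v.
Proof.
rewrite -(@fsbig_widen _ _ _ _ push_range)//; last by move=> g [_ /push_mass_out].
by apply: push_sum => //; exact: push_range_finite.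
Qed.

End Push.

Lemma push_norm (D : set V) (mu : V -> R) : finite_set D ->
  l1norm (push_mass D mu) <= \sum_(v \in D) `|mu v|.
Proof.
move=> fD; rewrite /l1norm -(@fsbig_widen _ _ _ _ (push_range D))//; last first.
  by move=> g [_ ng] /=; rewrite push_mass_out// normr0.
have fE := push_range_finite fD.
rewrite -(@push_sum D (fun v => `|mu v|) fD (push_range D) fE)//.
rewrite !fsbig_finite//; apply: ler_sum => g _; rewrite /push_mass !fsbig_finite//.
apply: le_trans (ler_norm_sum _ _ _) _; apply: ler_sum => v _.
by rewrite normrM (ger0_norm (orbit_mass_ge0 _ _)).
Qed.

Lemma push_act g (D D' : set V) (mu mu' : V -> R) : finite_set D -> finite_set D' ->
  (forall v, mu' (act g v) = mu v) ->
  (forall v, mu v != 0 -> D v) -> (forall v, mu' v != 0 -> D' v) ->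
  forall h, push_mass D' mu' h = push_mass D mu (g^-1 * h)%g.
Proof.
move=> fD fD' mm muD mu'D' h.
have toT E (nu : V -> R) k : (forall v, nu v != 0 -> E v) ->
    push_mass E nu k = \sum_(v \in [set: V]) nu v * orbit_mass v k.
  move=> nuE; apply: fsbig_widen => // v [_ nEv] /=.
  have -> : nu v = 0 by apply/eqP; apply: contra_notT nEv => /nuE.
  by rewrite mul0r.
rewrite !toT// (@reindex_fsbigT _ _ _ V V (act g)) /=; last first.
  by exists (act g^-1%g) => v; [exact: actK|exact: actVK].
by apply: eq_fsbigr => v _; rewrite mm orbit_mass_act.
Qed.

End OrbitMeasures.

(** * Amenability of the action on the nonterminating ultrafilters *)

Section BorelAmenability.
Import Defs.
Context {R : realType} (X : cubeComplex R) (G : groupClosed (aut X)).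
Local Notation vert := (vert X).
Local Notation vx := (@vx R X).
Local Notation adj := (adj vx).
Local Notation sq := (sq vx).
Variable d : vert -> vert -> nat.
Variable N : nat.
Hypothesis cs : cube_system vx.
Hypothesis cd : cube_distance adj sq d.
Hypothesis dimN : forall c : cell X, (dim c <= N)%N.
Hypothesis lf : locally_finite X.
Hypothesis proper : acts_properly G.
Let sg := cube_system_squares cs.
Let nbf := locally_finite_adj lf.

(** The edge from [u] to [v] leads towards [a]. *)
Definition towards (a : ultraNT X) (u v : vert) : Prop := sval a (hs (side d u v)).

Lemma towards_orientation a : orientation adj sq d N (towards a).
Proof.
have ua : ultrafilter (sval a) by case: a => a' [].
split.
- by move=> u v uv; exact: (ultrafilter_total cs cd ua uv).
- by move=> u v uv; exact: (ultrafilter_excl cs cd ua uv).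
- by move=> u v u' v' _ _ E; rewrite /towards E.
- by move=> x y y' xy xy' yy' oy oy'; exact: (ultrafilter_square cs cd ua xy xy' yy' oy oy').
- move=> x S HS; apply: (dimension_bound cs dimN (x := x)) => [u /HS[]//|u v uS vS uv].
  have [xu ou] := HS _ uS; have [xv ov] := HS _ vS.
  exact: (ultrafilter_square cs cd ua xu xv uv ou ov).
Qed.

Definition group_act (g : subgroup G) (v : vert) : vert := aut_vert (val g) v.

Lemma group_act1 v : group_act 1%g v = v.
Proof. by apply: vert_eq. Qed.

Lemma group_actM g h v : group_act (g * h)%g v = group_act g (group_act h v).
Proof. by apply: vert_eq. Qed.

Lemma group_stab_finite v : finite_set [set g | group_act g v = v].
Proof.
have := @proper [set sval v] (@compact_set1 _ (sval v)) => fin.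
apply: (@sub_finite_set _ _ ((val : subgroup G -> aut X) @^-1`
  [set g : aut X | g \in G /\ (g @` [set sval v]) `&` [set sval v] !=set0])).
  move=> g gv; split; first exact: (valP g).
  by exists (sval v); split=> //; exists (sval v) => //; rewrite -{2}gv.
by apply: finite_preimage => // g h _ _; exact: val_inj.
Qed.

Variable x0 : vert.

Definition mu a n (x y : vert) : R := phi R adj d N (towards a) n.+1 x y / total R N n.+1.

Lemma mu_ge0 a n x y : 0 <= mu a n x y.
Proof. by rewrite divr_ge0 ?phi_ge0// ltW// total_gt0. Qed.

Lemma mu_support a n x y : mu a n x y != 0 -> ball_set d x n.+1 y.
Proof. by rewrite mulf_eq0 negb_or => /andP[/phi_support]. Qed.

Lemma mu_sum a n x : \sum_(y \in ball_set d x n.+1) mu a n x y = 1.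
Proof.
rewrite /mu -mulr_fsuml (phi_sum _ sg cd nbf (towards_orientation a)) ?divff//.
  by rewrite gt_eqF// total_gt0.
exact: (ball_finite sg cd nbf).
Qed.

Lemma mu_act g a n x y : mu (subgroup_ultra_act g a) n (group_act g x) (group_act g y) =
  mu a n x y.
Proof.
rewrite /mu (phi_equivariant R N nbf (o := towards a) n.+1 x y
  (f := group_act g) (f' := group_act g^-1%g)) //.
- by move=> v; rewrite -group_actM mulVg group_act1.
- by move=> v; rewrite -group_actM mulgV group_act1.
- by move=> u v; exact: aut_vert_adj.
- by move=> u v; exact: aut_vert_adj.
- by move=> u v; exact: (dist_aut cs cd).
- by move=> u v _; exact: (ultra_act_hs cs cd).
Qed.

Local Notation push := (push_mass group_act x0).

Definition boundary_prob n a : finprob R (subgroup G) :=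
  let fb := ball_finite sg cd nbf x0 n.+1 in
  @FinProb R (subgroup G) (push (ball_set d x0 n.+1) (mu a n x0))
    (fun g => push_ge0 group_act x0 (ball_set d x0 n.+1) g (mu_ge0 a n x0))
    (push_support group_act1 group_actM group_stab_finite x0 (mu a n x0) fb)
    (etrans (push_sumT group_act1 group_actM group_stab_finite x0 (mu a n x0) fb)
      (mu_sum a n x0)).

Lemma finprob_eq (T : choiceType) (m m' : finprob R T) : mass m = mass m' -> m = m'.
Proof.
case: m m' => [f f0 ff f1] [g g0 gf g1] /= E; subst g.
by congr FinProb; exact: Prop_irrelevance.
Qed.

(** Translating by [g] turns the measure of [a] seen from [x0] into the measure
    of its image seen from the image of [x0]; moving the viewpoint back to [x0]
    costs what [phi_lipschitz] allows. *)
Lemma boundary_prob_equivariance n a g :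
  l1norm (fun h => boundary_prob n (subgroup_ultra_act g a) h -
    boundary_prob n a (g^-1 * h)%g) <=
  (d x0 (group_act g x0))%:R * 2 * (N%:R / (n.+1 + N)%:R).
Proof.
set ga := subgroup_ultra_act g a; set gx := group_act g x0.
pose D := ball_set d x0 (d x0 gx + n.+1).
have fD : finite_set D by exact: (ball_finite sg cd nbf).
have subx : ball_set d x0 n.+1 `<=` D.
  by move=> y; rewrite /D /ball_set /= => h; apply: leq_trans h (leq_addl _ _).
have subgx : ball_set d gx n.+1 `<=` D.
  move=> y; rewrite /D /ball_set /= => h.
  by apply: leq_trans (dist_triangle sg cd x0 gx y) _; rewrite leq_add2l.
have E1 h : boundary_prob n ga h = push D (mu ga n x0) h.
  apply: fsbig_widen => // v [_ nv] /=.
  have -> : mu ga n x0 v = 0 by apply/eqP; apply: contra_notT nv => /mu_support.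
  by rewrite mul0r.
have E2 h : boundary_prob n a (g^-1 * h)%g = push D (mu ga n gx) h.
  apply/esym; apply: (push_act group_act1 group_actM group_stab_finite) => //.
  - exact: (ball_finite sg cd nbf).
  - by move=> v; exact: mu_act.
  - by move=> v; exact: mu_support.
  - by move=> v /mu_support; exact: subgx.
have -> : (fun h => boundary_prob n ga h - boundary_prob n a (g^-1 * h)%g) =
    push D (fun v => mu ga n x0 v - mu ga n gx v).
  apply/funext => h; rewrite E1 E2 /push_mass !fsbig_finite// -sumrB.
  by apply: eq_bigr => v _; rewrite mulrBl.
apply: le_trans (push_norm group_act1 group_actM group_stab_finite x0 _ fD) _.
have tot := total_gt0 R N n.+1.
have -> : \sum_(v \in D) `|mu ga n x0 v - mu ga n gx v| =
    (\sum_(v \in D) `|phi R adj d N (towards ga) n.+1 x0 v -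
       phi R adj d N (towards ga) n.+1 gx v|) / total R N n.+1.
  rewrite mulr_fsuml; apply: eq_fsbigr => v _.
  by rewrite /mu -mulrBl normrM [X in _ * X]ger0_norm// invr_ge0 ltW.
rewrite -total_ratio ler_pdivrMr// -!mulrA mulVf ?gt_eqF// mulr1.
exact: (phi_lipschitz R sg cd nbf (towards_orientation ga) fD).
Qed.

Lemma boundary_prob_asymptotic a :
  asymptotically_equivariant_at (@subgroup_ultra_act R X G) boundary_prob a.
Proof.
move=> g; pose K : R := (d x0 (group_act g x0))%:R * 2 * N%:R.
apply: (@squeeze_cvgr _ _ _ _ (fun=> 0) (fun n => K * harmonic n)); last first.
- by rewrite -(mulr0 K); apply: cvgM; [exact: cvg_cst|exact: cvg_harmonic].
- exact: cvg_cst.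
- apply: nearW => n; apply/andP; split; first by apply: fsumr_ge0 => h _; exact: normr_ge0.
  apply: le_trans (boundary_prob_equivariance n a g) _.
  rewrite /K -[leRHS]mulrA ler_wpM2l ?mulr_ge0 ?ler0n// ler_wpM2l ?ler0n//.
  by rewrite /harmonic /= lef_pV2 ?posrE ?ltr0n// ler_nat leq_addr.
Qed.

Lemma ultra_halfspace_nbhs (a : ultraNT X) (h : set X) :
  nbhs a [set a' : ultraNT X | sval a' h <-> sval a h].
Proof.
have c1 : continuous (@ultra_indicator R X : ultraNT X -> {ptws set X -> bool}).
  exact: initial_continuous.
have c2 : continuous (proj h : {ptws set X -> bool} -> bool) by exact: proj_continuous.
have nb : nbhs (proj h (ultra_indicator a)) [set proj h (ultra_indicator a)].
  exact: discrete_set1.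
have H := c1 a _ (c2 (ultra_indicator a) _ nb).
apply: (@filterS _ (nbhs a) _ _ _ _ H) => a' /= E; rewrite /proj /ultra_indicator in E.
by split=> [/asboolP|/asboolP]; [rewrite E|rewrite -E] => /asboolP.
Qed.

(** Only the finitely many half-spaces bounded by walls through edges near [x0]
    enter, and each of them is a clopen condition on the ultrafilter. *)
Lemma boundary_prob_locally_constant n a :
  nbhs a [set a' | boundary_prob n a' = boundary_prob n a].
Proof.
pose E := \bigcup_(u in ball_set d x0 n.+1)
  ((fun v => hs (side d u v)) @` [set v | adj u v]).
have fE : finite_set E.
  apply: bigcup_finite; first exact: (ball_finite sg cd nbf).
  by move=> u _; apply: finite_image; exact: nbf.
have loc h : nbhs a [set a' : ultraNT X | sval a' h <-> sval a h].
  exact: ultra_halfspace_nbhs.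
have : nbhs a (\bigcap_(h in [set` fset_set E]) [set a' : ultraNT X | sval a' h <-> sval a h]).
  by apply: filter_bigI => h _; exact: loc.
apply: filterS => a' H; apply: finprob_eq => /=; apply/funext => g.
apply: eq_fsbigr => v _; congr (_ * _); rewrite /mu; congr (_ / _).
apply: (phi_local R sg cd v (towards_orientation a') (towards_orientation a)) => u w uw du.
apply: H; rewrite /= in_fset_set// inE; exists u => //; by exists w.
Qed.

Lemma boundary_prob_borel n : borel_map (boundary_prob n).
Proof.
move=> A _; apply: sub_sigma_algebra; rewrite /= openE => a Aa.
by apply: filterS (boundary_prob_locally_constant n a) => a' /= ->.
Qed.

End BorelAmenability.

Theorem theorem7p2 (R : realType) (X : cubeComplex R) (G : groupClosed (aut X)) :
  CAT0_cube_complex X -> irreducible X -> ~ Euclidean X -> unbounded X ->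
  locally_finite X -> finite_dimensional X ->
  discrete_subgroup G -> acts_properly G ->
  borel_amenable R (@subgroup_ultra_act R X G) /\
  universally_amenable R (@subgroup_ultra_act R X G).
Proof.
move=> cat0 _ _ _ lf [N dimN] _ proper.
have cs : cube_system (@vx R X) by apply: vx_cube_system; exact: cat0.2.
have [d cd] := CAT0_cube_distance cat0.
have [[[p _] _ _] _] := cat0; have [x0 _] := carrier_nonempty p.
have am : exists2 beta : nat -> ultraNT X -> finprob R (subgroup G),
    (forall n, borel_map (beta n)) &
    forall a, asymptotically_equivariant_at (@subgroup_ultra_act R X G) beta a.
  exists (boundary_prob cs cd dimN lf proper x0) => [n|a].
    exact: boundary_prob_borel.
  exact: boundary_prob_asymptotic.
split=> // b0 eta _; have [beta betaB betaE] := am.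
by exists beta => //; exact: aeW.
Qed.
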